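(* Let $\varepsilon_g,\varepsilon_H>0$. Assume that the retraction is second-order, that $f$ is $(\alpha,\beta,\gamma,\delta)$-strict saddle on $\mathcal{M}$ with $\mathcal{R}_3$ compact, that the pullback cubic bound holds with constant $L_H$ along the iterates, that $\|H_k\|\le\kappa_H$ for all iterates, and that there is $f^*>-\infty$ with $f(x)\ge f^*$ for all $x\in\mathcal{M}$. Then the Riemannian trust-region algorithm with exact subproblem minimization produces a point $x$ satisfying $\|\mathrm{grad} f(x)\|\le\varepsilon_g$ and $\lambda_{\min}(\mathrm{Hess} f(x))\ge-\varepsilon_H$ in at most $$\frac{1+\log_{\tau_2}(1/\tau_1)}{\log_{\tau_2}(1/\tau_1)}\left[\frac{C}{\min\left(\underline{\alpha}^2,\underline{\alpha}^{4/3}\underline{\beta},\underline{\alpha}^{4/3}\underline{\gamma},\underline{\alpha}^{2/3}\underline{\gamma}^2,\underline{\beta}^3,\underline{\beta}^2\underline{\gamma},\underline{\beta}\,\underline{\gamma}^2,\underline{\gamma}^3,\underline{\gamma}^2\underline{\delta}\right)}+1+\log_2\log_2\left(\frac{2\gamma^2}{\kappa_R\hat L_H\varepsilon_g}\right)\right]$$ $$+\frac{1}{\log_{\tau_2}(1/\tau_1)}\max\left(\log_{\tau_2}\left(\frac{1}{c_\Delta}\right),\ \log_{\tau_2}\left(\frac{\Delta_0}{c_\Delta\alpha^{1/2}}\right),\ \log_{\tau_2}\left(\frac{\Delta_0}{c_\Delta\alpha^{2/3}}\right),\ \log_{\tau_2}\left(\frac{\Delta_0}{c_\Delta\beta}\right),\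 \log_{\tau_2}\left(\frac{\Delta_0}{c_\Delta\gamma}\right)\right)$$ iterations, where the constant $C>0$ depends on $\kappa_H,c_\Delta,\Delta_0,\nu_R,\kappa_R,\hat L_H,\eta_1,c_Q$, and $\underline{\theta}=\min(1,\theta)$ for any $\theta\in\{\alpha,\beta,\gamma,\delta\}$.
   Context: Setting. $\mathcal{M}$ is an $n$-dimensional Riemannian manifold with Riemannian distance $\mathrm{dist}$; $f:\mathcal{M}\to\mathbb{R}$ is twice continuously differentiable with Riemannian gradient $\mathrm{grad} f$ and Riemannian Hessian $\mathrm{Hess} f$; $\lambda_{\min}$ denotes the smallest eigenvalue. A retraction $R_x:T_x\mathcal{M}\to\mathcal{M}$ is given, possibly defined only on the ball of radius $\varrho(x)>0$ around $0\in T_x\mathcal{M}$. The pullback at $x$ is $\hat f_x=f\circ R_x$, and $\hat f_k=\hat f_{x_k}$; $\nabla,\nabla^2$ denote its Euclidean gradient and Hessian on the tangent space. The retraction is second-order if each curve $t\mapsto R_x(ts)$ has zero intrinsic acceleration at $t=0$ (then $\nabla^2\hat f_x(0)=\mathrm{Hess} f(x)$). Strict saddle. A set $S\subset\mathcal{M}$ is geodesically convex if any two points of $S$ are joined by a geodesic segment contained in $S$; $f$ is geodesically $\gamma$-strongly convex on $S$ if $S$ is geodesically convex and for each geodesic $c:[0,1]\to S$ of length $L(c)>0$, $f\circ c$ is strongly convex with modulus $\gamma L(c)^2$. For $\alpha,\beta,\gamma,\delta>0$ let $\mathcal{R}_1=\{x:\|\mathrm{grad} f(x)\|\ge\alpha\}$,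 $\mathcal{R}_2=\{x:\lambda_{\min}(\mathrm{Hess} f(x))\le-\beta\}$, and $\mathcal{R}_3$ the set of $x$ for which there is a local minimizer $x^*$ of $f$ with $\mathrm{dist}(x,x^* )\le\delta$ and $f$ geodesically $\gamma$-strongly convex on $\{y:\mathrm{dist}(x^*,y)<2\delta\}$. $f$ is $(\alpha,\beta,\gamma,\delta)$-strict saddle if $\mathcal{M}=\mathcal{R}_1\cup\mathcal{R}_2\cup\mathcal{R}_3$. Algorithm (Riemannian trust-region, exact subproblem). Inputs: $x_0\in\mathcal{M}$, $0<\Delta_0<\bar\Delta$, $0<\eta_1<\eta_2<1$, $0<\tau_1<1<\tau_2$. For $k=0,1,2,\dots$: with $g_k=\mathrm{grad} f(x_k)$, $H_k=\nabla^2\hat f_k(0)$ and $m_k(s)=f(x_k)+\langle s,g_k\rangle+\frac12\langle s,H_ks\rangle$, let $s_k$ be a global minimizer of $m_k$ over $\{s\in T_{x_k}\mathcal{M}:\|s\|\le\Delta_k\}$. Let $\rho_k=\frac{f(x_k)-f(R_{x_k}(s_k))}{m_k(0)-m_k(s_k)}$. Set $x_{k+1}=R_{x_k}(s_k)$ if $\rho_k\ge\eta_1$ (the iteration is then called successful), $x_{k+1}=x_k$ otherwise. Set $\Delta_{k+1}=\min(\tau_2\Delta_k,\bar\Delta)$ if $\rho_k>\eta_2$, $\Delta_{k+1}=\Delta_k$ if $\eta_2\ge\rho_k\ge\eta_1$, $\Delta_{k+1}=\tau_1\Delta_k$ otherwise. Pullback cubic bound with constant $L_H>0$: for all iterates $x_k$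 and all $s\in T_{x_k}\mathcal{M}$ with $\|s\|\le\varrho(x_k)$, $f(R_{x_k}(s))\le f(x_k)+\langle s,\mathrm{grad} f(x_k)\rangle+\frac12\langle s,\nabla^2\hat f_k(0)[s]\rangle+\frac{L_H}{6}\|s\|^3$; moreover $\Delta_k\le\varrho(x_k)$ for all $k$. Constants (they exist when $\mathcal{R}_3$ is compact). $\hat L_H>0$ is such that $\|\nabla\hat f_k(s_k)-\nabla\hat f_k(0)-\nabla^2\hat f_k(0)[s_k]\|\le\frac{\hat L_H}{2}\|s_k\|^2$ for all iterates $x_k\in\mathcal{R}_3$. $\kappa_R>1$ and $\nu_R>0$ are such that $\|\mathrm{grad} f(R_x(s))\|\le\kappa_R\|\nabla\hat f_x(s)\|$ for $x\in\mathcal{R}_3$, $\|s\|\le\nu_R$. $\nu_S,\kappa_S>0$ are such that $\mathrm{dist}(x,R_x(s))\le\kappa_S\|s\|$ for $x\in\mathcal{R}_3$, $\|s\|\le\nu_S$. $c_\Delta=\min\left(1,\tau_1\sqrt{\tfrac{3(1-\eta_1)}{L_H}},\tau_1\sqrt[3]{\tfrac{3(1-\eta_1)}{\kappa_HL_H}},3\tau_1\tfrac{1-\eta_1}{L_H}\right)$ and $c_Q=\min\left(\tfrac{3(1-\eta_1)}{L_H},\nu_R,\tfrac1{\kappa_S},\tfrac12,\tfrac1{\kappa_R\hat L_H}\right)$.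
   Formalization: The constant C may also depend on f(x_0) − f^*, without which the bound fails on long slopes, and the term log_2 log_2(2γ²/(κ_R L̂_H ε_g)) is replaced by 0 where it is negative or undefined. *)

(* Defs.v *)
From HB Require Import structures.
From mathcomp Require Import all_boot all_order all_algebra.
From mathcomp Require Import all_classical all_reals all_analysis.

Set Implicit Arguments.
Unset Strict Implicit.
Unset Printing Implicit Defensive.

Import Order.TTheory GRing.Theory Num.Theory.
Import numFieldNormedType.Exports.

Local Open Scope classical_set_scope.
Local Open Scope ring_scope.

Definition partial (R : realType) (m : nat) (V : normedModType R) (i : 'I_m)
    (F : 'rV[R]_m -> V) (u : 'rV[R]_m) : V := 'D_(delta_mx 0 i) F u.

(* C^k on an open set U: only the germs of F at the points of U matter. *)
Fixpoint Ck (R : realType) (m : nat) (V : normedModType R) (k : nat)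
    (U : set 'rV[R]_m) (F : 'rV[R]_m -> V) : Prop :=
  match k with
  | 0%N => forall u, U u -> {for u, continuous F}
  | k'.+1 => (forall u, U u -> differentiable F u) /\
             (forall i : 'I_m, Ck k' U (partial i F))
  end.

Definition smooth (R : realType) (m : nat) (V : normedModType R)
    (U : set 'rV[R]_m) (F : 'rV[R]_m -> V) : Prop := forall k, Ck k U F.

(* A C^oo n-dimensional Riemannian manifold.  The atlas is indexed by the
   points, [phi x] being a chart around [x] (by choice, every atlas contains
   such a family).  The tangent space T_x M is represented by 'rV[R]_n: a vector
   is the row of its coordinates in the chart [phi x].  The maps are total, but
   only the values of [phi x] on [dom x], and of [psi x] and [gram x] on
   [phi x @` dom x], are meaningful.  [gram x u] is the matrix of the metric at
   the point [psi x u] in the coordinates of the chart [phi x]. *)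
Record riemannianManifold (R : realType) (n : nat) := RiemannianManifold {
  carrier :> topologicalType;
  dom : carrier -> set carrier;
  phi : carrier -> carrier -> 'rV[R]_n;
  psi : carrier -> 'rV[R]_n -> carrier;
  gram : carrier -> 'rV[R]_n -> 'M[R]_n;
  manifold_hausdorff : hausdorff_space carrier;
  manifold_second_countable : @second_countable carrier;
  dom_center : forall x, dom x x;
  dom_open : forall x, open (dom x);
  cod_open : forall x, open (phi x @` dom x);
  phiK : forall x p, dom x p -> psi x (phi x p) = p;
  phi_continuous : forall x p, dom x p -> {for p, continuous (phi x)};
  psi_continuous : forall x u, (phi x @` dom x) u -> {for u, continuous (psi x)};
  transition_smooth : forall x y,
    smooth (phi x @` (dom x `&` dom y)) (phi y \o psi x);
  gram_smooth : forall x i j, smooth (phi x @` dom x) (fun u => gram x u i j);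
  gram_sym : forall x u, (phi x @` dom x) u -> (gram x u)^T = gram x u;
  gram_pos : forall x u, (phi x @` dom x) u ->
    forall v : 'rV[R]_n, v != 0 -> 0 < (v *m gram x u *m v^T) 0 0;
  gram_change : forall x y u, (phi x @` (dom x `&` dom y)) u ->
    gram x u = 'J (phi y \o psi x) u *m gram y (phi y (psi x u))
               *m ('J (phi y \o psi x) u)^T
}.

Section Geometry.
Variables (R : realType) (n : nat) (M : riemannianManifold R n).
Implicit Types (x y : M) (c : R -> M) (f : M -> R) (S : set M).
Implicit Types (u v : 'rV[R]_n) (A : 'M[R]_n).

Definition metric x : 'M[R]_n := gram x (phi x x).

Definition inner x v (w : 'rV[R]_n) : R := (v *m metric x *m w^T) 0 0.

Definition tnorm x v : R := Num.sqrt (inner x v v).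

(* Linear operators on T_x M are matrices acting on rows by v |-> v *m A. *)
Definition opnorm x A : R :=
  sup [set tnorm x (v *m A) | v in [set v | tnorm x v <= 1]].

Definition lambda_min A : R := inf [set a | eigenvalue A a].

Definition christoffel y u (k i j : 'I_n) : R :=
  2^-1 * \sum_(l < n) invmx (gram y u) k l *
    (partial i (fun w => gram y w j l) u + partial j (fun w => gram y w i l) u
     - partial l (fun w => gram y w i j) u).

(* Gradient and Hessian (a self-adjoint operator) of a function on the Euclidean
   space T_x M with inner product [inner x]. *)
Definition egrad x (h : 'rV[R]_n -> R) v : 'rV[R]_n :=
  (\row_i partial i h v) *m invmx (metric x).

Definition ehess x (h : 'rV[R]_n -> R) v : 'M[R]_n :=
  (\matrix_(i, j) partial i (partial j h) v) *m invmx (metric x).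

Definition C2_fun f : Prop := forall x, Ck 2 (phi x @` dom x) (f \o psi x).

Definition grad f x : 'rV[R]_n :=
  (\row_i partial i (f \o psi x) (phi x x)) *m invmx (metric x).

Definition hess f x : 'M[R]_n :=
  (\matrix_(i, j) (partial i (partial j (f \o psi x)) (phi x x)
     - \sum_(k < n) christoffel x (phi x x) k i j
                    * partial k (f \o psi x) (phi x x)))
  *m invmx (metric x).

(* Curves are given on R, and regularity is required at each point of [0, 1],
   i.e. on a neighbourhood of it.  By smoothness of the transition maps and the
   transformation law of the Christoffel symbols, the local conditions do not
   depend on the chart [phi y]. *)
Definition C1_curve c : Prop :=
  forall t : R, t \in `[0, 1] -> exists y, \forall r \near t,
    [/\ dom y (c r), derivable (phi y \o c) r 1
      & {for r, continuous (derive1 (phi y \o c))}].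

Definition velocity c t : 'rV[R]_n := derive1 (phi (c t) \o c) t.

Definition curve_length c : R :=
  \int[lebesgue_measure]_(t in `[0, 1]) tnorm (c t) (velocity c t).

(* Piecewise C^1 curves, as concatenations of C^1 curves; the last argument is
   the total length. *)
Inductive joined : M -> M -> R -> Prop :=
| joined_refl x : joined x x 0
| joined_step c y l : C1_curve c -> joined (c 1) y l ->
    joined (c 0) y (curve_length c + l).

(* +oo between distinct connected components *)
Definition dist x y : \bar R := ereal_inf [set l%:E | l in joined x y].

(* Covariant derivative of the velocity, in the coordinates of the chart phi y. *)
Definition acceleration y c t : 'rV[R]_n :=
  let q := phi y \o c in
  \row_k (derive1 (derive1 q) t 0 k + \sum_(i < n) \sum_(j < n)
            christoffel y (q t) k i j * derive1 q t 0 i * derive1 q t 0 j).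

(* The segment is c restricted to [0, 1]. *)
Definition geodesic c : Prop :=
  forall t : R, t \in `[0, 1] -> exists y, \forall r \near t,
    [/\ dom y (c r), derivable (phi y \o c) r 1,
        derivable (derive1 (phi y \o c)) r 1 & acceleration y c r = 0].

Definition geodesically_convex S : Prop :=
  forall x y, S x -> S y -> exists c,
    [/\ geodesic c, c 0 = x, c 1 = y & forall t : R, t \in `[0, 1] -> S (c t)].

Definition strongly_convex01 (mu : R) (h : R -> R) : Prop :=
  forall a b l : R, a \in `[0, 1] -> b \in `[0, 1] -> l \in `[0, 1] ->
    h ((1 - l) * a + l * b) <=
    (1 - l) * h a + l * h b - mu / 2 * l * (1 - l) * (a - b) ^+ 2.

Definition geodesically_strongly_convex (gamma : R) f S : Prop :=
  geodesically_convex S /\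
  forall c, geodesic c -> (forall t : R, t \in `[0, 1] -> S (c t)) ->
    0 < curve_length c ->
    strongly_convex01 (gamma * curve_length c ^+ 2) (f \o c).

Definition local_minimizer f x : Prop := \forall y \near x, f x <= f y.

Definition region1 f (alpha : R) : set M := [set x | alpha <= tnorm x (grad f x)].

Definition region2 f (beta : R) : set M :=
  [set x | lambda_min (hess f x) <= - beta].

Definition region3 f (gamma delta : R) : set M :=
  [set x | exists xs, [/\ local_minimizer f xs, (dist x xs <= delta%:E)%E
    & geodesically_strongly_convex gamma f
        [set y | (dist xs y < (2 * delta)%:E)%E]]].

Definition strict_saddle f (alpha beta gamma delta : R) : Prop :=
  region1 f alpha `|` region2 f beta `|` region3 f gamma delta = [set: M].

Section Retraction.
Variables (Rt : M -> 'rV[R]_n -> M) (radius : M -> \bar R).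

Definition in_ball x v : Prop := ((tnorm x v)%:E <= radius x)%E.

(* Rt in bundle coordinates: w = (u, v) stands for the tangent vector at the
   point psi x u with coordinates v in the chart phi x; the Jacobian converts v
   to the coordinates used for the tangent space at psi x u. *)
Definition retr_bundle x (w : 'rV[R]_(n + n)) : M :=
  let p := psi x (lsubmx w) in
  Rt p (rsubmx w *m 'J (phi p \o psi x) (lsubmx w)).

(* Smoothness is joint in the point and the vector, at every (x, v) of the
   domain {|v|_x <= radius x}; Rt is arbitrary away from the domain. *)
Definition retraction : Prop :=
  [/\ forall x, (0 < radius x)%E,
      forall x, Rt x 0 = x,
      forall x v, 'D_v (phi x \o Rt x) 0 = v
    & forall x v, in_ball x v -> exists W : set 'rV[R]_(n + n),
        [/\ open W, W (row_mx (phi x x) v),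
            forall w, W w -> (phi x @` dom x) (lsubmx w) /\
                             dom (Rt x v) (retr_bundle x w)
          & smooth W (phi (Rt x v) \o retr_bundle x)]].

Definition second_order : Prop :=
  forall x v, acceleration x (fun t => Rt x (t *: v)) 0 = 0.

Definition pullback f x : 'rV[R]_n -> R := f \o Rt x.

Definition pgrad f x v : 'rV[R]_n := egrad x (pullback f x) v.

Definition phess0 f x : 'M[R]_n := ehess x (pullback f x) 0.

Definition model f x v : R :=
  f x + inner x v (grad f x) + 2^-1 * inner x v (v *m phess0 f x).

(* With the convention a / 0 = 0: the denominator vanishes only when x is
   already a second-order critical point of the pullback. *)
Definition ratio f x v : R := (f x - f (Rt x v)) / (model f x 0 - model f x v).

Definition subproblem_solution f x (D : R) v : Prop :=
  tnorm x v <= D /\ forall w, tnorm x w <= D -> model f x v <= model f x w.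

(* xs, ss, Ds: iterates, steps, trust-region radii *)
Definition rtr_run f (x0 : M) (D0 Dbar eta1 eta2 tau1 tau2 : R)
    (xs : nat -> M) (ss : nat -> 'rV[R]_n) (Ds : nat -> R) : Prop :=
  [/\ xs 0%N = x0, Ds 0%N = D0 &
    forall k, let rho := ratio f (xs k) (ss k) in
    [/\ subproblem_solution f (xs k) (Ds k) (ss k),
        xs k.+1 = (if eta1 <= rho then Rt (xs k) (ss k) else xs k)
      & Ds k.+1 = (if eta2 < rho then Num.min (tau2 * Ds k) Dbar
                   else if eta1 <= rho then Ds k else tau1 * Ds k)]].

Definition pullback_cubic_bound f (LH : R) (xs : nat -> M) (Ds : nat -> R) : Prop :=
  (forall k v, in_ball (xs k) v ->
     f (Rt (xs k) v) <= f (xs k) + inner (xs k) v (grad f (xs k))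
       + 2^-1 * inner (xs k) v (v *m phess0 f (xs k))
       + LH / 6 * tnorm (xs k) v ^+ 3) /\
  (forall k, ((Ds k)%:E <= radius (xs k))%E).

End Retraction.
End Geometry.

Section Constants.
Variable R : realType.
Implicit Types (b t A : R).

Definition log b t : R := ln t / ln b.

(* log2 (log2 A) when A >= 2; 0 otherwise (no iteration is then accounted for,
   and the double logarithm is negative or undefined). *)
Definition loglog2 A : R := Num.max 0 (log 2 (log 2 A)).

Definition minl (a : R) (s : seq R) : R := foldr Num.min a s.
Definition maxl (a : R) (s : seq R) : R := foldr Num.max a s.

Definition c_Delta (tau1 eta1 kappaH LH : R) : R :=
  minl 1 [:: tau1 * Num.sqrt (3 * (1 - eta1) / LH);
             tau1 * (3 * (1 - eta1) / (kappaH * LH)) `^ 3^-1;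
             3 * tau1 * ((1 - eta1) / LH)].

Definition c_Q (eta1 LH nuR kappaS kappaR hLH : R) : R :=
  minl (3 * (1 - eta1) / LH) [:: nuR; kappaS^-1; 2^-1; (kappaR * hLH)^-1].

Definition saddle_scale (alpha beta gamma delta : R) : R :=
  let a := Num.min 1 alpha in let b := Num.min 1 beta in
  let g := Num.min 1 gamma in let d := Num.min 1 delta in
  minl (a ^+ 2) [:: a `^ (4 / 3) * b; a `^ (4 / 3) * g; a `^ (2 / 3) * g ^+ 2;
                    b ^+ 3; b ^+ 2 * g; b * g ^+ 2; g ^+ 3; g ^+ 2 * d].

Definition iteration_bound (C alpha beta gamma delta epsg D0 tau1 tau2
    kappaR hLH cD : R) : R :=
  let l := log tau2 tau1^-1 in
  (1 + l) / l *
    (C / saddle_scale alpha beta gamma delta + 1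
     + loglog2 (2 * gamma ^+ 2 / (kappaR * hLH * epsg)))
  + l^-1 * maxl (log tau2 cD^-1)
             [:: log tau2 (D0 / (cD * alpha `^ 2^-1));
                 log tau2 (D0 / (cD * alpha `^ (2 / 3)));
                 log tau2 (D0 / (cD * beta));
                 log tau2 (D0 / (cD * gamma))].

End Constants.

(* Main.v *)
Require Import Defs.
From HB Require Import structures.
From mathcomp Require Import all_boot all_order all_algebra.
From mathcomp Require Import all_classical all_reals all_analysis.
From mathcomp Require Import ring lra.
Set Implicit Arguments.
Unset Strict Implicit.
Unset Printing Implicit Defensive.
Import Order.TTheory GRing.Theory Num.Theory.
Import numFieldNormedType.Exports.
Local Open Scope classical_set_scope.
Local Open Scope ring_scope.

(** Every iterate that is not yet an approximate second-order point lies in a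
    region where the model predicts a decrease: a step along the negative
    gradient in the first region ([cauchy_decrease]), along an eigenvector of
    negative curvature in the second ([eigen_decrease]), and, in the third, the
    minimizer [s] of a strongly convex model, which decreases it by at least
    [gamma / 2 * |s|^2] ([strong_decrease]).

    Radii.  For small radii the predicted decrease is at worst quadratic in the step
    length, while the cubic bound makes the model error cubic, so that a step
    is accepted once the radius is small enough; hence the radii stay above a floor
    ([floor_rejected_gradient], [floor_rejected_curvature]).  Since accepted steps
    multiply the radius by at most [tau2] and rejected ones by [tau1], the
    logarithm of the radius bounds the number of rejected steps by that of the
    accepted ones ([iterations_le_successes]).  It remains to count the latter.

    Geometry of the third region.  From every point there starts a geodesic in
    every direction (the Picard theorem, [geodesic_exists]), and its speed is
    constant ([geodesic_speed]); strong convexity of [f] along it bounds the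
    Hessian below by [gamma] ([hess_strongly_convex]).  As the retraction is
    second-order, the Hessian of the pullback at the origin defines the same
    quadratic form ([pullback_expansion]).  Moreover strong convexity along
    geodesics implies gradient dominance and quadratic growth around the
    minimizer ([gradient_dominance], [dist_le_growth]): the points of the ball of
    radius [2 delta] where [f] does not exceed [f x] lie within
    [|grad f x| / gamma] of the minimizer.  If this is at most [delta], a path
    that starts at [x] and keeps [f] below [f x] cannot leave the ball of radius
    [delta], since it would have to cross the shell between the two balls
    ([region3_path]).

    Two phases.  When the gradient is below a threshold [T] at a point of the third
    region, the step is a Newton step: it is interior, accepted, and shorter than
    [nuR], and the path [t |-> R_x (t s)] keeps [f] below [f x], so that the next
    iterate is again in the third region, with a gradient norm bounded by a
    multiple of the square of the present one.  From there on the convergence is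
    quadratic and takes at most [1 + log2 log2 (2 gamma^2 / (kappaR hLH epsg))]
    steps ([phase_length]).  Any earlier accepted step decreases [f] by a fixed
    [d = rate * scale], with [scale] the minimum in the denominator of the bound,
    unless it is a Newton step from a gradient above [T] to one below [T]; the next
    accepted step then decreases [f] by [d] or belongs to the final phase.  So
    there are at most [2 (f x0 - fstar) / d + 1] of them
    ([successes_before_phase]). *)

(** * Induction along a segment and the first order chain rule *)

(** Connectedness of the unit interval: the supremum of the initial segments on
    which [P] holds is [1], because [P] propagates in both directions near every
    point. *)
Lemma segment_induction (R : realType) (P : R -> Prop) :
  (forall t, t \in `[0, 1] -> exists2 e : R, 0 < e &
     forall r s, r \in `[0, 1] -> s \in `[0, 1] ->
       `|r - t| < e -> `|s - t| < e -> P r -> P s) ->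
  P 0 -> forall t, t \in `[0, 1] -> P t.
Proof.
move=> Ploc P0 t t01.
pose A : set R := [set u | 0 <= u <= 1 /\ forall r, 0 <= r <= u -> P r].
have A0 : A 0.
  split; first by rewrite lexx ler01.
  by move=> r; rewrite -eq_le => /eqP <-.
have supA : has_sup A by split; [exists 0 | exists 1 => u [/andP[]]].
have s0 : 0 <= sup A by apply: ub_le_sup => //; case: supA.
have s1 : sup A <= 1 by apply: ge_sup => //; [exists 0 | move=> u [/andP[]]].
have s01 : sup A \in `[0, 1] by rewrite in_itv /= s0 s1.
have [e e0 Pe] := Ploc _ s01.
have [u Au u_gt] := sup_adherent e0 supA.
case: (Au) => /andP[u0 u1] Pu.
have us : u <= sup A by apply: ub_le_sup => //; case: supA.
have step r : 0 <= r <= 1 -> r < sup A + e -> P r.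
  move=> /andP[r0 r1] re; have [ru|ur] := leP r u; first by apply: Pu; rewrite r0.
  apply: (Pe u r); rewrite ?in_itv /= ?u0 ?r0 //; last by apply: Pu; rewrite u0 lexx.
  - by rewrite ltr_distl u_gt /=; lra.
  - by rewrite ltr_distl re andbT; lra.
have A1 : A (Num.min 1 (sup A + e / 2)).
  split; first by rewrite le_min ler01 ge_min lexx /=; lra.
  move=> r /andP[r0]; rewrite le_min => /andP[r1 re].
  by apply: step; rewrite ?r0 ?r1 //; lra.
have := ub_le_sup supA.2 A1; rewrite ge_min => /orP[|]; last by lra.
move=> s1'; move: t01; rewrite in_itv /= => t01; apply: step => //.
by case/andP: t01; lra.
Qed.

Section Partials.
Variables (R : realType) (m : nat) (V : normedModType R).
Implicit Types (F : 'rV[R]_m -> V) (p w : 'rV[R]_m).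

Lemma derive_partials F p w : differentiable F p ->
  'D_w F p = \sum_i w 0 i *: partial i F p.
Proof.
move=> dF; rewrite deriveE // {1}[w]row_sum_delta linear_sum /=.
by apply: eq_bigr => i _; rewrite linearZ /partial deriveE.
Qed.

Lemma is_derive_comp_rV (U : normedModType R) F (q : U -> 'rV[R]_m) t v :
  differentiable F (q t) -> differentiable q t ->
  is_derive t v (F \o q) (\sum_i ('D_v q t) 0 i *: partial i F (q t)).
Proof.
move=> dF dq; apply: DeriveDef.
  by apply: diff_derivable; exact: differentiable_comp.
rewrite -(derive_partials _ dF) deriveE; last exact: differentiable_comp.
by rewrite (diff_comp dq dF) (deriveE _ dF) (deriveE _ dq).
Qed.

Lemma is_derive_comp_curve F (q : R -> 'rV[R]_m) t :
  differentiable F (q t) -> derivable q t 1 ->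
  is_derive t 1 (F \o q) (\sum_i (derive1 q t) 0 i *: partial i F (q t)).
Proof.
move=> dF /derivable1_diffP dq; rewrite derive1E; exact: is_derive_comp_rV.
Qed.

End Partials.

(** * Symmetry of second derivatives *)

Section TwiceDifferentiable.
Variable R : realType.

(** Weaker than being C^2 near [u]: nothing is asked of the second derivatives away
    from [u].  It is enough for the symmetry of the second derivatives and for the
    second order chain rule. *)
Definition twice_differentiable_at m (V : normedModType R)
    (F : 'rV[R]_m -> V) (u : 'rV[R]_m) : Prop :=
  (\forall w \near u, differentiable F w) /\
  (forall i, differentiable (partial i F) u).

Lemma differentiable_expansion (U V : normedModType R) (G : U -> V) u e :
  differentiable G u -> 0 < e ->
  \forall w \near 0, `|G (w + u) - G u - 'd G u w| <= e * `|w|.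
Proof.
move=> /diff_locallyP[_ /eqaddoP/(_ e)] GE e0.
have := GE e0; apply: filterS => w.
by rewrite !fctE /= opprD addrA.
Qed.

Lemma norm_delta_rV m (i : 'I_m) : `|delta_mx 0 i : 'rV[R]_m| <= 1.
Proof.
rewrite [leLHS]/Num.Def.normr/= mx_normrE bigmax_le // => -[k l] _ /=.
by rewrite mxE; case: (_ && _); rewrite ?normr1 ?normr0.
Qed.

Lemma is_derive_line m (u v : 'rV[R]_m) (t : R) :
  is_derive t 1 (fun s : R => s *: v + u) v.
Proof.
have dl : is_derive t 1 ( *:%R^~ v : R -> 'rV[R]_m) v.
  apply: DeriveDef; first by apply: diff_derivable; exact: ex_diff.
  by rewrite deriveE; [rewrite diff_val scale1r | exact: ex_diff].
have := @is_deriveD _ _ _ ( *:%R^~ v : R -> 'rV[R]_m) (cst u) t 1 _ _ dl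
  (is_derive_cst u t 1).
by rewrite addr0.
Qed.

(** Only the differentiability of the partial derivatives at the point itself
    matters: by the mean value theorem, the second difference of [F] over the
    square spanned by [h e_i] and [h e_j] is [h] times an increment of the [i]-th
    partial derivative, and this derivative has a first order expansion. *)
Lemma second_difference m (F : 'rV[R]_m -> R) u i j e :
  twice_differentiable_at F u -> 0 < e ->
  \forall h \near 0^'+,
   `|F (h *: delta_mx 0 i + (h *: delta_mx 0 j + u)) - F (h *: delta_mx 0 i + u)
     - F (h *: delta_mx 0 j + u) + F u
     - h ^+ 2 * partial j (partial i F) u| <= e * h ^+ 2.
Proof.
move=> [dF dpF] e0; set ei := delta_mx 0 i; set ej := delta_mx 0 j.
have e30 : 0 < e / 3 by rewrite divr_gt0.
have := differentiable_expansion (dpF i) e30.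
move=> /nbhs_ballP[d1 /= d10 Hexp].
have /nbhs_ballP[d2 /= d20 HdF] := dF.
near=> h.
have h0 : 0 < h by near: h; exact: nbhs_right_gt.
have hd1 : 2 * h < d1.
  rewrite -ltr_pdivlMl // mulrC; near: h; apply: nbhs_right_lt.
  by rewrite divr_gt0.
have hd2 : 2 * h < d2.
  rewrite -ltr_pdivlMl // mulrC; near: h; apply: nbhs_right_lt.
  by rewrite divr_gt0.
have n1 := norm_delta_rV i; have n2 := norm_delta_rV j.
have small b t : 0 <= t <= h -> 0 <= b <= h -> `|t *: ei + b *: ej| <= t + b.
  move=> /andP[t0 th] /andP[b0 bh]; apply: le_trans (ler_normD _ _) _.
  by rewrite !normrZ !ger0_norm // lerD // ler_piMr.
have dFs b t : 0 <= t <= h -> 0 <= b <= h ->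
    is_derive t 1 (fun t => F (t *: ei + (b *: ej + u)))
      (partial i F (t *: ei + (b *: ej + u))).
  move=> th bh.
  have dq := is_derive_line (b *: ej + u) ei t.
  have dFx : differentiable F (t *: ei + (b *: ej + u)).
    apply: HdF; rewrite -ball_normE /= addrA opprD addrCA subrr addr0 normrN.
    by apply: le_lt_trans (small _ _ th bh) _; lra.
  have := @is_derive_comp_curve _ _ _ F (fun t => t *: ei + (b *: ej + u)) t dFx.
  rewrite derive1E derive_val -derive_partials //.
  by apply; case: dq.
pose g t := F (t *: ei + (h *: ej + u)) - F (t *: ei + (0 *: ej + u)).
pose dg t := partial i F (t *: ei + (h *: ej + u))
             - partial i F (t *: ei + (0 *: ej + u)).
have hh : 0 <= h <= h by rewrite ltW /=.
have h00 : (0 : R) <= 0 <= h by rewrite lexx ltW.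
have gd t : 0 <= t <= h -> is_derive t 1 g (dg t).
  by move=> th; apply: is_deriveB; exact: dFs.
have [t] : exists2 t, t \in `]0, h[ & g h - g 0 = dg t * (h - 0).
  apply: MVT => //.
    by move=> t; rewrite in_itv /= => /andP[t0 th]; apply: gd; rewrite !ltW.
  apply: derivable_within_continuous => t; rewrite in_itv /= => th.
  by case: (gd _ th).
rewrite in_itv /= subr0 => /andP[t0 th] gE.
have th' : 0 <= t <= h by rewrite !ltW.
have -> : F (h *: ei + (h *: ej + u)) - F (h *: ei + u) - F (h *: ej + u) + F u
   = g h - g 0.
  by rewrite /g !scale0r !add0r opprB; ring.
rewrite gE /dg scale0r add0r.
have E1 := Hexp (t *: ei + h *: ej); have E2 := Hexp (t *: ei).
have B1 : ball (0 : 'rV[R]_m) d1 (t *: ei + h *: ej).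
  rewrite -ball_normE /= add0r normrN.
  by apply: le_lt_trans (small _ _ th' hh) _; lra.
have B2 : ball (0 : 'rV[R]_m) d1 (t *: ei).
  rewrite -ball_normE /= add0r normrN.
  by have := small _ _ th' h00; rewrite scale0r !addr0 => /le_lt_trans; apply; lra.
move: (E1 B1) (E2 B2); rewrite linearD (linearZ _ ej) /=.
have -> : 'd (partial i F) u ej = partial j (partial i F) u.
  by rewrite {2}/partial deriveE.
rewrite -[t *: ei + h *: ej + u]addrA.
set X := partial i F (t *: ei + (h *: ej + u)).
set Y := partial i F (t *: ei + u); set L := 'd _ _ _.
set P := partial j _ _ => HX HY.
have nX := small _ _ th' hh; have := small _ _ th' h00.
rewrite scale0r !addr0 => nY.
rewrite (_ : (X - Y) * h - h ^+ 2 * P =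
  h * ((X - partial i F u - (L + h *: P)) - (Y - partial i F u - L))); last first.
  by rewrite /GRing.scale /=; ring.
rewrite normrM (gtr0_norm h0) expr2 mulrCA ler_pM2l //.
apply: le_trans (ler_normB _ _) _.
apply: le_trans (lerD HX HY) _.
have -> : e * h = e / 3 * (2 * h) + e / 3 * h by field.
by apply: lerD; rewrite ler_pM2l //; lra.
Unshelve. all: by end_near. Qed.

Lemma young m (F : 'rV[R]_m -> R) u i j : twice_differentiable_at F u ->
  partial i (partial j F) u = partial j (partial i F) u.
Proof.
move=> dF; apply/eqP; rewrite -subr_eq0 -normr_le0; apply/ler_addgt0Pl => e e0.
rewrite addr0; have e20 : 0 < e / 2 by rewrite divr_gt0.
have [h [[/= A B] /= h0]] := filter_ex (filterI (filterI
  (second_difference i j dF e20) (second_difference j i dF e20))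
  (nbhs_right_gt (0 : R))).
move: A B; rewrite [h *: delta_mx 0 j + (_ + _)]addrCA.
set D := F (_ + (_ + _)); set Di := F (h *: delta_mx 0 i + u).
set Dj := F (h *: delta_mx 0 j + u).
set Pji := partial j (partial i F) u; set Pij := partial i (partial j F) u => A B.
rewrite -(ler_pM2l (exprn_gt0 2 h0)) -[X in X * `|_|]ger0_norm; last exact: exprn_ge0 (ltW h0).
rewrite -normrM (_ : _ * _ = (D - Di - Dj + F u - h ^+ 2 * Pji)
   - (D - Dj - Di + F u - h ^+ 2 * Pij)); last by ring.
apply: le_trans (ler_normB _ _) _.
apply: le_trans (lerD A B) _.
by rewrite -mulrDl -splitr mulrC.
Qed.

End TwiceDifferentiable.

(** * Second derivatives of compositions *)

Section SecondOrderChainRule.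
Variable R : realType.

Lemma near_eq_differentiable (V W : normedModType R) (f g : V -> W) a :
  {near a, f =1 g} -> differentiable f a -> differentiable g a.
Proof.
move=> fg /diff_locallyP[df_cont fE].
have gE : g \o shift a = cst (g a) + 'd f a +o_ 0 id.
  apply/eqaddoP => e e0; move/eqaddoP : fE => /(_ _ e0) fE.
  have fg0 : \forall h \near 0, f (h + a) = g (h + a).
    by move: fg; rewrite (near_shift 0) subr0.
  apply: filterS2 fE fg0 => h; rewrite !fctE /= => fE <-.
  by rewrite -(nbhs_singleton fg).
have dE := diff_unique df_cont gE.
by apply/diff_locallyP; rewrite dE.
Qed.

Lemma near_derive_comp_curve m (F : 'rV[R]_m -> R) (q : R -> 'rV[R]_m) t :
  (\forall w \near q t, differentiable F w) ->
  (\forall s \near t, derivable q s 1) ->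
  \forall s \near t, is_derive (s : R) 1 (F \o q)
    (\sum_i (derive1 q s) 0 i * partial i F (q s)).
Proof.
move=> dF dq.
have cq : {for t, continuous q}.
  by apply: differentiable_continuous; apply/derivable1_diffP; exact: nbhs_singleton dq.
near=> s; apply: is_derive_comp_curve; last by near: s.
by near: s; exact: (cq _ dF).
Unshelve. all: by end_near. Qed.

Lemma is_derive2_comp_curve m (F : 'rV[R]_m -> R) (q : R -> 'rV[R]_m) t :
  twice_differentiable_at F (q t) ->
  (\forall s \near t, derivable q s 1) -> derivable (derive1 q) t 1 ->
  is_derive t 1 (derive1 (F \o q))
   (\sum_j \sum_i derive1 q t 0 i * derive1 q t 0 j
                  * partial i (partial j F) (q t)
    + \sum_j derive1 (derive1 q) t 0 j * partial j F (q t)).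
Proof.
move=> [dF dpF] dq dq'.
have dqt := nbhs_singleton dq.
have nE : \forall s \near t,
    \sum_j (derive1 q s) 0 j * partial j F (q s) = derive1 (F \o q) s.
  have := near_derive_comp_curve dF dq; apply: filterS => s [_ <-].
  by rewrite derive1E.
apply: near_eq_is_derive nE _.
have -> : (fun s => \sum_j derive1 q s 0 j * partial j F (q s)) =
  \sum_j (fun s => derive1 q s 0 j * partial j F (q s)).
  by apply/funext => s; rewrite fct_sumE.
rewrite -big_split /=; apply: is_derive_sum => j.
have d1 : is_derive t 1 (fun s => derive1 q s 0 j) (derive1 (derive1 q) t 0 j).
  apply: DeriveDef; first by move/derivable_mxP: dq'; apply.
  by rewrite [in RHS]derive1E (derive_mx dq') mxE.
have d2 : is_derive t 1 (partial j F \o q)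
    (\sum_i derive1 q t 0 i * partial i (partial j F) (q t)).
  exact: is_derive_comp_curve.
have d12 := @is_deriveM _ _ _ _ _ _ _ _ d1 d2.
apply: (is_derive_eq d12).
rewrite /GRing.scale /=; congr (_ + _); last by rewrite mulrC.
by rewrite big_distrr /=; apply: eq_bigr => i _; ring.
Qed.

Lemma twice_differentiable_comp m n (F : 'rV[R]_n -> R)
    (r : 'rV[R]_m -> 'rV[R]_n) u :
  twice_differentiable_at F (r u) -> twice_differentiable_at r u ->
  twice_differentiable_at (F \o r) u.
Proof.
move=> [dF dpF] [dr dpr].
have dru := nbhs_singleton dr.
have cr := differentiable_continuous dru.
have dFr : \forall w \near u, differentiable F (r w) by exact: (cr _ dF).
split; first by near=> w; apply: differentiable_comp; near: w.
move=> i.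
have nE : \forall w \near u,
    \sum_k (partial i r w) 0 k * partial k F (r w) = partial i (F \o r) w.
  near=> w; have d1 : differentiable r w by near: w.
  have d2 : differentiable F (r w) by near: w.
  by have [_] := is_derive_comp_rV (delta_mx 0 i) d2 d1; rewrite /partial => ->.
have dS : differentiable
    (fun w => \sum_k (partial i r w) 0 k * partial k F (r w)) u.
  have -> : (fun w => \sum_k partial i r w 0 k * partial k F (r w)) =
    \sum_k (fun w => partial i r w 0 k * partial k F (r w)).
    by apply/funext => s; rewrite fct_sumE.
  apply: differentiable_sum => k; apply: differentiableM.
    apply: (@differentiable_comp _ _ _ _ (partial i r) (fun M : 'rV[R]_n => M 0 k)) => //.
    exact: differentiable_coord.
  exact: differentiable_comp.
exact: near_eq_differentiable nE dS.
Unshelve. all: by end_near. Qed.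
End SecondOrderChainRule.

(** * Strong convexity on the unit interval *)

Section StrongConvexity.
Variable R : realType.
Variables (mu : R) (h : R -> R).
Hypothesis sc : strongly_convex01 mu h.

Lemma cvg_derive_at_right (F : R -> R) a v : derivable F a v ->
  l^-1 *: (F (l *: v + a) - F a) @[l --> (0 : R)^'+] --> 'D_v F a.
Proof.
by move=> dF; apply: cvg_dnbhs_at_right.
Qed.

(** Divide the convexity inequality at [(1 - l) a + l b] by [l] and let [l] tend
    to [0]. *)
Lemma strongly_convex_gradient a b : a \in `[0, 1] -> b \in `[0, 1] ->
  derivable h a 1 ->
  h a + derive1 h a * (b - a) + mu / 2 * (b - a) ^+ 2 <= h b.
Proof.
move=> a01 b01 /derivable1_diffP dh.
have Dh : 'D_(b - a) h a = derive1 h a * (b - a).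
  by rewrite deriveE // derive1E' // -[in LHS](mulr1 (b - a)) linearZ /= mulrC.
have lim1 := cvg_derive_at_right (@diff_derivable _ _ _ h a (b - a) dh).
have lim2 : h b - h a - mu / 2 * (1 - l) * (b - a) ^+ 2
    @[l --> (0 : R)^'+] --> h b - h a - mu / 2 * (1 - 0) * (b - a) ^+ 2.
  apply: cvg_at_right_filter; apply: cvgB; first exact: cvg_cst.
  apply: cvgM; last exact: cvg_cst.
  apply: cvgM; first exact: cvg_cst.
  by apply: cvgB; [exact: cvg_cst | exact: cvg_id].
suff : 'D_(b - a) h a <= h b - h a - mu / 2 * (1 - 0) * (b - a) ^+ 2.
  by rewrite Dh subr0 mulr1; lra.
apply: ler_cvg_to lim1 lim2 _; near=> l.
have l0 : 0 < l by near: l; exact: nbhs_right_gt.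
have l1 : l < 1 by near: l; exact: nbhs_right_lt.
have l01 : l \in `[0, 1] by rewrite in_itv /= !ltW.
rewrite /GRing.scale /= mulrC ler_pdivrMr //.
have := sc a01 b01 l01.
rewrite (_ : (1 - l) * a + l * b = l * (b - a) + a); last by ring.
by rewrite (_ : (a - b) ^+ 2 = (b - a) ^+ 2); [lra | ring].
Unshelve. all: by end_near. Qed.

(** The sum of the gradient inequalities from [0] to [l] and from [l] to [0] bounds
    the difference quotient of the derivative. *)
Lemma strongly_convex_derive2 : (\forall t \near (0 : R), derivable h t 1) ->
  derivable (derive1 h) 0 1 -> mu <= derive1 (derive1 h) 0.
Proof.
move=> dh dh'.
have lim := cvg_derive_at_right dh'.
rewrite [leRHS]derive1E; apply: cvgr_to_ge lim _; near=> l.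
have l0 : 0 < l by near: l; exact: nbhs_right_gt.
have l1 : l < 1 by near: l; exact: nbhs_right_lt.
have dl : derivable h l 1 by near: l; exact: cvg_at_right_filter dh.
have l01 : l \in `[0, 1] by rewrite in_itv /= !ltW.
have z01 : 0 \in `[0, 1 : R] by rewrite in_itv /= lexx ler01.
have A := strongly_convex_gradient z01 l01 (nbhs_singleton dh).
have B := strongly_convex_gradient l01 z01 dl.
rewrite /GRing.scale /= mulr1 addr0 ler_pdivlMl // -(ler_pM2l l0).
move: A B; rewrite subr0 sub0r; set u := derive1 h l; set w := derive1 h 0.
set x := h l; set y := h 0; move: u w x y mu => u w x y m; nra.
Unshelve. all: by end_near. Qed.
End StrongConvexity.

(** * The Picard theorem for a globally Lipschitz field *)

Section Antiderivative.
Variable R : realType.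
Notation mu := (@lebesgue_measure R).
Implicit Types (h g : R -> R).

Lemma norm_increment_le (g dg : R -> R) (C s t : R) :
  (forall r, Num.min s t <= r <= Num.max s t -> is_derive r 1 g (dg r)) ->
  (forall r, Num.min s t <= r <= Num.max s t -> `|dg r| <= C) ->
  `|g t - g s| <= C * `|t - s|.
Proof.
wlog st : s t / s <= t => [H|].
  case/orP: (le_total s t) => st; first exact: H.
  by rewrite minC maxC distrC (distrC t); exact: H.
rewrite (min_idPl st) (max_idPr st) => dgE dgC.
have [r] : exists2 r, r \in `[s, t] & g t - g s = dg r * (t - s).
  apply: MVT_segment => //.
    move=> x; rewrite in_itv /= => /andP[sx xt]; apply: dgE.
    by rewrite (ltW sx) (ltW xt).
  apply: derivable_within_continuous => x; rewrite in_itv /= => sxt.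
  by case: (dgE _ sxt).
rewrite in_itv /= => srt ->; rewrite normrM ler_wpM2r //; exact: dgC.
Qed.

(** The primitive that vanishes at [0], to be used on [(-1, 1)]: integrating from
    [-1] covers both signs of [t]. *)
Definition antiderivative h (t : R) : R :=
  \int[mu]_(s in `[-1, t]) h s - \int[mu]_(s in `[-1, 0]) h s.

Lemma antiderivative0 h : antiderivative h 0 = 0.
Proof. exact: subrr. Qed.

Lemma is_derive_antiderivative h (t : R) : continuous h -> `|t| < 1 ->
  is_derive t 1 (antiderivative h) (h t).
Proof.
move=> ch; rewrite ltr_norml => /andP[t1 t2].
have hi : mu.-integrable `[-1, 1] (EFin \o h).
  apply: continuous_compact_integrable; first exact: segment_compact.
  exact: continuous_subspaceT.
have [d1 d2] := @continuous_FTC1_closed _ h (-1) t 1 t2 hi t1 (ch t).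
have d3 : is_derive t 1 (fun x => \int[mu]_(s in `[-1, x]) h s) (h t).
  by apply: (DeriveDef d1); rewrite -derive1E; exact: d2.
have := is_deriveB d3 (is_derive_cst (\int[mu]_(s in `[-1, 0]) h s) t 1).
by rewrite subr0.
Qed.

Lemma antiderivative_bound h C s t : continuous h -> (forall r, `|h r| <= C) ->
  `|s| < 1 -> `|t| < 1 ->
  `|antiderivative h t - antiderivative h s| <= C * `|t - s|.
Proof.
move=> ch hC; rewrite !ltr_norml => /andP[s1 s2] /andP[t1 t2].
apply: (@norm_increment_le _ h) => // r /andP[r1 r2].
apply: is_derive_antiderivative => //; rewrite ltr_norml.
by rewrite (lt_le_trans _ r1) ?(le_lt_trans r2) ?lt_min ?gt_max ?s1 ?s2.
Qed.

Lemma antiderivative_dist h g C t : continuous h -> continuous g ->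
  (forall r, `|h r - g r| <= C) -> `|t| < 1 ->
  `|antiderivative h t - antiderivative g t| <= C * `|t|.
Proof.
move=> ch cg hC; rewrite ltr_norml => /andP[t1 t2].
have := @norm_increment_le (fun x => antiderivative h x - antiderivative g x)
  (fun x => h x - g x) C 0 t.
rewrite !antiderivative0 !subr0; apply => // r /andP[r1 r2].
have r12 : `|r| < 1.
  rewrite ltr_norml.
  by rewrite (lt_le_trans _ r1) ?(le_lt_trans r2) ?lt_min ?gt_max ?t1 ?t2 ?ltrN10 ?ltr01.
by apply: is_deriveB; exact: is_derive_antiderivative.
Qed.

End Antiderivative.

Section GeometricSequences.
Variable R : realType.

Lemma le_geometric (x y A : R) :
  (forall k, x <= y + A * 2^-1 ^+ k) -> x <= y.
Proof.
move=> H.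
have c1 : y + A * 2^-1 ^+ k @[k --> \oo] --> y + A * 0.
  apply: cvgD; first exact: cvg_cst.
  apply: cvgM; first exact: cvg_cst.
  by apply: cvg_expr; rewrite ger0_norm // invf_lt1 // ltr1n.
rewrite -[y]addr0 -[0](mulr0 A).
by apply: cvgr_to_ge c1 _; apply: nearW.
Qed.

Lemma geometric_dist (V : normedModType R) (v : nat -> V) B :
  (forall k, `|v k.+1 - v k| <= B * 2^-1 ^+ k) ->
  forall n m, `|v (n + m)%N - v n| <= 2 * B * 2^-1 ^+ n * (1 - 2^-1 ^+ m).
Proof.
move=> H n; elim=> [|m IH]; first by rewrite addn0 expr0 !subrr normr0 mulr0.
rewrite addnS -(subrKA (v (n + m)%N)); apply: le_trans (ler_normD _ _) _.
apply: le_trans (lerD (H _) IH) _.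
rewrite exprD exprS; set a := _ ^+ n; set b := _ ^+ m.
by rewrite le_eqVlt; apply/orP; left; apply/eqP; field.
Qed.

Lemma geometric_cvg (V : completeNormedModType R) (v : nat -> V) B :
  (forall k, `|v k.+1 - v k| <= B * 2^-1 ^+ k) ->
  cvgn v /\ forall k, `|limn v - v k| <= 2 * B * 2^-1 ^+ k.
Proof.
move=> H; have B0 : 0 <= B by have := H 0%N; rewrite expr0 mulr1; apply: le_trans.
have D n m : `|v (n + m)%N - v n| <= 2 * B * 2^-1 ^+ n.
  apply: le_trans (geometric_dist H n m) _; apply: ler_piMr.
    by rewrite !mulr_ge0 // exprn_ge0 // invr_ge0.
  by rewrite gerBl exprn_ge0 // invr_ge0.
have cv : cvgn v.
  apply/cauchy_cvgP; apply/cauchy_ballP => e e0.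
  have e20 : 0 < e / 2 by rewrite divr_gt0.
  have c0 : 2 * B * 2^-1 ^+ k @[k --> \oo] --> 2 * B * 0.
    apply: cvgM; first exact: cvg_cst.
    by apply: cvg_expr; rewrite ger0_norm // invf_lt1 // ltr1n.
  rewrite mulr0 in c0.
  have [N _ HN] := cvgr_lt 0 c0 _ e20.
  near_simpl; exists ([set n | (N <= n)%N], [set n | (N <= n)%N]).
    by split; exists N.
  move=> [n m] [/= Nn Nm]; rewrite -ball_normE /=.
  rewrite -(subrKA (v N)) [e]splitr; apply: le_lt_trans (ler_normD _ _) _.
  rewrite (distrC (v N)) -(subnKC Nn) -(subnKC Nm); apply: ltrD.
    by apply: le_lt_trans (D _ _) (HN N _) => /=.
  by apply: le_lt_trans (D _ _) (HN N _) => /=.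
split=> // k.
have c1 : `|v (m + k)%N - v k| @[m --> \oo] --> `|limn v - v k|.
  apply: cvg_norm; apply: cvgB; last exact: cvg_cst.
  by rewrite (cvg_shiftn k v).
by apply: cvgr_to_le c1 _; apply: nearW => m; rewrite addnC.
Qed.

End GeometricSequences.

Section Clamp.
Variable R : realDomainType.
Implicit Types a x y : R.

Lemma max_dist a x y : `|Num.max a x - Num.max a y| <= `|x - y|.
Proof.
have h1 := ler_norm (x - y); have h2 : y - x <= `|x - y| by rewrite distrC ler_norm.
by rewrite ler_norml; have [ax|ax] := ltP a x; have [ay|ay] := ltP a y; lra.
Qed.

Lemma min_dist a x y : `|Num.min a x - Num.min a y| <= `|x - y|.
Proof.
have h1 := ler_norm (x - y); have h2 : y - x <= `|x - y| by rewrite distrC ler_norm.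
by rewrite ler_norml; have [ax|ax] := ltP a x; have [ay|ay] := ltP a y; lra.
Qed.

End Clamp.

Section Picard.
Variables (R : realType) (m : nat).
Variables (F : 'rV[R]_m -> 'rV[R]_m) (p : 'rV[R]_m) (K B : R).
Hypothesis (F_lip : forall x y, `|F x - F y| <= K * `|x - y|).
Hypothesis (F_bnd : forall x, `|F x| <= B).
Hypothesis (K0 : 0 <= K).

(* On times in [[-e, e]] the Picard operator halves distances. *)
Let e : R := (2 * (K + 1))^-1.

Lemma norm_row_le (v : 'rV[R]_m) C : 0 <= C -> (forall i, `|v 0 i| <= C) -> `|v| <= C.
Proof.
move=> C0 H; rewrite [leLHS]/Num.Def.normr/= mx_normrE bigmax_le // => -[k l] _ /=.
by rewrite (ord1 k).
Qed.

Lemma norm_coord_le (v : 'rV[R]_m) i : `|v 0 i| <= `|v|.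
Proof.
rewrite [leRHS]/Num.Def.normr/= mx_normrE.
by apply: le_trans; last exact: (le_bigmax _ _ (0, i)).
Qed.

Let B0 : 0 <= B. Proof. exact: le_trans (normr_ge0 _) (F_bnd 0). Qed.
Let e0 : 0 < e. Proof. by rewrite invr_gt0; move: K0; lra. Qed.
Let e2 : e <= 2^-1.
Proof. by rewrite lef_pV2 ?posrE; move: K0; lra. Qed.
Let eK : e * K <= 2^-1.
Proof. by rewrite mulrC ler_pdivrMr; move: K0; lra. Qed.

(* Freezing the time outside [[-e, e]] makes the iterates globally defined and
   Lipschitz. *)
Let cut (t : R) : R := Num.max (- e) (Num.min e t).

Let cut_le t : `|cut t| <= e.
Proof.
rewrite ler_norml /cut le_max lexx ge_max ge_min lexx /=.
by move: e0; lra.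
Qed.

Let cut_lip s t : `|cut t - cut s| <= `|t - s|.
Proof. exact: le_trans (max_dist _ _ _) (min_dist _ _ _). Qed.

Let cut1 t : `|cut t| < 1.
Proof. by apply: le_lt_trans (cut_le t) _; move: e2; lra. Qed.

Let cut_id t : `|t| < e -> \forall s \near t, cut s = s.
Proof.
rewrite ltr_norml => /andP[t1 t2]; near=> s.
have s1 : s < e by near: s; exact: lt_nbhsl.
have s2 : - e < s by near: s; exact: lt_nbhsr.
by rewrite /cut (min_idPr (ltW s1)) (max_idPr (ltW s2)).
Unshelve. all: by end_near. Qed.

Let step (u : R -> 'rV[R]_m) (t : R) : 'rV[R]_m :=
  p + \row_i antiderivative (fun s => F (u s) 0 i) (cut t).

Let field_continuous (u : R -> 'rV[R]_m) i :
  (forall s t, `|u t - u s| <= B * `|t - s|) -> continuous (fun s => F (u s) 0 i).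
Proof.
move=> ul t; apply/cvgrPdist_lt => d d0.
have M0 : 0 < K * B + 1 by rewrite ltr_wpDl // mulr_ge0.
near=> s.
have -> : F (u t) 0 i - F (u s) 0 i = (F (u t) - F (u s)) 0 i by rewrite !mxE.
apply: le_lt_trans (norm_coord_le _ _) _; apply: le_lt_trans (F_lip _ _) _.
have st : `|t - s| < d / (K * B + 1).
  near: s; apply/nbhs_ballP; exists (d / (K * B + 1)) => //.
  exact: divr_gt0.
rewrite ltr_pdivlMr // in st; apply: le_lt_trans st.
apply: (@le_trans _ _ (K * (B * `|t - s|))); first by rewrite ler_wpM2l.
by rewrite mulrA [leRHS]mulrC ler_wpM2r // lerDl.
Unshelve. all: by end_near. Qed.

Let step_lip u : (forall s t, `|u t - u s| <= B * `|t - s|) ->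
  forall s t, `|step u t - step u s| <= B * `|t - s|.
Proof.
move=> ul s t; rewrite /step opprD addrACA subrr add0r.
apply: norm_row_le => [|i]; first exact: mulr_ge0.
rewrite !mxE; apply: (@le_trans _ _ (B * `|cut t - cut s|)); last first.
  by rewrite ler_wpM2l.
apply: antiderivative_bound => //; first exact: field_continuous.
by move=> r; apply: le_trans (norm_coord_le _ _) (F_bnd _).
Qed.

Let step_dist u v C : 0 <= C -> (forall s t, `|u t - u s| <= B * `|t - s|) ->
  (forall s t, `|v t - v s| <= B * `|t - s|) -> (forall t, `|u t - v t| <= C) ->
  forall t, `|step u t - step v t| <= C / 2.
Proof.
move=> C0 ul vl uv t; rewrite /step opprD addrACA subrr add0r.
apply: norm_row_le => [|i]; first exact: divr_ge0.
rewrite !mxE; apply: (@le_trans _ _ (K * C * `|cut t|)).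
  apply: antiderivative_dist => //; try exact: field_continuous.
  move=> r; have -> : F (u r) 0 i - F (v r) 0 i = (F (u r) - F (v r)) 0 i by rewrite !mxE.
  apply: le_trans (norm_coord_le _ _) _; apply: le_trans (F_lip _ _) _.
  by rewrite ler_wpM2l.
apply: (@le_trans _ _ (K * C * e)); first by rewrite ler_wpM2l ?mulr_ge0.
by rewrite mulrAC mulrC ler_wpM2l // mulrC.
Qed.

Let it k := iter k step (cst p).

Let it_lip k s t : `|it k t - it k s| <= B * `|t - s|.
Proof.
elim: k s t => [|k IH] s t; first by rewrite /it /= subrr normr0 mulr_ge0.
exact: step_lip.
Qed.

Let it_dist k t : `|it k.+1 t - it k t| <= B * 2^-1 ^+ k.
Proof.
elim: k t => [|k IH] t; last first.
  have C0 : 0 <= B * 2^-1 ^+ k by rewrite mulr_ge0 // exprn_ge0 // invr_ge0.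
  have := step_dist C0 (it_lip k.+1) (it_lip k) IH t.
  by rewrite exprSr mulrA.
rewrite expr0 mulr1 /it /= /step addrC addKr.
apply: norm_row_le => // i; rewrite mxE -[X in `|X|]subr0.
rewrite -[X in _ - X](antiderivative0 (fun _ => F p 0 i)).
apply: (@le_trans _ _ (B * `|cut t - 0|)).
  apply: antiderivative_bound; rewrite ?normr0 //.
    by apply: (@field_continuous (cst p)) => s r; rewrite subrr normr0 mulr_ge0.
  by move=> r; apply: le_trans (norm_coord_le _ _) (F_bnd _).
by rewrite subr0 ler_piMr // ltW.
Qed.

(** The Picard iterates are [B]-Lipschitz and converge geometrically and uniformly;
    their limit is a fixed point of the integral operator. *)
Lemma picard_global : exists (u : R -> 'rV[R]_m) (d : R), [/\ 0 < d, u 0 = p,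
  forall t : R, `|u t - p| <= B * `|t|
  & forall t : R, `|t| < d -> is_derive t 1 u (F (u t))].
Proof.
pose u t : 'rV[R]_m := \row_i limn (fun k => it k t 0 i).
have uE t k : `|u t - it k t| <= 2 * B * 2^-1 ^+ k.
  apply: norm_row_le => [|i].
    by rewrite !mulr_ge0 // exprn_ge0 // invr_ge0.
  rewrite !mxE; apply: (@geometric_cvg R R^o (fun k => it k t 0 i) B _).2 => l.
  have -> : it l.+1 t 0 i - it l t 0 i = (it l.+1 t - it l t) 0 i by rewrite !mxE.
  exact: le_trans (norm_coord_le _ _) (it_dist _ _).
have ul s t : `|u t - u s| <= B * `|t - s|.
  apply: (@le_geometric _ _ _ (2 * (2 * B))) => k.
  have -> : u t - u s = (u t - it k t) + (it k t - it k s) + (it k s - u s).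
    by rewrite !subrKA.
  apply: le_trans (ler_normD _ _) _; apply: le_trans (lerD (ler_normD _ _) (lexx _)) _.
  have := uE t k; have := uE s k; have := it_lip k s t.
  by rewrite (distrC (u s)); lra.
have fix_u t : u t = step u t.
  apply/eqP; rewrite -subr_eq0 -normr_le0.
  apply: (@le_geometric _ _ _ (2 * B)) => k; rewrite add0r.
  rewrite -(subrKA (it k.+1 t) (u t)); apply: le_trans (ler_normD _ _) _.
  have A := uE t k.+1.
  have C0 : 0 <= 2 * B * 2^-1 ^+ k.
    by rewrite !mulr_ge0 // exprn_ge0 // invr_ge0.
  have D s : `|it k s - u s| <= 2 * B * 2^-1 ^+ k by rewrite distrC; exact: uE.
  have := step_dist C0 (it_lip k) ul D t.
  move: A; rewrite -[it k.+1 t]/(step (it k) t).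
  set a := `|_|; set b := `|_ - step u t| => A E.
  apply: le_trans (lerD A E) _; rewrite exprS.
  by rewrite le_eqVlt; apply/orP; left; apply/eqP; field.
have u0 : u 0 = p.
  rewrite fix_u /step /cut (min_idPr (ltW e0)) (max_idPr _) ?oppr_le0 ?ltW //.
  rewrite -[RHS]addr0; congr (_ + _); apply/rowP => i.
  by rewrite !mxE antiderivative0.
exists u, e; split => // [t|t te].
  by rewrite -u0 -[X in _ * `|X|]subr0.
have d i : is_derive (t : R) 1 (fun s => u s 0 i) (F (u t) 0 i).
  have t1 : `|t| < 1 by apply: lt_trans te _; move: e2; lra.
  have := is_derive_antiderivative (@field_continuous u i ul) t1.
  have nE : \forall s \near t, p 0 i + antiderivative (fun s => F (u s) 0 i) s = u s 0 i.
    have := cut_id te; apply: filterS => s cs.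
    by rewrite [in RHS]fix_u /step !mxE cs.
  move=> da; apply: near_eq_is_derive nE _.
  have := is_deriveD (is_derive_cst (p 0 i) t 1) da.
  by rewrite add0r.
have du : derivable u t 1 by apply/derivable_mxP => i j; rewrite (ord1 i); case: (d j).
apply: (DeriveDef du); rewrite (derive_mx du); apply/rowP => j.
by rewrite mxE; case: (d j).
Qed.

End Picard.

(** * Locally Lipschitz maps and the Picard theorem *)

Section LipschitzNear.
Variables (R : realType) (m : nat).
Implicit Types (p : 'rV[R]_m).

Definition lipschitz_near (V : normedModType R) (f : 'rV[R]_m -> V) p : Prop :=
  exists K d, [/\ 0 <= K, 0 < d & forall x y, `|x - p| < d -> `|y - p| < d ->
    `|f x - f y| <= K * `|x - y|].

Lemma lipschitz_near2 (V W : normedModType R) (f : 'rV[R]_m -> V)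
    (g : 'rV[R]_m -> W) p :
  lipschitz_near f p -> lipschitz_near g p ->
  exists K d, [/\ 0 <= K, 0 < d & forall x y, `|x - p| < d -> `|y - p| < d ->
    `|f x - f y| <= K * `|x - y| /\ `|g x - g y| <= K * `|x - y|].
Proof.
move=> [K1 [d1 [K10 d10 fK]]] [K2 [d2 [K20 d20 gK]]].
exists (K1 + K2), (Num.min d1 d2); split; [exact: addr_ge0|by rewrite lt_min d10|].
move=> x y; rewrite !lt_min => /andP[x1 x2] /andP[y1 y2]; split.
  by apply: le_trans (fK _ _ x1 y1) _; rewrite ler_wpM2r // lerDl.
by apply: le_trans (gK _ _ x2 y2) _; rewrite ler_wpM2r // lerDr.
Qed.

Lemma lipschitz_near_ext (V : normedModType R) (f g : 'rV[R]_m -> V) p :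
  {near p, f =1 g} -> lipschitz_near f p -> lipschitz_near g p.
Proof.
move=> /nbhs_ballP[d /= d0 fg] [K [d1 [K0 d10 fK]]].
exists K, (Num.min d d1); split=> //; first by rewrite lt_min d0.
move=> x y; rewrite !lt_min => /andP[x1 x2] /andP[y1 y2].
rewrite -!fg; first exact: fK.
  by rewrite -ball_normE /= distrC.
by rewrite -ball_normE /= distrC.
Qed.

Lemma lipschitz_near_cst (V : normedModType R) (a : V) p :
  lipschitz_near (fun=> a) p.
Proof. by exists 0, 1; split=> // x y _ _; rewrite subrr normr0 mul0r. Qed.

Lemma lipschitz_near_coord i p : lipschitz_near (fun x => x 0 i) p.
Proof.
exists 1, 1; split=> // x y _ _; rewrite mul1r.
by apply: le_trans (norm_coord_le _ i); rewrite !mxE.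
Qed.

Lemma lipschitz_nearD (V : normedModType R) (f g : 'rV[R]_m -> V) p :
  lipschitz_near f p -> lipschitz_near g p ->
  lipschitz_near (fun x => f x + g x) p.
Proof.
move=> fl gl; have [K [d [K0 d0 H]]] := lipschitz_near2 fl gl.
exists (2 * K), d; split=> // [|x y xd yd]; first exact: mulr_ge0.
have [A B] := H _ _ xd yd; rewrite opprD addrACA.
by apply: le_trans (ler_normD _ _) _; apply: le_trans (lerD A B) _; lra.
Qed.

Lemma lipschitz_nearM (f g : 'rV[R]_m -> R) p :
  lipschitz_near f p -> lipschitz_near g p ->
  lipschitz_near (fun x => f x * g x) p.
Proof.
move=> fl gl; have [K [d [K0 d0 H]]] := lipschitz_near2 fl gl.
have pd : `|p - p| < d by rewrite subrr normr0.
exists (K * (`|f p| + K * d) + K * (`|g p| + K * d)), d; split=> //.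
  by rewrite addr_ge0 // mulr_ge0 // addr_ge0 // mulr_ge0 // ltW.
move=> x y xd yd; have [A B] := H _ _ xd yd.
have [Ax _] := H _ _ xd pd; have [_ By] := H _ _ yd pd.
have fx : `|f x| <= `|f p| + K * d.
  rewrite -[f x](subrK (f p)) addrC; apply: le_trans (ler_normD _ _) _.
  by rewrite lerD2l; apply: le_trans Ax _; rewrite ler_wpM2l // ltW.
have gy : `|g y| <= `|g p| + K * d.
  rewrite -[g y](subrK (g p)) addrC; apply: le_trans (ler_normD _ _) _.
  by rewrite lerD2l; apply: le_trans By _; rewrite ler_wpM2l // ltW.
have -> : f x * g x - f y * g y = f x * (g x - g y) + (f x - f y) * g y by ring.
apply: le_trans (ler_normD _ _) _; rewrite !normrM mulrDl; apply: lerD.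
  by rewrite [X in _ <= X]mulrAC [X in _ <= X]mulrC; apply: ler_pM.
by rewrite [X in _ <= X]mulrAC; apply: ler_pM.
Qed.

Lemma lipschitz_near_sum (V : normedModType R) (I : Type) (r : seq I) (P : pred I)
    (f : I -> 'rV[R]_m -> V) p :
  (forall i, P i -> lipschitz_near (f i) p) ->
  lipschitz_near (fun x => \sum_(i <- r | P i) f i x) p.
Proof.
move=> fl; elim: r => [|i r IH].
  under eq_fun do rewrite big_nil; exact: lipschitz_near_cst.
under eq_fun do rewrite big_cons.
case: (P i) (fl i) => //= fli; apply: lipschitz_nearD => //; exact: fli.
Qed.

Lemma lipschitz_near_prod (I : Type) (r : seq I) (P : pred I)
    (f : I -> 'rV[R]_m -> R) p :
  (forall i, P i -> lipschitz_near (f i) p) ->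
  lipschitz_near (fun x => \prod_(i <- r | P i) f i x) p.
Proof.
move=> fl; elim: r => [|i r IH].
  under eq_fun do rewrite big_nil; exact: lipschitz_near_cst.
under eq_fun do rewrite big_cons.
case: (P i) (fl i) => //= fli; apply: lipschitz_nearM => //; exact: fli.
Qed.

Lemma lipschitz_nearV (f : 'rV[R]_m -> R) p : f p != 0 ->
  lipschitz_near f p -> lipschitz_near (fun x => (f x)^-1) p.
Proof.
move=> fp0 [K [d [K0 d0 H]]].
have pd : `|p - p| < d by rewrite subrr normr0.
have c0 : 0 < `|f p| / 2 by rewrite divr_gt0 ?normr_gt0.
set c := `|f p| / 2.
exists (K / c ^+ 2), (Num.min d (c / (K + 1))); split.
- by rewrite divr_ge0 // exprn_ge0 // ltW.
- by rewrite lt_min d0 divr_gt0 // ltr_wpDl.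
have low x : `|x - p| < d -> `|x - p| < c / (K + 1) -> c <= `|f x|.
  move=> xd; rewrite ltr_pdivlMr ?ltr_wpDl // => xc.
  have := H _ _ xd pd; have := lerB_dist (f p) (f p - f x).
  have -> : f p - (f p - f x) = f x by ring.
  rewrite (distrC (f p)) => A B; have c2 : `|f p| = c + c by rewrite /c -splitr.
  have n0 : 0 <= `|x - p| by [].
  have : K * `|x - p| <= c by apply/ltW/(le_lt_trans _ xc); rewrite mulrC ler_wpM2l // lerDl.
  by rewrite c2 in A; lra.
move=> x y; rewrite !lt_min => /andP[x1 x2] /andP[y1 y2].
have fx := low _ x1 x2; have fy := low _ y1 y2.
have fx0 : f x != 0 by rewrite -normr_gt0; exact: lt_le_trans fx.
have fy0 : f y != 0 by rewrite -normr_gt0; exact: lt_le_trans fy.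
have -> : (f x)^-1 - (f y)^-1 = (f y - f x) * ((f x)^-1 * (f y)^-1) by field; rewrite fx0 fy0.
rewrite normrM [leRHS]mulrAC; apply: ler_pM => //; first by rewrite distrC; exact: H.
rewrite normrM !normfV -invfM lef_pV2 ?posrE ?mulr_gt0 ?exprn_gt0 ?normr_gt0 //.
by rewrite expr2; apply: ler_pM => //; exact: ltW.
Qed.

(** The increments are estimated by the mean value theorem along segments. *)
Lemma lipschitz_near_C1 (f : 'rV[R]_m -> R) p :
  (\forall x \near p, differentiable f x) ->
  (forall i, {for p, continuous (partial i f)}) -> lipschitz_near f p.
Proof.
move=> df cpf.
have bnd : \forall x \near p, forall i, `|partial i f x| <= `|partial i f p| + 1.
  apply: (@filter_forall _ 'I_m (fun i x => `|partial i f x| <= `|partial i f p| + 1) (nbhs p) _) => i.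
  by apply: (cvgr_norm_le _ (cpf i)); rewrite ltrDl.
have dfb : \forall x \near p, differentiable f x /\
    forall i, `|partial i f x| <= `|partial i f p| + 1 by exact: filterI.
have /nbhs_ballP[d /= d0 H] := dfb.
pose K := \sum_i (`|partial i f p| + 1).
have K0 : 0 <= K by apply: sumr_ge0 => i _; rewrite addr_ge0.
exists K, d; split=> // x y xd yd.
pose q t := t *: (x - y) + y.
have qd r : 0 <= r <= 1 -> ball p d (q r).
  move=> /andP[r0 r1]; rewrite -ball_normE /= distrC.
  have -> : q r - p = r *: (x - p) + (1 - r) *: (y - p).
    rewrite /q !scalerBr !scalerBl !scale1r.
    by apply/rowP => j; rewrite !mxE; ring.
  have [r00|r00] := eqVneq r 0.
    by rewrite r00 scale0r add0r subr0 scale1r.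
  apply: le_lt_trans (ler_normD _ _) _; rewrite !normrZ (ger0_norm r0).
  rewrite ger0_norm ?subr_ge0 //.
  have rp : 0 < r by rewrite lt_def r00.
  have : r * `|x - p| < r * d by rewrite ltr_pM2l.
  have : (1 - r) * `|y - p| <= (1 - r) * d by rewrite ler_wpM2l ?subr_ge0 // ltW.
  lra.
have := @norm_increment_le _ (f \o q)
  (fun r => \sum_i (x - y) 0 i * partial i f (q r)) (K * `|x - y|) 0 1.
have q1 : q 1 = x by rewrite /q scale1r subrK.
have q0 : q 0 = y by rewrite /q scale0r add0r.
rewrite /= q1 q0 subr0 normr1 mulr1; apply.
  move=> r; rewrite (min_idPl _) // (max_idPr _) // => r01.
  have [dfq _] := H _ (qd _ r01).
  have dq := is_derive_line y (x - y) r.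
  have dqr : derivable q r 1 by case: dq.
  have := is_derive_comp_curve dfq dqr.
  by rewrite derive1E (@derive_val _ _ _ _ _ _ _ dq).
move=> r; rewrite (min_idPl _) // (max_idPr _) // => r01.
have [_ bq] := H _ (qd _ r01).
apply: le_trans (ler_norm_sum _ _ _) _.
rewrite /K mulr_suml; apply: ler_sum => i _; rewrite normrM mulrC.
by apply: ler_pM => //; exact: norm_coord_le.
Qed.

Lemma lipschitz_near_det n (A : 'rV[R]_m -> 'M[R]_n) p :
  (forall i j, lipschitz_near (fun x => A x i j) p) ->
  lipschitz_near (fun x => \det (A x)) p.
Proof.
move=> H; rewrite /determinant; apply: lipschitz_near_sum => s _.
apply: lipschitz_nearM; first exact: lipschitz_near_cst.
by apply: lipschitz_near_prod => i _.
Qed.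

(** Cramer's rule. *)
Lemma lipschitz_near_invmx n (A : 'rV[R]_m -> 'M[R]_n) p :
  (\forall x \near p, A x \in unitmx) ->
  (forall i j, lipschitz_near (fun x => A x i j) p) ->
  forall i j, lipschitz_near (fun x => invmx (A x) i j) p.
Proof.
move=> uA H i j.
apply: (@lipschitz_near_ext _ (fun x => (\det (A x))^-1 * cofactor (A x) j i)).
  by apply: filterS uA => x; rewrite /invmx => ->; rewrite !mxE.
apply: lipschitz_nearM.
  apply: lipschitz_nearV; last exact: lipschitz_near_det.
  by have := nbhs_singleton uA; rewrite unitmxE unitfE.
apply: lipschitz_nearM; first exact: lipschitz_near_cst.
by apply: lipschitz_near_det => k l; under eq_fun do rewrite !mxE.
Qed.

Lemma lipschitz_near_rV n (F : 'rV[R]_m -> 'rV[R]_n) p :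
  (forall i, lipschitz_near (fun x => F x 0 i) p) -> lipschitz_near F p.
Proof.
move=> H; have /choice[Kd HK] : forall i, exists Kd : R * R,
   [/\ 0 <= Kd.1, 0 < Kd.2 & forall x y, `|x - p| < Kd.2 -> `|y - p| < Kd.2 ->
    `|F x 0 i - F y 0 i| <= Kd.1 * `|x - y|].
  by move=> i; have [K [d ?]] := H i; exists (K, d).
have K0 : 0 <= \sum_i (Kd i).1 by apply: sumr_ge0 => i _; case: (HK i).
exists (\sum_i (Kd i).1), (\big[Num.min/1]_i (Kd i).2); split=> //.
  by apply: lt_bigmin => // i _; case: (HK i).
move=> x y xd yd.
apply: norm_row_le => [|i]; first exact: mulr_ge0.
have dle := bigmin_le 1 i (fun i => (Kd i).2).
have [Ki _ /(_ _ _ (lt_le_trans xd dle) (lt_le_trans yd dle))] := HK i.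
rewrite !mxE => h; apply: le_trans h _; rewrite ler_wpM2r //.
rewrite (bigD1 i) //= lerDl; apply: sumr_ge0 => j _; by case: (HK j).
Qed.

(** Clamping the coordinates to a cube around [p] turns the local Lipschitz bound
    into a global one; the solution starts at [p] and does not leave the cube at
    once. *)
Lemma picard (F : 'rV[R]_m -> 'rV[R]_m) p : lipschitz_near F p ->
  exists (u : R -> 'rV[R]_m) d, [/\ 0 < d, u 0 = p
  & forall t : R, `|t| < d -> is_derive t 1 u (F (u t))].
Proof.
move=> [K [d [K0 d0 FK]]].
pose r := d / 2; have r0 : 0 < r by exact: divr_gt0.
have rd : r < d by rewrite /r; lra.
pose c (x : 'rV[R]_m) : 'rV[R]_m :=
  \row_i Num.max (p 0 i - r) (Num.min (p 0 i + r) (x 0 i)).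
have cl x y : `|c x - c y| <= `|x - y|.
  apply: norm_row_le => // i; rewrite !mxE.
  apply: le_trans (max_dist _ _ _) _; apply: le_trans (min_dist _ _ _) _.
  by apply: le_trans (norm_coord_le _ i); rewrite !mxE.
have cd x : `|c x - p| < d.
  apply: le_lt_trans rd; apply: norm_row_le => [|i]; first exact: ltW.
  rewrite !mxE ler_norml.
  move: (p 0 i) (x 0 i) => a b.
  have [h1|h1] := leP (a + r) b.
    by have [h2|h2] := leP (a - r) (a + r); lra.
  by have [h2|h2] := leP (a - r) b; lra.
have cid x : `|x - p| <= r -> c x = x.
  move=> xr; apply/rowP => i; rewrite mxE.
  have := le_trans (norm_coord_le _ i) xr.
  rewrite !mxE ler_norml => /andP[x1 x2].
  by rewrite (min_idPr _) ?(max_idPr _) //; lra.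
have Fcl x y : `|(F \o c) x - (F \o c) y| <= K * `|x - y|.
  by apply: le_trans (FK _ _ (cd x) (cd y)) _; rewrite ler_wpM2l.
have Fcb x : `|(F \o c) x| <= `|F p| + K * d.
  have pd : `|p - p| < d by rewrite subrr normr0.
  rewrite /= -[F (c x)](subrK (F p)) addrC; apply: le_trans (ler_normD _ _) _.
  rewrite lerD2l; apply: le_trans (FK _ _ (cd x) pd) _.
  by rewrite ler_wpM2l // ltW.
have [u [e [e0 u0 ub ud]]] := picard_global p Fcl Fcb K0.
set B := `|F p| + K * d in ub; have B0 : 0 <= B by exact: le_trans (Fcb p).
exists u, (Num.min e (r / (B + 1))); split=> //.
  by rewrite lt_min e0 divr_gt0 // ltr_wpDl.
move=> t; rewrite lt_min => /andP[te]; rewrite ltr_pdivlMr ?ltr_wpDl // => tr.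
have := ud _ te; rewrite /= cid //.
apply: le_trans (ub t) _; apply: le_trans (ltW tr).
by rewrite mulrC ler_wpM2l // lerDl.
Qed.
End LipschitzNear.

(** * Inner products on the tangent spaces *)

Section InnerProduct.
Variables (R : realType) (n : nat) (M : riemannianManifold R n).
Implicit Types (x y : M) (u v w : 'rV[R]_n) (A : 'M[R]_n).

Lemma cod_center x : (phi x @` dom x) (phi x x).
Proof. by exists x => //; exact: dom_center. Qed.

Lemma gram_unit x u : (phi x @` dom x) u -> gram x u \in unitmx.
Proof.
move=> ux; rewrite unitmxE unitfE; apply/det0P => -[v v0 vG].
by have := gram_pos ux v0; rewrite vG mul0mx mxE ltxx.
Qed.

Lemma metric_unit x : metric x \in unitmx.
Proof. exact/gram_unit/cod_center. Qed.

Lemma metric_sym x : (metric x)^T = metric x.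
Proof. exact/gram_sym/cod_center. Qed.

Lemma innerC x v w : inner x v w = inner x w v.
Proof.
rewrite /inner -[in LHS](trmxK (v *m metric x *m w^T)) mxE.
by rewrite !trmx_mul trmxK metric_sym mulmxA.
Qed.

Lemma innerDl x u v w : inner x (u + v) w = inner x u w + inner x v w.
Proof. by rewrite /inner !mulmxDl mxE. Qed.

Lemma innerZl x a v w : inner x (a *: v) w = a * inner x v w.
Proof. by rewrite /inner -!scalemxAl mxE. Qed.

Lemma innerDr x u v w : inner x w (u + v) = inner x w u + inner x w v.
Proof. by rewrite innerC innerDl !(innerC _ w). Qed.

Lemma innerZr x a v w : inner x w (a *: v) = a * inner x w v.
Proof. by rewrite innerC innerZl (innerC _ w). Qed.

Lemma inner0l x w : inner x 0 w = 0.
Proof. by rewrite /inner !mul0mx mxE. Qed.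

Lemma inner0r x w : inner x w 0 = 0.
Proof. by rewrite innerC inner0l. Qed.

Lemma inner_gt0 x v : v != 0 -> 0 < inner x v v.
Proof. exact/gram_pos/cod_center. Qed.

Lemma inner_ge0 x v : 0 <= inner x v v.
Proof.
have [->|/(inner_gt0 x)/ltW//] := eqVneq v 0; by rewrite inner0l.
Qed.

Lemma tnorm_ge0 x v : 0 <= tnorm x v.
Proof. exact: sqrtr_ge0. Qed.

Lemma tnorm_sqr x v : tnorm x v ^+ 2 = inner x v v.
Proof. by rewrite sqr_sqrtr // inner_ge0. Qed.

Lemma tnorm_gt0 x v : v != 0 -> 0 < tnorm x v.
Proof. by move=> v0; rewrite sqrtr_gt0 inner_gt0. Qed.

Lemma tnorm0 x : tnorm x 0 = 0.
Proof. by rewrite /tnorm inner0l sqrtr0. Qed.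

Lemma tnorm_eq0 x v : tnorm x v = 0 -> v = 0.
Proof. by move=> /eqP; apply: contraTeq => /(tnorm_gt0 x)/gt_eqF ->. Qed.

Lemma tnormZ x a v : tnorm x (a *: v) = `|a| * tnorm x v.
Proof.
by rewrite /tnorm innerZl innerZr mulrA -expr2 sqrtrM ?sqr_ge0 // sqrtr_sqr.
Qed.

Lemma tnormN x v : tnorm x (- v) = tnorm x v.
Proof. by rewrite -scaleN1r tnormZ normrN1 mul1r. Qed.

Lemma inner_cauchy x v w : `|inner x v w| <= tnorm x v * tnorm x w.
Proof.
rewrite -ler_sqr ?nnegrE ?mulr_ge0 ?tnorm_ge0 //.
rewrite real_normK ?num_real // exprMn !tnorm_sqr.
have [->|w0] := eqVneq w 0; first by rewrite inner0r inner0l mulr0 expr0n.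
have wp := inner_gt0 x w0; set b := inner x w w in wp *.
have := inner_ge0 x (b *: v + (- inner x v w) *: w).
rewrite !(innerDl, innerDr, innerZl, innerZr) (innerC _ w v) -/b.
set a := inner x v v; set c := inner x v w => H.
have : 0 <= b * (a * b - c ^+ 2) by apply: le_trans H _; rewrite le_eqVlt; apply/orP; left; apply/eqP; ring.
by rewrite pmulr_rge0 // subr_ge0.
Qed.

Lemma inner_ge_cauchy x v w : - (tnorm x v * tnorm x w) <= inner x v w.
Proof. by have := inner_cauchy x v w; rewrite ler_norml => /andP[]. Qed.

Lemma inner_mul_invmx x v w : inner x v (w *m invmx (metric x)) = (v *m w^T) 0 0.
Proof.
rewrite /inner trmx_mul trmx_inv metric_sym mulmxA -(mulmxA v).
by rewrite mulmxV ?metric_unit // mulmx1.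
Qed.

Lemma coord_le_tnorm x i v : `|v 0 i| <= tnorm x (delta_mx 0 i *m invmx (metric x)) * tnorm x v.
Proof.
rewrite mulrC; apply: le_trans (inner_cauchy x _ _).
by rewrite inner_mul_invmx trmx_delta -colE mxE.
Qed.

Lemma tnormD x v w : tnorm x (v + w) <= tnorm x v + tnorm x w.
Proof.
rewrite -ler_sqr ?nnegrE ?addr_ge0 ?tnorm_ge0 // sqrrD !tnorm_sqr.
rewrite innerDl !innerDr (innerC _ w v).
have := le_trans (ler_norm _) (inner_cauchy x v w).
move: (inner x v w) (inner x v v) (inner x w w) (tnorm x v * tnorm x w) => c a b d.
by rewrite mulr2n; lra.
Qed.

Lemma tnorm_sum x (I : finType) (F : I -> 'rV[R]_n) :
  tnorm x (\sum_i F i) <= \sum_i tnorm x (F i).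
Proof.
elim/big_ind2 : _ => [|v a w b va wb|//]; first by rewrite tnorm0.
exact: le_trans (tnormD _ _ _) (lerD va wb).
Qed.

(** The coordinates of a vector are controlled by its norm, so that the set whose
    supremum is the operator norm is bounded. *)
Lemma opnorm_bound x A kappa v : opnorm x A <= kappa ->
  inner x v (v *m A) <= kappa * tnorm x v ^+ 2.
Proof.
move=> Ak; have [->|v0] := eqVneq v 0.
  by rewrite mul0mx inner0l tnorm0 expr0n mulr0.
have vp := tnorm_gt0 x v0.
set S := [set tnorm x (v *m A) | v in [set v | tnorm x v <= 1]].
pose C := \sum_i tnorm x (delta_mx 0 i *m invmx (metric x)) * tnorm x (row i A).
have S_ub : has_ubound S.
  exists C => _ [w /= w1 <-].
  rewrite mulmx_sum_row; apply: le_trans (tnorm_sum _ _) _.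
  apply: ler_sum => i _; rewrite tnormZ; apply: ler_wpM2r; first exact: tnorm_ge0.
  apply: le_trans (coord_le_tnorm x i w) _.
  by rewrite ler_piMr // tnorm_ge0.
pose w := (tnorm x v)^-1 *: v.
have w1 : tnorm x w = 1 by rewrite tnormZ gtr0_norm ?invr_gt0 // mulVf // gt_eqF.
have wA : tnorm x (w *m A) <= kappa.
  by apply: le_trans Ak; apply: ub_le_sup => //; exists w => //=; rewrite w1.
have vw : v = tnorm x v *: w by rewrite scalerA mulfV ?scale1r // gt_eqF.
rewrite {1 2}vw -scalemxAl innerZl innerZr mulrA -expr2 mulrC.
rewrite ler_wpM2r ?exprn_ge0 ?tnorm_ge0 //.
apply: le_trans (ler_norm _) _; apply: le_trans (inner_cauchy _ _ _) _.
by rewrite w1 mul1r.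
Qed.

(** A negative infimum is that of a nonempty set of eigenvalues bounded below; an
    eigenvector for an eigenvalue close to it is suitable. *)
Lemma lambda_min_le_direction x A b e : lambda_min A <= - b -> 0 < b -> 0 < e ->
  exists2 v, tnorm x v = 1 & inner x v (v *m A) <= - b + e.
Proof.
move=> Ab b0 e0; have Al0 : lambda_min A < 0 by apply: le_lt_trans Ab _; rewrite oppr_lt0.
have hA : has_inf [set a | eigenvalue A a].
  by apply: contrapT => /inf_out Aout; move: Al0; rewrite /lambda_min Aout ltxx.
have [a /= /eigenvalueP[v vA v0] ae] := inf_adherent e0 hA.
have vp := tnorm_gt0 x v0; pose w := (tnorm x v)^-1 *: v.
have w1 : tnorm x w = 1 by rewrite tnormZ gtr0_norm ?invr_gt0 // mulVf // gt_eqF.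
exists w => //; rewrite /w -scalemxAl vA scalerA mulrC -scalerA -/w innerZr -tnorm_sqr w1.
rewrite expr1n mulr1; apply: ltW; apply: lt_le_trans ae _.
by rewrite lerD2r.
Qed.

Lemma lambda_min_ge0 x A : (forall v, 0 <= inner x v (v *m A)) -> 0 <= lambda_min A.
Proof.
move=> A0; rewrite /lambda_min.
have [->|/set0P S0] := eqVneq [set a | eigenvalue A a] set0; first by rewrite inf0.
apply: lb_le_inf => // a /= /eigenvalueP[v vA v0].
by have := A0 v; rewrite vA innerZr pmulr_lge0 // inner_gt0.
Qed.

End InnerProduct.

(** * Smooth maps *)

Section Smooth.
Variables (R : realType) (m : nat).

Lemma smooth_differentiable (V : normedModType R) U (F : 'rV[R]_m -> V) u :
  smooth U F -> U u -> differentiable F u.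
Proof. by move=> /(_ 1%N)[dF _]; exact: dF. Qed.

Lemma smooth_partial (V : normedModType R) U (F : 'rV[R]_m -> V) i :
  smooth U F -> smooth U (partial i F).
Proof. by move=> sF k; exact: (sF k.+1).2. Qed.

Lemma C2_twice_differentiable (V : normedModType R) U (F : 'rV[R]_m -> V) u :
  Ck 2 U F -> open U -> U u -> twice_differentiable_at F u.
Proof.
move=> [dF CF] oU Uu; split; last by move=> i; exact: (CF i).1.
by apply: filterS (open_nbhs_nbhs (conj oU Uu)) => w; exact: dF.
Qed.

Lemma smooth_lipschitz_near U (F : 'rV[R]_m -> R) u :
  smooth U F -> open U -> U u -> lipschitz_near F u.
Proof.
move=> sF oU Uu; apply: lipschitz_near_C1 => [|i].
  apply: filterS (open_nbhs_nbhs (conj oU Uu)) => w; exact: smooth_differentiable.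
by apply: differentiable_continuous; apply: smooth_differentiable Uu; exact: smooth_partial.
Qed.

End Smooth.

Lemma quad_sum (R : comRingType) n (v w : 'rV[R]_n) (A : 'M[R]_n) :
  (v *m A *m w^T) 0 0 = \sum_j \sum_i v 0 i * w 0 j * A i j.
Proof.
rewrite mxE; apply: eq_bigr => j _; rewrite !mxE mulr_suml.
by apply: eq_bigr => i _; ring.
Qed.

(** * Curves and their speed *)

Section Curves.
Variables (R : realType) (n : nat) (M : riemannianManifold R n).
Implicit Types (x y z : M) (c : R -> M) (u v w : 'rV[R]_n).

Lemma gram_entry_continuous y u i j : (phi y @` dom y) u ->
  {for u, continuous (fun w => gram y w i j)}.
Proof.
move=> uy; apply: differentiable_continuous.
exact: smooth_differentiable (@gram_smooth _ _ M y i j) uy.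
Qed.

Lemma curve_continuous y c (r : R) : (\forall s \near r, dom y (c s)) ->
  derivable (phi y \o c) r 1 -> {for r, continuous c}.
Proof.
move=> dc /derivable1_diffP/differentiable_continuous cq.
have dr := nbhs_singleton dc.
have cc : {for r, continuous (psi y \o (phi y \o c))}.
  by apply: continuous_comp => //; apply: psi_continuous; exists (c r).
have E : {near r, (psi y \o (phi y \o c)) =1 c}.
  by apply: filterS dc => s ds /=; rewrite phiK.
move: cc; rewrite /prop_for /continuous_at /= phiK // => cc.
by apply: cvg_trans cc; apply: near_eq_cvg.
Qed.

Lemma chart_velocity y z c (r : R) : (\forall s \near r, dom y (c s)) ->
  derivable (phi y \o c) r 1 -> dom z (c r) ->
  is_derive r 1 (phi z \o c)
    (derive1 (phi y \o c) r *m 'J (phi z \o psi y) (phi y (c r))).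
Proof.
move=> dc dq dz; have dr := nbhs_singleton dc.
have E : {near r, ((phi z \o psi y) \o (phi y \o c)) =1 (phi z \o c)}.
  by apply: filterS dc => s ds /=; rewrite phiK.
apply: near_eq_is_derive E _.
have dT : differentiable (phi z \o psi y) (phi y (c r)).
  by apply: smooth_differentiable (@transition_smooth _ _ M y z) _; exists (c r).
rewrite -(deriveEjacobian _ dT) (derive_partials _ dT).
exact: (is_derive_comp_curve dT dq).
Qed.

Lemma near_dom c (r : R) z : {for r, continuous c} -> dom z (c r) ->
  \forall s \near r, dom z (c s).
Proof.
by move=> cc dz; apply: cc; apply: open_nbhs_nbhs; split=> //; exact: dom_open.
Qed.

(** The Jacobian of the transition map acts in opposite ways on the velocity and on
    the metric. *)
Lemma speed_chart y c (r : R) : (\forall s \near r, dom y (c s)) ->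
  derivable (phi y \o c) r 1 ->
  inner (c r) (velocity c r) (velocity c r) =
  (derive1 (phi y \o c) r *m gram y (phi y (c r))
     *m (derive1 (phi y \o c) r)^T) 0 0.
Proof.
move=> dc dq; have dr := nbhs_singleton dc; set z := c r.
have dz : dom z (c r) by exact: dom_center.
have cv := chart_velocity dc dq dz.
have -> : velocity c r = derive1 (phi y \o c) r *m 'J (phi z \o psi y) (phi y (c r)).
  by rewrite /velocity derive1E; case: cv.
rewrite (@gram_change _ _ _ y z); last by exists z.
by rewrite /inner /metric phiK // trmx_mul !mulmxA.
Qed.

Lemma is_derive_along f c (r : R) y : C2_fun f ->
  (\forall s \near r, dom y (c s)) -> derivable (phi y \o c) r 1 ->
  is_derive r 1 (f \o c) (inner (c r) (velocity c r) (grad f (c r))).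
Proof.
move=> Cf dc dq; have dr := nbhs_singleton dc; set z := c r.
have dz : dom z (c r) by exact: dom_center.
have cv := chart_velocity dc dq dz.
have dzs := near_dom (curve_continuous dc dq) dz.
have E : {near r, ((f \o psi z) \o (phi z \o c)) =1 (f \o c)}.
  by apply: filterS dzs => s ds /=; rewrite phiK.
apply: near_eq_is_derive E _.
have dF : differentiable (f \o psi z) (phi z (c r)).
  by have [dF _] := Cf z; apply: dF; exists z.
have dqz : derivable (phi z \o c) r 1 by case: cv.
apply: (is_derive_eq (is_derive_comp_curve dF dqz)).
rewrite /grad inner_mul_invmx mxE /velocity.
by apply: eq_bigr => i _; rewrite !mxE.
Qed.

Lemma speed_continuous c t : C1_curve c -> t \in `[0, 1] ->
  {for t, continuous (fun r => tnorm (c r) (velocity c r))}.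
Proof.
move=> Cc /Cc[y near_t].
have dc : \forall s \near t, dom y (c s) by apply: filterS near_t => r [].
pose q := phi y \o c.
have E : {near t, (fun r => Num.sqrt
    (\sum_j \sum_i derive1 q r 0 i * derive1 q r 0 j * gram y (q r) i j)) =1
    (fun r => tnorm (c r) (velocity c r))}.
  have := near_join near_t; apply: filterS => r nr.
  have [_ dr _] := nbhs_singleton nr.
  rewrite /tnorm (@speed_chart y) //; first by rewrite quad_sum.
  by apply: filterS nr => s [].
have [dt dqt cdq] := nbhs_singleton near_t.
have cq : {for t, continuous q}.
  move: dqt => /derivable1_diffP; exact: differentiable_continuous.
have ut : (phi y @` dom y) (q t) by exists (c t).
have cg i j : {for t, continuous ((fun w => gram y w i j) \o q)}.
  by apply: continuous_comp => //; exact: gram_entry_continuous.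
have cd i : {for t, continuous ((fun v : 'rV[R]_n => v 0 i) \o derive1 q)}.
  by apply: continuous_comp => //; exact: coord_continuous.
have cont : {for t, continuous (fun r => Num.sqrt
    (\sum_j \sum_i derive1 q r 0 i * derive1 q r 0 j * gram y (q r) i j))}.
  apply: (@continuous_comp _ _ _ _ Num.sqrt); last exact: sqrt_continuous.
  apply: cvg_big => [|j _]; first exact: add_continuous.
  apply: cvg_big => [|i _]; first exact: add_continuous.
  by apply: cvgM; [apply: cvgM; exact: cd | exact: cg].
move: cont; rewrite /prop_for /continuous_at (nbhs_singleton E) => cont.
by apply: cvg_trans cont; apply: near_eq_cvg.
Qed.

End Curves.

(** * Lengths and the Riemannian distance *)

Section Distance.
Variables (R : realType) (n : nat) (M : riemannianManifold R n).
Implicit Types (x y z : M) (c : R -> M) (u v w : 'rV[R]_n).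
Notation mu := (@lebesgue_measure R).

Lemma is_derive_affine (V : normedModType R) (q : R -> V) (a b t : R) dq :
  is_derive (a * t + b) 1 q dq -> is_derive t 1 (fun s => q (a * s + b)) (a *: dq).
Proof.
move=> [/derivable1_diffP dfq qE].
have dl : is_derive t 1 (fun s : R => a * s + b) a.
  have := is_deriveD (@is_deriveZ _ _ _ _ a _ _ _ (is_derive_id t 1)) (is_derive_cst b t 1).
  by rewrite addr0 /GRing.scale /= mulr1.
have dfl : differentiable (fun s : R => a * s + b) t.
  by case: dl => /derivable1_diffP.
have dfc : differentiable (q \o (fun s : R => a * s + b)) t by exact: differentiable_comp.
apply: DeriveDef; first exact/derivable1_diffP.
rewrite (deriveE _ dfc) (diff_comp dfl dfq) /= -(deriveE _ dfl).
case: dl => _ ->; rewrite -qE (deriveE _ dfq) -[X in 'd q _ X](mulr1 a).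
exact: linearZ.
Qed.

Lemma affine_continuous (a b : R) : continuous (fun s : R => a * s + b).
Proof.
move=> t; apply: cvgD; last exact: cvg_cst.
by apply: cvgM; [exact: cvg_cst | exact: cvg_id].
Qed.

Lemma near_affine (P : R -> Prop) (a b t : R) :
  (\forall r \near (a * t + b), P r) -> \forall r \near t, P (a * r + b).
Proof. by move=> nP; exact: (@affine_continuous a b t P nP). Qed.

Lemma velocity_affine y c a b (t : R) :
  (\forall s \near (a * t + b), dom y (c s)) -> derivable (phi y \o c) (a * t + b) 1 ->
  velocity (fun s => c (a * s + b)) t = a *: velocity c (a * t + b).
Proof.
move=> dc dq; have dz := dom_center (c (a * t + b)).
have cv := chart_velocity dc dq dz.
have [_ E] := is_derive_affine cv.
rewrite -[LHS]/(derive1 (fun s => (phi (c (a * t + b)) \o c) (a * s + b)) t).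
rewrite derive1E E; congr (_ *: _); rewrite /velocity [RHS]derive1E.
by case: cv => _ ->.
Qed.

Lemma continuous_within_segment (g : R -> R) :
  (forall t, t \in `[0, 1] -> {for t, continuous g}) ->
  {within `[0, 1], continuous g}.
Proof. by move=> cg; apply: continuous_in_subspaceT => t /set_mem /cg. Qed.

Lemma curve_length_eq_cst c k :
  (forall t, t \in `[0, 1] -> tnorm (c t) (velocity c t) = k) -> curve_length c = k.
Proof.
move=> ck; rewrite /curve_length.
rewrite (@eq_Rintegral _ _ _ _ _ (fun=> k)) => [|t /set_mem]; last exact: ck.
by rewrite Rintegral_cst // /= lebesgue_measure_itv /= lte_fin ltr01 oppr0 adde0 /= mulr1.
Qed.

Lemma curve_length_le c k : C1_curve c ->
  (forall t, t \in `[0, 1] -> tnorm (c t) (velocity c t) <= k) -> curve_length c <= k.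
Proof.
move=> Cc ck.
have <- : \int[mu]_(t in `[0, 1]) k = k.
  by rewrite Rintegral_cst // /= lebesgue_measure_itv /= lte_fin ltr01 oppr0 adde0 /= mulr1.
apply: le_Rintegral => //.
- apply: continuous_compact_integrable; first exact: segment_compact.
  by apply: continuous_within_segment => t; exact: speed_continuous.
- apply: continuous_compact_integrable; first exact: segment_compact.
  by apply: continuous_within_segment => t _; exact: cvg_cst.
Qed.

Lemma curve_length_ge0 c : 0 <= curve_length c.
Proof. by apply: Rintegral_ge0 => t _; exact: tnorm_ge0. Qed.

Lemma C1_curve_flip c : C1_curve c -> C1_curve (fun t => c (-1 * t + 1)).
Proof.
move=> Cc t; rewrite in_itv /= => /andP[t0 t1].
have /Cc[y near_t] : -1 * t + 1 \in `[0, 1] by rewrite in_itv /=; lra.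
exists y; pose P r := [/\ dom y (c r), derivable (phi y \o c) r 1
  & {for r, continuous (derive1 (phi y \o c))}].
have near_t' : \forall r \near t, P (-1 * r + 1).
  by apply: near_affine; exact: near_t.
apply: filterS (near_join near_t') => r near_r.
have [dr dq cdq] := nbhs_singleton near_r; split; first exact: dr.
  by case: (is_derive_affine (derivableP dq)) => + _; exact.
have E : {near r, (fun s => -1 *: derive1 (phi y \o c) (-1 * s + 1)) =1
    derive1 (phi y \o (fun t => c (-1 * t + 1)))}.
  apply: filterS near_r => s [_ dqs _].
  by rewrite [RHS]derive1E; have [_ ->] := is_derive_affine (derivableP dqs); rewrite derive1E.
have cont : {for r, continuous (fun s : R => -1 *: derive1 (phi y \o c) (-1 * s + 1))}.
  apply: (@continuous_comp _ _ _ (derive1 (phi y \o c) \o (fun s : R => -1 * s + 1))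
    ( *:%R (-1) : 'rV[R]_n -> 'rV[R]_n)); last exact: scaler_continuous.
  apply: continuous_comp; [exact: affine_continuous | exact: cdq].
move: cont; rewrite /prop_for /continuous_at (nbhs_singleton E) => cont.
by apply: cvg_trans cont; apply: near_eq_cvg.
Qed.

Lemma curve_length_flip c : C1_curve c ->
  curve_length (fun t => c (-1 * t + 1)) = curve_length c.
Proof.
move=> Cc; pose g t := tnorm (c t) (velocity c t).
have cg : {within `[0, 1], continuous g}.
  by apply: continuous_within_segment => t; exact: speed_continuous.
have z1 : (0 : R) <= (1 : R) <= 1 by rewrite ler01 lexx.
have H : \int[mu]_(t in `[0, 1]) g t = \int[mu]_(t in `[1 - 1, 1]) g (1 - t).
  exact: Rintegration_by_substitution_onem z1 cg.
rewrite subrr in H.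
apply/esym; apply: (etrans H); apply: eq_Rintegral => t /set_mem /= {H cg}.
rewrite in_itv /= => /andP[t0 t1].
have /Cc[y near_t] : -1 * t + 1 \in `[0, 1] by rewrite in_itv /=; lra.
have [_ dq _] := nbhs_singleton near_t.
have dn : \forall s \near (-1 * t + 1), dom y (c s) by apply: filterS near_t => r [].
by rewrite (velocity_affine dn dq) scaleN1r tnormN /g mulN1r addrC.
Qed.

Lemma joined_trans x y z l k : joined x y l -> joined y z k -> joined x z (l + k).
Proof.
elim=> [w|c w l' Cc _ IH] jk; first by rewrite add0r.
by rewrite -addrA; apply: joined_step => //; exact: IH.
Qed.

Lemma joined_curve c : C1_curve c -> joined (c 0) (c 1) (curve_length c).
Proof.
by move=> Cc; rewrite -[curve_length c]addr0; apply: joined_step Cc (joined_refl _).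
Qed.

Lemma joined_sym x y l : joined x y l -> joined y x l.
Proof.
elim=> [w|c w k Cc _ IH]; first exact: joined_refl.
rewrite addrC; apply: joined_trans IH _.
have := joined_curve (C1_curve_flip Cc).
by rewrite curve_length_flip // mulr0 add0r mulr1 addNr.
Qed.

Lemma dist_sym x y : dist x y = dist y x.
Proof.
rewrite /dist; congr ereal_inf; apply/seteqP.
by split=> _ [l /= j <-]; exists l => //; exact: joined_sym.
Qed.

Lemma dist_le_joined x y l : joined x y l -> (dist x y <= l%:E)%E.
Proof. by move=> j; apply: ereal_inf_lbound; exists l. Qed.

Lemma dist_le_curve c : C1_curve c -> (dist (c 0%R) (c 1%R) <= (curve_length c)%:E)%E.
Proof. by move=> Cc; apply: dist_le_joined; exact: joined_curve. Qed.

Lemma dist_refl_le x (r : R) : 0 <= r -> (dist x x <= r%:E)%E.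
Proof.
by move=> r0; apply: le_trans (dist_le_joined (joined_refl x)) _; rewrite lee_fin.
Qed.

Lemma dist_ltP x y (r : R) : (dist x y < r%:E)%E -> exists2 l, joined x y l & l < r.
Proof.
by move=> /ereal_inf_lt[_ [l /= j <-]]; rewrite lte_fin => lr; exists l.
Qed.

Lemma dist_lt_trans x y z (a b : R) : (dist x y < a%:E)%E -> (dist y z < b%:E)%E ->
  (dist x z < (a + b)%:E)%E.
Proof.
move=> /dist_ltP[l jl la] /dist_ltP[k jk kb].
apply: le_lt_trans (dist_le_joined (joined_trans jl jk)) _.
by rewrite lte_fin ltrD.
Qed.

(** A chart segment from [y] to [z] has length at most a constant times the
    distance of the coordinates, since the metric is bounded near [y]. *)
Lemma dist_near y (e : R) : 0 < e -> \forall z \near y, (dist y z < e%:E)%E.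
Proof.
move=> e0; set u0 := phi y y.
have uy : (phi y @` dom y) u0 by exact: cod_center.
pose B := \sum_j \sum_i (`|gram y u0 i j| + 1).
have B0 : 0 <= B by do 2 (apply: sumr_ge0 => ? _); rewrite addr_ge0.
have nb : \forall w \near u0, (phi y @` dom y) w /\
    forall ij : 'I_n * 'I_n, `|gram y w ij.1 ij.2| <= `|gram y u0 ij.1 ij.2| + 1.
  apply: filterI; first by apply: open_nbhs_nbhs; split=> //; exact: cod_open.
  apply: (@filter_forall _ ('I_n * 'I_n)%type
    (fun ij w => `|gram y w ij.1 ij.2| <= `|gram y u0 ij.1 ij.2| + 1) (nbhs u0) _) => -[i j].
  by apply: (cvgr_norm_le _ (gram_entry_continuous uy)); rewrite ltrDl.
have /nbhs_ballP[d /= d0 Hd] := nb.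
have e1 : 0 < e / (Num.sqrt B + 1) by rewrite divr_gt0 // ltr_wpDl // sqrtr_ge0.
have cphi := @phi_continuous _ _ M y y (dom_center y).
have cdist r : 0 < r -> \forall z \near y, `|u0 - phi y z| < r.
  by move=> r0; have /cvgrPdist_lt/(_ r r0) := cphi.
near=> z.
have dz : dom y z.
  by near: z; apply: open_nbhs_nbhs; split; [exact: dom_open|exact: dom_center].
have vd : `|phi y z - u0| < d by rewrite distrC; near: z; exact: cdist d0.
have ve : `|phi y z - u0| < e / (Num.sqrt B + 1).
  by rewrite distrC; near: z; exact: cdist e1.
set v := phi y z - u0 in vd ve *.
pose q (t : R) := t *: v + u0; pose c t := psi y (q t).
have qball t : t \in `[0, 1] -> ball u0 d (q t).
  rewrite in_itv /= => /andP[t0 t1]; rewrite -ball_normE /= opprD addrCA subrr addr0.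
  by rewrite normrN normrZ ger0_norm //; apply: le_lt_trans vd; rewrite ler_piMl.
have dq t : is_derive (t : R) 1 q v by exact: is_derive_line.
have qcod (t : R) : t \in `[0, 1] -> \forall r \near t, (phi y @` dom y) (q r).
  move=> /qball /Hd [qt _].
  have cq : {for t, continuous q}.
    by apply: differentiable_continuous; case: (dq t) => /derivable1_diffP.
  by apply: cq; apply: open_nbhs_nbhs; split=> //; exact: cod_open.
have phic r : (phi y @` dom y) (q r) -> dom y (c r) /\ phi y (c r) = q r.
  by move=> [p dp pq]; rewrite /c -pq phiK.
have nearq (t : R) : t \in `[0, 1] -> {near t, q =1 phi y \o c}.
  by move=> /qcod; apply: filterS => r /phic[_ /esym].
have Cc : C1_curve c.
  move=> t t01; exists y; have := near_join (qcod _ t01); apply: filterS => r nr.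
  have E : {near r, q =1 phi y \o c} by apply: filterS nr => s /phic[_ /esym].
  split.
  - by have [] := phic r (nbhs_singleton nr).
  - by have [] := near_eq_is_derive E (dq r).
  - have E2 : {near r, (fun=> v) =1 derive1 (phi y \o c)}.
      have := near_join nr; apply: filterS => s ns.
      have Es : {near s, q =1 phi y \o c} by apply: filterS ns => a /phic[_ /esym].
      by rewrite derive1E; have [_ ->] := near_eq_is_derive Es (dq s).
    rewrite /prop_for /continuous_at -(nbhs_singleton E2).
    by apply: cvg_trans (near_eq_cvg E2) _; exact: cvg_cst.
have c0 : c 0 = y by rewrite /c /q scale0r add0r phiK //; exact: dom_center.
have c1 : c 1 = z by rewrite /c /q scale1r subrK phiK.
rewrite -c1 -{1}c0; apply: le_lt_trans (dist_le_curve Cc) _; rewrite lte_fin.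
apply: (@le_lt_trans _ _ (Num.sqrt B * `|v|)); last first.
  rewrite ltr_pdivlMr ?ltr_wpDl ?sqrtr_ge0 // mulrC in ve; apply: le_lt_trans ve.
  by rewrite ler_wpM2r // lerDl.
apply: curve_length_le => // t t01.
have dcn : \forall s \near t, dom y (c s) by have := qcod _ t01; apply: filterS => r /phic[].
have dqt := near_eq_is_derive (nearq _ t01) (dq t).
have dqt' : derivable (phi y \o c) t 1 by case: dqt.
rewrite /tnorm (speed_chart dcn dqt') derive1E.
have [_ ->] := dqt; have [_ ->] := phic _ (nbhs_singleton (qcod _ t01)).
rewrite -[`|v|]ger0_norm // -sqrtr_sqr -sqrtrM // ler_wsqrtr // quad_sum.
apply: le_trans (ler_norm _) _; apply: le_trans (ler_norm_sum _ _ _) _.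
rewrite /B mulr_suml; apply: ler_sum => j _.
apply: le_trans (ler_norm_sum _ _ _) _; rewrite mulr_suml; apply: ler_sum => i _.
rewrite !normrM mulrC; apply: ler_pM => //; first by have [_ /(_ (i, j))] := Hd _ (qball _ t01).
by rewrite expr2; apply: ler_pM => //; exact: norm_coord_le.
Unshelve. all: by end_near. Qed.

End Distance.

(** * Geodesics and the Hessian *)

Section Geodesics.
Variables (R : realType) (n : nat) (M : riemannianManifold R n).
Implicit Types (x y z : M) (c : R -> M) (u v w : 'rV[R]_n) (f : M -> R).

Lemma geodesic_C1 c : geodesic c -> C1_curve c.
Proof.
move=> gc t /gc[y near_t]; exists y; apply: filterS near_t => r [dr dq ddq _].
split; [exact: dr | exact: dq |].
by move: ddq => /derivable1_diffP; exact: differentiable_continuous.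
Qed.

(** In coordinates, the derivative of the squared speed is twice the inner product
    of the velocity with its covariant derivative: the terms coming from the
    derivatives of the metric cancel against the Christoffel symbols. *)
Lemma christoffel_compatible y u (a : 'rV[R]_n) : (phi y @` dom y) u ->
  let b := \row_k - (\sum_(i < n) \sum_(j < n) christoffel y u k i j * a 0 i * a 0 j) in
  2 * (a *m gram y u *m b^T) 0 0 =
  - \sum_l \sum_i \sum_j a 0 l * a 0 i * a 0 j * partial l (fun w => gram y w i j) u.
Proof.
move=> uy b; set D := fun l i j : 'I_n => partial l (fun w => gram y w i j) u.
pose w : 'rV[R]_n := \row_l \sum_i \sum_j a 0 i * a 0 j * (D i j l + D j i l - D l i j).
have bE : b^T = - 2^-1 *: (invmx (gram y u) *m w^T).
  apply/matrixP => k z; rewrite !mxE; set s := (X in - X); set s' := (X in _ * X).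
  suff -> : s = 2^-1 * s' by rewrite mulNr.
  rewrite /s /s'; under [in RHS]eq_bigr do rewrite !mxE mulr_sumr.
  rewrite [X in _ = _ * X]exchange_big /= mulr_sumr; apply: eq_bigr => i _.
  under [in RHS]eq_bigr do rewrite mulr_sumr.
  rewrite [X in _ = _ * X]exchange_big /= mulr_sumr; apply: eq_bigr => j _.
  rewrite /christoffel -!mulrA; congr (_ * _); rewrite mulr_suml.
  by apply: eq_bigr => l _; rewrite /D; ring.
rewrite bE -scalemxAr mxE !mulmxA mulmxK ?gram_unit // mxE mulNr mulrN mulrA mulfV // mul1r.
congr (- _).
pose f l i j := a 0 l * a 0 i * a 0 j * D l i j.
transitivity (\sum_l \sum_i \sum_j (f i j l + f j i l - f l i j)).
  apply: eq_bigr => l _; rewrite !mxE mulr_sumr; apply: eq_bigr => i _.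
  by rewrite mulr_sumr; apply: eq_bigr => j _; rewrite /f; ring.
under eq_bigr do under eq_bigr do rewrite sumrB big_split.
under eq_bigr do rewrite sumrB big_split.
rewrite sumrB big_split /=.
have -> : \sum_l \sum_i \sum_j f i j l = \sum_l \sum_i \sum_j f l i j.
  rewrite exchange_big /=; apply: eq_bigr => i _; exact: exchange_big.
have -> : \sum_l \sum_i \sum_j f j i l = \sum_l \sum_i \sum_j f l i j.
  rewrite exchange_big /=; under eq_bigr do rewrite exchange_big.
  exact: exchange_big.
by rewrite addrK.
Qed.

Lemma geodesic_speed_derive y c (r : R) : (\forall s \near r, dom y (c s)) ->
  derivable (phi y \o c) r 1 -> derivable (derive1 (phi y \o c)) r 1 ->
  acceleration y c r = 0 ->
  is_derive r 1 (fun s => \sum_j \sum_i derive1 (phi y \o c) s 0 i *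
    derive1 (phi y \o c) s 0 j * gram y (phi y (c s)) i j) 0.
Proof.
move=> dc dq ddq acc; set q := phi y \o c in dq ddq acc *.
set a := derive1 q r; set b := derive1 (derive1 q) r.
have uy : (phi y @` dom y) (q r) by exists (c r) => //; exact: nbhs_singleton dc.
have da i : is_derive r 1 (fun s => derive1 q s 0 i) (b 0 i).
  apply: DeriveDef; first by move/derivable_mxP: ddq; apply.
  by rewrite /b [in RHS]derive1E (derive_mx ddq) mxE.
have dG i j : is_derive r 1 ((fun u => gram y u i j) \o q)
    (\sum_l a 0 l * partial l (fun u => gram y u i j) (q r)).
  have dg := smooth_differentiable (@gram_smooth _ _ M y i j) uy.
  exact: (is_derive_comp_curve dg dq).
have dt i j := @is_deriveM _ _ _ _ _ _ _ _
  (@is_deriveM _ _ _ _ _ _ _ _ (da i) (da j)) (dG i j).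
pose T i j := a 0 i * a 0 j * (\sum_l a 0 l * partial l (fun u => gram y u i j) (q r))
  + gram y (q r) i j * (a 0 i * b 0 j + a 0 j * b 0 i).
have dS : is_derive r 1 (\sum_j \sum_i (fun s => derive1 q s 0 i * derive1 q s 0 j *
    gram y (q s) i j)) (\sum_j \sum_i T i j).
  by apply: is_derive_sum => j; apply: is_derive_sum => i; exact: dt.
have E : \sum_j \sum_i T i j = 0.
  have bE : b = \row_k - (\sum_(i < n) \sum_(j < n) christoffel y (q r) k i j * a 0 i * a 0 j).
    apply/rowP => k; have /rowP/(_ k) := acc; rewrite !mxE => /eqP.
    by rewrite addr_eq0 => /eqP.
  have H := christoffel_compatible a uy; rewrite -bE /= in H.
  have sG : (b *m gram y (q r) *m a^T) 0 0 = (a *m gram y (q r) *m b^T) 0 0.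
    rewrite -[in LHS](trmxK (b *m gram y (q r) *m a^T)) mxE.
    by rewrite !trmx_mul trmxK gram_sym // mulmxA.
  transitivity ((a *m gram y (q r) *m b^T) 0 0 + (b *m gram y (q r) *m a^T) 0 0 +
    \sum_l \sum_i \sum_j a 0 l * a 0 i * a 0 j * partial l (fun w => gram y w i j) (q r)).
    pose t l i j := a 0 l * a 0 i * a 0 j * partial l (fun w => gram y w i j) (q r).
    rewrite [X in _ + X](_ : _ = \sum_j \sum_i \sum_l t l i j); last first.
      rewrite -/t exchange_big /=; under eq_bigr do rewrite exchange_big /=.
      by rewrite exchange_big.
    rewrite !quad_sum /t.
    rewrite -!big_split; apply: eq_bigr => j _; rewrite -!big_split; apply: eq_bigr => i _.
    rewrite /T [LHS]addrC mulr_sumr /=; congr (_ + _).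
      by ring.
    by apply: eq_bigr => l _; ring.
  by rewrite sG -mulr2n -mulr_natl H addNr.
rewrite E in dS.
have -> : (fun s => \sum_j \sum_i derive1 q s 0 i * derive1 q s 0 j * gram y (q s) i j)
  = \sum_j \sum_i (fun s => derive1 q s 0 i * derive1 q s 0 j * gram y (q s) i j).
  by apply/funext => s; rewrite fct_sumE; apply: eq_bigr => j _; rewrite fct_sumE.
exact: dS.
Qed.

(** In each chart the squared speed has zero derivative, hence is locally
    constant. *)
Lemma geodesic_speed c t : geodesic c -> t \in `[0, 1] ->
  tnorm (c t) (velocity c t) = tnorm (c 0) (velocity c 0).
Proof.
move=> gc; move: t; pose P t := tnorm (c t) (velocity c t) = tnorm (c 0) (velocity c 0).
apply: (@segment_induction _ P) => // t t01.
have [y near_t] := gc t t01.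
pose E s := \sum_j \sum_i derive1 (phi y \o c) s 0 i *
    derive1 (phi y \o c) s 0 j * gram y (phi y (c s)) i j.
have nE : \forall s \near t, is_derive (s : R) 1 E 0 /\
    inner (c s) (velocity c s) (velocity c s) = E s.
  apply: filterS (near_join near_t) => s ns.
  have dn : \forall r \near s, dom y (c r) by apply: filterS ns => r [].
  have [ds dq ddq acc] := nbhs_singleton ns; split.
    exact: geodesic_speed_derive.
  by rewrite (speed_chart dn dq) quad_sum.
have /nbhs_ballP[e /= e0 He] := nE.
exists e; first exact: e0.
move=> r s r01 s01 re se; rewrite /P /tnorm.
have [|_ Er] := He r; first by rewrite -ball_normE /= distrC.
have [|_ Es] := He s; first by rewrite -ball_normE /= distrC.
rewrite Er Es => <-; congr Num.sqrt.
apply/eqP; rewrite -subr_eq0 -normr_le0.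
apply: le_trans (@norm_increment_le _ E (fun=> 0) 0 r s _ _) _ => [a|a _|].
- rewrite ge_min le_max => /andP[ra as_]; have [|//] := He a.
  rewrite -ball_normE /= distrC; move: re se; rewrite !ltr_distl.
  clear -ra as_; move=> /andP[? ?] /andP[? ?].
  by case/orP: ra => ?; case/orP: as_ => ?; lra.
- by rewrite normr0.
- by rewrite mul0r.
Qed.

Lemma geodesic_length c : geodesic c -> curve_length c = tnorm (c 0) (velocity c 0).
Proof. by move=> gc; apply: curve_length_eq_cst => t; exact: geodesic_speed. Qed.

Lemma hess_quad f x v : inner x v (v *m hess f x) =
  \sum_j \sum_i v 0 i * v 0 j * (partial i (partial j (f \o psi x)) (phi x x)
     - \sum_(k < n) christoffel x (phi x x) k i j * partial k (f \o psi x) (phi x x)).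
Proof.
rewrite /hess mulmxA inner_mul_invmx trmx_mul mulmxA quad_sum exchange_big /=.
by apply: eq_bigr => j _; apply: eq_bigr => i _; rewrite !mxE; ring.
Qed.

(** For a curve with zero acceleration the first order terms of the second
    derivative are the ones that the Hessian subtracts. *)
Lemma second_derivative_along f c x : C2_fun f -> c 0 = x ->
  (\forall s \near (0 : R), dom x (c s)) ->
  (\forall s \near (0 : R), derivable (phi x \o c) s 1) ->
  derivable (derive1 (phi x \o c)) (0 : R) 1 -> acceleration x c 0 = 0 ->
  let a := derive1 (phi x \o c) 0 in
  is_derive (0 : R) 1 (derive1 (f \o c)) (inner x a (a *m hess f x)).
Proof.
move=> Cf c0 dc dq ddq acc a; set q := phi x \o c in dq ddq acc a *.
have q0 : q 0 = phi x x by rewrite /q /= c0.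
have tF : twice_differentiable_at (f \o psi x) (q 0).
  rewrite q0; exact: (C2_twice_differentiable (Cf x) (@cod_open _ _ M x) (cod_center x)).
have E : {near (0 : R), derive1 ((f \o psi x) \o q) =1 derive1 (f \o c)}.
  apply: filterS (near_join dc) => s ns; rewrite !derive1E.
  by apply: near_eq_derive; apply: filterS ns => r dr /=; rewrite phiK.
apply: near_eq_is_derive E _.
apply: (is_derive_eq (is_derive2_comp_curve tF dq ddq)).
rewrite hess_quad q0 -/a.
have bE k : derive1 (derive1 q) 0 0 k =
    - (\sum_(i < n) \sum_(j < n) christoffel x (phi x x) k i j * a 0 i * a 0 j).
  have /rowP/(_ k) := acc; rewrite !mxE -/q q0 => /eqP.
  by rewrite addr_eq0 => /eqP.
under [X in _ + X]eq_bigr do rewrite bE.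
under [RHS]eq_bigr do under eq_bigr do rewrite mulrBr.
under [RHS]eq_bigr do rewrite sumrB.
rewrite sumrB; congr (_ + _); rewrite -sumrN.
under [RHS]eq_bigr do rewrite -sumrN.
under [RHS]eq_bigr do under eq_bigr do rewrite mulr_sumr -sumrN.
rewrite [RHS]exchange_big /=.
under [RHS]eq_bigr do rewrite exchange_big /=.
rewrite [RHS]exchange_big /=.
apply: eq_bigr => k _; rewrite mulNr mulr_suml -sumrN; apply: eq_bigr => i _.
by rewrite mulr_suml -sumrN; apply: eq_bigr => j _; ring.
Qed.

End Geodesics.

(** * Existence of geodesics and the Hessian of a strongly convex function *)

Section GeodesicExistence.
Variables (R : realType) (n : nat) (M : riemannianManifold R n).
Implicit Types (x y z : M) (c : R -> M) (u v w : 'rV[R]_n) (f : M -> R) (S : set M).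

Lemma norm_lsubmx_le (w : 'rV[R]_(n + n)) : `|lsubmx w| <= `|w|.
Proof. by apply: norm_row_le => // i; rewrite mxE; exact: norm_coord_le. Qed.

Lemma lipschitz_near_lsubmx (g : 'rV[R]_n -> R) (w : 'rV[R]_(n + n)) :
  lipschitz_near g (lsubmx w) -> lipschitz_near (fun w : 'rV[R]_(n + n) => g (lsubmx w)) w.
Proof.
move=> [K [d [K0 d0 gK]]]; exists K, d; split=> // a b aw bw.
have lB (p q : 'rV[R]_(n + n)) : `|lsubmx p - lsubmx q| <= `|p - q|.
  by rewrite -linearB /=; exact: norm_lsubmx_le.
apply: le_trans (gK _ _ _ _) _; try exact: le_lt_trans (lB _ _) _.
by rewrite ler_wpM2l.
Qed.

Lemma lipschitz_near_christoffel y u k i j : (phi y @` dom y) u ->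
  lipschitz_near (fun u => christoffel y u k i j) u.
Proof.
move=> uy; have oU := @cod_open _ _ M y.
have pl a b l : lipschitz_near (fun u => partial a (fun w => gram y w b l) u) u.
  apply: smooth_lipschitz_near oU uy.
  by apply: smooth_partial; exact: (@gram_smooth _ _ M y b l).
apply: lipschitz_nearM; first exact: lipschitz_near_cst.
apply: lipschitz_near_sum => l _; apply: lipschitz_nearM.
  apply: lipschitz_near_invmx => [|a b].
    by apply: filterS (open_nbhs_nbhs (conj oU uy)) => w; exact: gram_unit.
  exact: smooth_lipschitz_near (@gram_smooth _ _ M y a b) oU uy.
apply: lipschitz_nearD; first by apply: lipschitz_nearD.
have -> : (fun u => - partial l (fun w => gram y w i j) u) =
  (fun u => -1 * partial l (fun w => gram y w i j) u).
  by apply/funext => w; rewrite mulN1r.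
by apply: lipschitz_nearM => //; exact: lipschitz_near_cst.
Qed.

(** The geodesic equation as an autonomous first order system for the position
    and the velocity. *)
Definition geodesic_field y (w : 'rV[R]_(n + n)) : 'rV[R]_(n + n) :=
  row_mx (rsubmx w) (\row_k - (\sum_(i < n) \sum_(j < n)
    christoffel y (lsubmx w) k i j * rsubmx w 0 i * rsubmx w 0 j)).

Lemma lipschitz_near_geodesic_field y (w : 'rV[R]_(n + n)) : (phi y @` dom y) (lsubmx w) ->
  lipschitz_near (geodesic_field y) w.
Proof.
move=> wy; apply: lipschitz_near_rV => i.
have rl j : lipschitz_near (fun w : 'rV[R]_(n + n) => rsubmx w 0 j) w.
  by under eq_fun do rewrite mxE; exact: lipschitz_near_coord.
rewrite -[i]splitK; case: (fintype.split i) => [k|k] /=.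
  by under eq_fun do rewrite row_mxEl; exact: rl.
under eq_fun do rewrite row_mxEr mxE -mulN1r.
apply: lipschitz_nearM; first exact: lipschitz_near_cst.
apply: lipschitz_near_sum => a _; apply: lipschitz_near_sum => b _.
apply: lipschitz_nearM => //; apply: lipschitz_nearM => //.
apply: (@lipschitz_near_lsubmx (fun u => christoffel y u k a b)).
exact: lipschitz_near_christoffel.
Qed.

Lemma is_derive_lsubmx (u : R -> 'rV[R]_(n + n)) (t : R) du :
  is_derive t 1 u du -> is_derive t 1 (fun s => lsubmx (u s)) (lsubmx du).
Proof.
move=> [d <-]; have dl : derivable (fun s => lsubmx (u s)) t 1.
  apply/derivable_mxP => i j; under eq_fun do rewrite mxE.
  by move/derivable_mxP: d; apply.
apply: (DeriveDef dl); rewrite (derive_mx dl) (derive_mx d).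
by apply/matrixP => i j; rewrite !mxE; under eq_fun do rewrite mxE.
Qed.

Lemma is_derive_rsubmx (u : R -> 'rV[R]_(n + n)) (t : R) du :
  is_derive t 1 u du -> is_derive t 1 (fun s => rsubmx (u s)) (rsubmx du).
Proof.
move=> [d <-]; have dl : derivable (fun s => rsubmx (u s)) t 1.
  apply/derivable_mxP => i j; under eq_fun do rewrite mxE.
  by move/derivable_mxP: d; apply.
apply: (DeriveDef dl); rewrite (derive_mx dl) (derive_mx d).
by apply/matrixP => i j; rewrite !mxE; under eq_fun do rewrite mxE.
Qed.

(** Slowing down the parametrization by a factor [l] makes a solution that is
    defined near [0] a geodesic on a neighbourhood of the unit interval. *)
Lemma geodesic_exists x v S : (\forall z \near x, S z) ->
  exists c l, [/\ 0 < l, geodesic c, forall t, t \in `[0, 1] -> S (c t), c 0 = x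
    & derive1 (phi x \o c) 0 = l *: v /\
      \forall s \near (0 : R), [/\ dom x (c s), derivable (phi x \o c) s 1,
        derivable (derive1 (phi x \o c)) s 1 & acceleration x c s = 0]].
Proof.
move=> xS; set u0 := phi x x.
have ux : (phi x @` dom x) u0 by exact: cod_center.
have := @lipschitz_near_geodesic_field x (row_mx u0 v).
rewrite row_mxKl => /(_ ux)/picard[w [d [d0 w0 wd]]].
pose q t := lsubmx (w t); pose p t := rsubmx (w t).
have dq (t : R) : `|t| < d -> is_derive t 1 q (p t).
  by move=> /wd/is_derive_lsubmx; rewrite row_mxKl.
have dp (t : R) : `|t| < d -> is_derive t 1 p (\row_k - (\sum_(i < n) \sum_(j < n)
    christoffel x (q t) k i j * p t 0 i * p t 0 j)).
  by move=> /wd/is_derive_rsubmx; rewrite row_mxKr.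
have q0 : q 0 = u0 by rewrite /q w0 row_mxKl.
have p0 : p 0 = v by rewrite /p w0 row_mxKr.
have cq : {for 0, continuous q}.
  have d00 : `|0 : R| < d by rewrite normr0.
  by apply: differentiable_continuous; case: (dq 0 d00) => /derivable1_diffP.
have nU : \forall u \near q 0, (phi x @` dom x) u /\ S (psi x u).
  rewrite q0; apply: filterI.
    by apply: open_nbhs_nbhs; split=> //; exact: cod_open.
  have cpsi := @psi_continuous _ _ M x u0 ux.
  by apply: cpsi; rewrite phiK //; exact: dom_center.
have /nbhs_ballP[e /= e0 He] := cq _ nU.
pose l := Num.min d e / 3.
have m0 : 0 < Num.min d e by rewrite lt_min d0 e0.
have l0 : 0 < l by rewrite divr_gt0.
have lm (t : R) : `|t| < 2 -> `|l * t + 0| < d /\ `|l * t + 0| < e.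
  move=> t2; apply/andP; rewrite -lt_min addr0 normrM gtr0_norm //.
  have : l * `|t| <= l * 2 by rewrite ler_wpM2l // ltW.
  by move=> /le_lt_trans; apply; rewrite /l; move: m0; lra.
have inU (t : R) : `|t| < 2 -> (phi x @` dom x) (q (l * t + 0)) /\ S (psi x (q (l * t + 0))).
  move=> /lm[_ te]; apply: He; rewrite -ball_normE /=.
  by rewrite sub0r normrN.
pose c t := psi x (q (l * t + 0)).
have phic (t : R) : `|t| < 2 -> dom x (c t) /\ phi x (c t) = q (l * t + 0).
  by move=> /inU[[z dz zq] _]; rewrite /c -zq phiK.
have near2 (t : R) : `|t| < 2 -> \forall s \near t, `|s| < 2.
  move=> t2; apply/nbhs_ballP; exists (2 - `|t|); first by rewrite /= subr_gt0.
  move=> s; rewrite -ball_normE /= => ts.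
  have := ler_normD (s - t) t; rewrite subrK distrC.
  by move: ts; lra.
have d1 (t : R) : `|t| < 2 -> is_derive t 1 (phi x \o c) (l *: p (l * t + 0)).
  move=> t2; have [td _] := lm t t2.
  apply: (near_eq_is_derive _ (is_derive_affine (dq _ td))).
  by apply: filterS (near2 t t2) => s /phic[_ <-].
have d1E (t : R) : `|t| < 2 -> derive1 (phi x \o c) t = l *: p (l * t + 0).
  by move=> /d1[_ <-]; rewrite derive1E.
have d2 (t : R) : `|t| < 2 -> is_derive t 1 (derive1 (phi x \o c))
    (l *: (l *: (\row_k - (\sum_(i < n) \sum_(j < n)
    christoffel x (q (l * t + 0)) k i j * p (l * t + 0) 0 i * p (l * t + 0) 0 j)))).
  move=> t2; have [td _] := lm t t2.
  have dpl := is_derive_affine (dp _ td).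
  have dZ := @is_deriveZ _ _ _ _ l _ _ _ dpl.
  apply: (near_eq_is_derive _ dZ).
  by apply: filterS (near2 t t2) => s /d1E ->.
have reg (t : R) : `|t| < 2 -> [/\ dom x (c t), derivable (phi x \o c) t 1,
    derivable (derive1 (phi x \o c)) t 1 & acceleration x c t = 0].
  move=> t2; split; first by case: (phic t t2).
  - by case: (d1 t t2).
  - by case: (d2 t t2).
  have E2 := derive1E (derive1 (phi x \o c)) t.
  rewrite (derive_val (is_derive := d2 t t2)) in E2.
  apply/rowP => k; rewrite !mxE E2; have [_ /= ->] := phic t t2.
  rewrite (d1E t t2) !mxE.
  rewrite !mulrN addrC; apply/eqP; rewrite subr_eq0; apply/eqP.
  rewrite !mulr_sumr; apply: eq_bigr => i _; rewrite !mulr_sumr; apply: eq_bigr => j _.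
  by rewrite !mxE; ring.
have u2 (t : R) : t \in `[0, 1] -> `|t| < 2.
  by rewrite in_itv /= => /andP[t0 t1]; rewrite ger0_norm //; lra.
exists c, l; split=> //.
- by move=> t /u2 t2; exists x; apply: filterS (near2 t t2).
- by move=> t /u2/inU[].
- by rewrite /c mulr0 add0r q0 phiK //; exact: dom_center.
- split.
    by rewrite d1E ?normr0 // mulr0 add0r p0.
  by apply: filterS (near2 0 _); rewrite ?normr0.
Qed.

(** Along a geodesic leaving [x] with velocity [a], the second derivative of [f]
    is [Hess f (a, a)], and the modulus of strong convexity is [gamma |a|^2]
    because the speed is constant. *)
Lemma hess_strongly_convex f gamma S x v : C2_fun f -> (\forall z \near x, S z) ->
  geodesically_strongly_convex gamma f S ->
  gamma * tnorm x v ^+ 2 <= inner x v (v *m hess f x).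
Proof.
move=> Cf xS [_ scS].
have [->|v0] := eqVneq v 0.
  by rewrite tnorm0 expr0n mulr0 mul0mx inner0l.
have [c [l [l0 gc cS c0 [a0 reg]]]] := geodesic_exists v xS.
have L : curve_length c = l * tnorm x v.
  by rewrite (geodesic_length gc) /velocity c0 a0 tnormZ gtr0_norm.
have L0 : 0 < curve_length c by rewrite L mulr_gt0 // tnorm_gt0.
have sc := scS c gc cS L0.
have dc : \forall s \near (0 : R), dom x (c s) by apply: filterS reg => s [].
have dq : \forall s \near (0 : R), derivable (phi x \o c) s 1.
  by apply: filterS reg => s [].
have [_ _ ddq acc] := nbhs_singleton reg.
have [dd ddE] := second_derivative_along Cf c0 dc dq ddq acc.
have df : \forall t \near (0 : R), derivable (f \o c) t 1.
  apply: filterS (near_join reg) => t nt.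
  have dct : \forall s \near t, dom x (c s) by apply: filterS nt => s [].
  have [_ dqt _ _] := nbhs_singleton nt.
  by case: (is_derive_along Cf dct dqt).
have := strongly_convex_derive2 sc df dd.
rewrite derive1E ddE a0 -scalemxAl innerZl innerZr L exprMn.
have l2 : 0 < l ^+ 2 by rewrite exprn_gt0.
move=> H; rewrite -(ler_pM2l l2) mulrCA; apply: le_trans H _.
by rewrite mulrA -expr2.
Qed.

End GeodesicExistence.

(** * Balls around a minimizer *)

Section StronglyConvexBall.
Variables (R : realType) (n : nat) (M : riemannianManifold R n) (f : M -> R).
Variables (gamma delta : R) (xs : M).
Hypotheses (Cf : C2_fun f) (gamma0 : 0 < gamma) (delta0 : 0 < delta).
Hypothesis xs_min : local_minimizer f xs.
Let S : set M := [set y | (dist xs y < (2 * delta)%:E)%E].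
Hypothesis scS : geodesically_strongly_convex gamma f S.

Lemma ball_center : S xs.
Proof.
rewrite /S /=; apply: le_lt_trans (dist_refl_le xs (lexx 0)) _.
by rewrite lte_fin mulr_gt0.
Qed.

Lemma ball_open y : S y -> \forall z \near y, S z.
Proof.
rewrite /S /= => /dist_ltP[l jl ld].
have e0 : 0 < 2 * delta - l by rewrite subr_gt0.
have := dist_near y e0; apply: filterS => z /dist_ltP[k jk kd].
apply: le_lt_trans (dist_le_joined (joined_trans jl jk)) _.
by rewrite lte_fin -ltrBrDl.
Qed.

Lemma geodesic_continuous (c : R -> M) t : geodesic c -> t \in `[0, 1] ->
  {for t, continuous c}.
Proof.
move=> gc /gc[y ny]; have [_ dq _ _] := nbhs_singleton ny.
by apply: (curve_continuous _ dq); apply: filterS ny => s [].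
Qed.

(** Dividing the strong convexity inequality between the minimizer and a nearby
    point of the geodesic by the parameter gives quadratic growth in the length
    of the geodesic, hence in the distance. *)
Lemma dist_le_growth y r : S y -> 0 <= r -> f y <= f xs + gamma / 2 * r ^+ 2 ->
  (dist xs y <= r%:E)%E.
Proof.
move=> Sy r0 fy; have [c [gc c0 c1 cS]] := scS.1 _ _ ball_center Sy.
have := dist_le_curve (geodesic_C1 gc); rewrite c0 c1 => dL.
apply: le_trans dL _; rewrite lee_fin.
have := curve_length_ge0 c; rewrite le_eqVlt => /predU1P[<-//|L0].
have sc := scS.2 c gc cS L0; set L := curve_length c in L0 sc *.
have z01 : (0 : R) \in `[0, 1] by rewrite in_itv /= lexx ler01.
have o01 : (1 : R) \in `[0, 1] by rewrite in_itv /= lexx ler01.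
have cc := geodesic_continuous gc z01.
have nmin : \forall l \near (0 : R), f xs <= f (c l).
  have nm : nbhs (c 0) [set z | f xs <= f z] by rewrite c0; exact: xs_min.
  exact: (cc _ nm).
have lim : gamma * L ^+ 2 / 2 * (1 - l) @[l --> (0 : R)^'+] -->
    gamma * L ^+ 2 / 2 * (1 - 0).
  apply: cvg_at_right_filter; apply: cvgM; first exact: cvg_cst.
  by apply: cvgB; [exact: cvg_cst | exact: cvg_id].
have grow : gamma * L ^+ 2 / 2 * (1 - 0) <= f y - f xs.
  apply: cvgr_to_le lim _; near=> l.
  have l0 : 0 < l by near: l; exact: nbhs_right_gt.
  have l1 : l < 1 by near: l; exact: nbhs_right_lt.
  have l01 : l \in `[0, 1] by rewrite in_itv /= !ltW.
  have fl : f xs <= f (c l) by near: l; exact: cvg_at_right_filter nmin.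
  have := sc 0 1 l z01 o01 l01.
  rewrite /= mulr0 add0r mulr1 c0 c1 sub0r sqrrN expr1n mulr1 => h.
  rewrite -(ler_pM2l l0).
  move: (gamma * L ^+ 2) (f (c l)) (f xs) (f y) fl h => m a b d fl h.
  by nra.
rewrite subr0 mulr1 in grow.
have : gamma / 2 * L ^+ 2 <= gamma / 2 * r ^+ 2.
  by move: grow fy; rewrite mulrAC; move: (f y) (f xs) => a b; lra.
by rewrite ler_pM2l ?divr_gt0 // ler_sqr ?nnegrE // ltW.
Unshelve. all: by end_near. Qed.

(** The geodesic to the minimizer, of length [l], gives
    [f y - f xs <= l |grad f y| - gamma l^2 / 2], which is largest when
    [l = |grad f y| / gamma]. *)
Lemma gradient_dominance y : S y ->
  2 * gamma * (f y - f xs) <= tnorm y (grad f y) ^+ 2.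
Proof.
move=> Sy; have [c [gc c0 c1 cS]] := scS.1 _ _ Sy ball_center.
have along t : t \in `[0, 1] ->
    is_derive (t : R) 1 (f \o c) (inner (c t) (velocity c t) (grad f (c t))).
  move=> /gc[z nz]; have [_ dq _ _] := nbhs_singleton nz.
  have dc : \forall s \near t, dom z (c s) by apply: filterS nz => s [].
  exact: (is_derive_along Cf dc dq).
have z01 : (0 : R) \in `[0, 1] by rewrite in_itv /= lexx ler01.
have o01 : (1 : R) \in `[0, 1] by rewrite in_itv /= lexx ler01.
have L := geodesic_length gc.
have := curve_length_ge0 c; rewrite le_eqVlt => /predU1P[L0|L0].
  have := @norm_increment_le _ (f \o c)
    (fun t => inner (c t) (velocity c t) (grad f (c t))) 0 0 1.
  rewrite /= c0 c1 mul0r normr_le0 subr_eq0 => H.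
  have /eqP -> : f xs == f y.
    apply: H => r; rewrite (min_idPl _) // (max_idPr _) // => r01; first exact: along.
    have v0 : velocity c r = 0.
      by apply: (@tnorm_eq0 _ _ _ (c r)); rewrite geodesic_speed // -L -L0.
    by rewrite v0 inner0l normr0.
  by rewrite subrr mulr0 exprn_ge0 // tnorm_ge0.
have sc := scS.2 c gc cS L0.
have [dh dhE] := along 0 z01.
have := strongly_convex_gradient sc z01 o01 dh.
rewrite /= derive1E dhE subr0 expr1n !mulr1 c1.
have := inner_ge_cauchy (c 0) (velocity c 0) (grad f (c 0)).
rewrite -L c0; set g := tnorm y _; set l := curve_length c; set i := inner _ _ _.
have g0 : 0 <= g by exact: tnorm_ge0.
move: (f y) (f xs) i => a b i h1 h2.
have : 2 * gamma * (a - b) <= 2 * gamma * (l * g - gamma * l ^+ 2 / 2).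
  by rewrite ler_pM2l ?mulr_gt0 //; lra.
move=> /le_trans; apply.
rewrite -subr_ge0 (_ : _ - _ = (g - gamma * l) ^+ 2); first exact: sqr_ge0.
by field.
Qed.

(** A path that leaves the ball would have to cross points that are in the ball
    but, by quadratic growth, only at distance [r] from the centre. *)
Lemma path_stays (p : R -> M) r : 0 <= r -> r < 2 * delta ->
  (forall t, t \in `[0, 1] -> {for t, continuous p}) -> S (p 0) ->
  (forall t, t \in `[0, 1] -> f (p t) <= f xs + gamma / 2 * r ^+ 2) ->
  forall t, t \in `[0, 1] -> (dist xs (p t) <= r%:E)%E.
Proof.
move=> r0 rd cp Sp0 fp t t01; apply: dist_le_growth => //; last exact: fp.
move: t t01; apply: (@segment_induction _ (fun t => S (p t))) => // t t01.
have e0 : 0 < (2 * delta - r) / 3 by rewrite divr_gt0 // subr_gt0.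
have /nbhs_ballP[d /= d0 Hd] := cp _ t01 _ (dist_near (p t) e0).
exists d; first exact: d0.
move=> a b a01 b01 at_ bt Sa.
have Da : (dist xs (p a) < (r + (2 * delta - r) / 3)%:E)%E.
  apply: le_lt_trans (dist_le_growth Sa r0 (fp _ a01)) _.
  by rewrite lte_fin ltrDl.
have Dat : (dist (p a) (p t) < ((2 * delta - r) / 3)%:E)%E.
  by rewrite dist_sym; apply: Hd; rewrite -ball_normE /= distrC.
have Dbt : (dist (p t) (p b) < ((2 * delta - r) / 3)%:E)%E.
  by apply: Hd; rewrite -ball_normE /= distrC.
have := dist_lt_trans (dist_lt_trans Da Dat) Dbt.
by rewrite /S /=; congr (_ < _%:E)%E; field.
Qed.

End StronglyConvexBall.

Section RegionThree.
Variables (R : realType) (n : nat) (M : riemannianManifold R n) (f : M -> R).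
Variables (gamma delta : R).
Hypotheses (Cf : C2_fun f) (gamma0 : 0 < gamma) (delta0 : 0 < delta).

Lemma region3_in_ball (x xs : M) : (dist x xs <= delta%:E)%E ->
  (dist xs x < (2 * delta)%:E)%E.
Proof. by rewrite dist_sym => /le_lt_trans; apply; rewrite lte_fin; move: delta0; lra. Qed.

Lemma region3_hess x v : region3 f gamma delta x ->
  gamma * tnorm x v ^+ 2 <= inner x v (v *m hess f x).
Proof.
move=> [xs [xmin xd sc]]; apply: hess_strongly_convex sc => //.
by apply: ball_open => //; exact: region3_in_ball.
Qed.

(** With [r = |grad f x| / gamma], gradient dominance at [x] gives
    [f x <= f xs + gamma / 2 * r^2], the bound under which paths stay within [r] of
    the minimizer. *)
Lemma region3_path x (p : R -> M) : region3 f gamma delta x -> p 0 = x ->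
  tnorm x (grad f x) <= gamma * delta ->
  (forall t, t \in `[0, 1] -> {for t, continuous p}) ->
  (forall t, t \in `[0, 1] -> f (p t) <= f x) ->
  region3 f gamma delta (p 1).
Proof.
move=> [xs [xmin xd sc]] p0 gd cp fp; exists xs; split=> //.
set r := tnorm x (grad f x) / gamma.
have r0 : 0 <= r by rewrite divr_ge0 // ?tnorm_ge0 // ltW.
have rd : r <= delta by rewrite ler_pdivrMr // mulrC.
have o01 : (1 : R) \in `[0, 1] by rewrite in_itv /= lexx ler01.
have Sx := region3_in_ball xd.
rewrite dist_sym; apply: (@le_trans _ _ r%:E); last by rewrite lee_fin.
apply: (path_stays gamma0 delta0 xmin sc r0 _ cp _ _ o01).
- by move: rd delta0; lra.
- by rewrite p0.
- move=> t t01; apply: le_trans (fp _ t01) _.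
  have := gradient_dominance Cf gamma0 delta0 sc Sx.
  have -> : tnorm x (grad f x) = gamma * r by rewrite /r mulrC divfK // gt_eqF.
  move=> H; have g2 : 0 < 2 * gamma by rewrite mulr_gt0.
  rewrite -lerBlDl -(ler_pM2l g2); apply: le_trans H _.
  by rewrite le_eqVlt; apply/orP; left; apply/eqP; field.
Qed.

End RegionThree.

(** * Retractions and pullbacks *)

Section RetractionCharts.
Variables (R : realType) (n : nat) (M : riemannianManifold R n).
Variables (Rt : M -> 'rV[R]_n -> M) (radius : M -> \bar R).
Hypothesis Rt_retr : retraction Rt radius.
Implicit Types (x y z : M) (v w : 'rV[R]_n) (f : M -> R).

Lemma twice_differentiable_near_eq m (V : normedModType R) (F G : 'rV[R]_m -> V) u :
  {near u, F =1 G} -> twice_differentiable_at F u -> twice_differentiable_at G u.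
Proof.
move=> FG [dF dpF]; split.
  apply: filterS2 (near_join FG) dF => w nw; exact: near_eq_differentiable.
move=> i; apply: near_eq_differentiable (dpF i).
by apply: filterS (near_join FG) => w nw; exact: near_eq_derive.
Qed.

(** The change of coordinates from the chart [phi x] to itself is trivial. *)
Lemma retr_bundle_center x v : retr_bundle Rt x (row_mx (phi x x) v) = Rt x v.
Proof.
have dx := dom_center x.
rewrite /retr_bundle row_mxKl row_mxKr phiK //; congr (Rt x _).
have E : {near phi x x, id =1 phi x \o psi x}.
  have := @cod_open _ _ M x => oU.
  apply: filterS (open_nbhs_nbhs (conj oU (cod_center x))) => u [p dp <-] /=.
  by rewrite phiK.
have dT : differentiable (phi x \o psi x) (phi x x).
  by apply: (near_eq_differentiable E); exact: ex_diff.
rewrite -(deriveEjacobian _ dT).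
by rewrite -(near_eq_derive _ E) derive_id.
Qed.

Lemma differentiable_row_mx (u v : 'rV[R]_n) :
  differentiable (fun w => row_mx u w : 'rV[R]_(n + n)) v.
Proof.
have -> : (fun w => row_mx u w : 'rV[R]_(n + n)) =
    \sum_i (fun w : 'rV[R]_n => w 0 i *: (delta_mx 0 (rshift n i) : 'rV[R]_(n + n)))
    + cst (row_mx u 0).
  apply/funext => w; rewrite !fctE fct_sumE; apply/rowP => j.
  rewrite [RHS]mxE summxE; case: (split_ordP j) => k ->.
    rewrite !row_mxEl big1 ?add0r // => i _.
    by rewrite !mxE eqxx eq_lrshift mulr0.
  rewrite !row_mxEr mxE addr0 (bigD1 k) //= big1 ?addr0 => [|i ik].
    by rewrite !mxE !eqxx mulr1.
  by rewrite !mxE eqxx (inj_eq (@rshift_inj _ _)) eq_sym (negbTE ik) mulr0.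
apply: differentiableD => //; apply: differentiable_sum => i.
by apply: differentiableZl; exact: differentiable_coord.
Qed.

Lemma derive_row_mx (u v w : 'rV[R]_n) :
  'D_w (fun w => row_mx u w : 'rV[R]_(n + n)) v = row_mx 0 w.
Proof.
have dl := @diff_derivable _ _ _ _ v w (differentiable_row_mx u v).
rewrite (derive_mx dl); apply/matrixP => i j; rewrite mxE (ord1 i).
case: (split_ordP j) => k ->.
  under eq_fun do rewrite row_mxEl.
  by rewrite row_mxEl mxE derive_cst.
under eq_fun do rewrite row_mxEr.
rewrite row_mxEr; have := derive_mx (@derivable_id R 'rV[R]_n v w).
by rewrite derive_id => /matrixP/(_ 0 k); rewrite mxE.
Qed.

(** The retraction at [x] is the smooth bundle map restricted to the fibre of
    [x]. *)
Lemma retraction_chart x v : in_ball radius x v ->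
  {for v, continuous (Rt x)} /\
  twice_differentiable_at (phi (Rt x v) \o Rt x) v.
Proof.
case: Rt_retr => _ _ _ H /H[W [oW Wv Wd sW]] {H}.
set z := Rt x v; pose j (w : 'rV[R]_n) : 'rV[R]_(n + n) := row_mx (phi x x) w.
set G := phi z \o retr_bundle Rt x in sW.
have dj w : differentiable j w by exact: differentiable_row_mx.
have cj w : {for w, continuous j} by exact: differentiable_continuous.
have nW : \forall w \near v, W (j w) by apply: cj; exact: open_nbhs_nbhs.
have RE w : Rt x w = retr_bundle Rt x (j w) by rewrite retr_bundle_center.
have GE : G \o j = phi z \o Rt x by apply/funext => w; rewrite [RHS]/= RE.
have dG w : W (j w) -> differentiable G (j w) by exact: smooth_differentiable.
have tG : twice_differentiable_at (G \o j) v.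
  split; first by apply: filterS nW => w /dG dGw; exact: differentiable_comp.
  move=> i; have dP : differentiable (partial (rshift n i) G \o j) v.
    apply: differentiable_comp => //.
    by apply: smooth_differentiable (smooth_partial _ sW) _.
  apply: near_eq_differentiable dP; apply: filterS nW => w Ww.
  have [_] := is_derive_comp_rV (delta_mx 0 i) (dG _ Ww) (dj w).
  rewrite -(derive_partials _ (dG _ Ww)) derive_row_mx /partial => ->.
  congr ('D_ _ G _); apply/rowP => k.
  case: (split_ordP k) => l ->; rewrite ?row_mxEl ?row_mxEr !mxE !eqxx /=.
    by rewrite eq_lrshift.
  by rewrite (inj_eq (@rshift_inj _ _)).
split; last by rewrite -GE.
have cG : {for v, continuous (psi z \o (G \o j))}.
  apply: continuous_comp.
    exact: differentiable_continuous (nbhs_singleton tG.1).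
  have -> : (G \o j) v = phi z z by rewrite GE.
  exact: (@psi_continuous _ _ M z _ (cod_center z)).
have E : {near v, psi z \o (G \o j) =1 Rt x}.
  by apply: filterS nW => w /Wd[_ dw]; rewrite /= -/z /G /= phiK // -RE.
move: cG; rewrite /prop_for /continuous_at (nbhs_singleton E) => cG.
exact: cvg_trans (near_eq_cvg E) cG.
Qed.

Lemma in_ball0 x : in_ball radius x 0.
Proof. by case: Rt_retr => r0 _ _ _; rewrite /in_ball tnorm0; apply/ltW. Qed.

(** For the Hessians, the second derivative of [f] along [t |-> Rt x (t v)] is
    computed twice: as that of the pullback along a line, and as that of [f] along a
    curve with zero acceleration at [0]. *)
Lemma pullback_expansion f x : C2_fun f ->
  [/\ twice_differentiable_at (pullback Rt f x) 0,
      pgrad Rt f x 0 = grad f x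
    & second_order Rt -> forall v,
      inner x v (v *m phess0 Rt f x) = inner x v (v *m hess f x)].
Proof.
move=> Cf; have [_ R0 DR _] := Rt_retr.
have [cR tr] := retraction_chart (in_ball0 x); rewrite R0 in tr.
set r := phi x \o Rt x in tr.
have DRr v : 'D_v r 0 = v := DR x v.
have r0 : r 0 = phi x x by rewrite /r /= R0.
have dx : \forall w \near (0 : 'rV[R]_n), dom x (Rt x w).
  apply: cR; rewrite R0; apply: open_nbhs_nbhs; split; [exact: dom_open|exact: dom_center].
have tF : twice_differentiable_at (f \o psi x) (r 0).
  by rewrite r0; exact: (C2_twice_differentiable (Cf x) (@cod_open _ _ M x) (cod_center x)).
have FE : {near (0 : 'rV[R]_n), (f \o psi x) \o r =1 pullback Rt f x}.
  by apply: filterS dx => w dw; rewrite /= /pullback /= phiK.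
have tP : twice_differentiable_at (pullback Rt f x) 0.
  exact: twice_differentiable_near_eq FE (twice_differentiable_comp tF tr).
have dr := nbhs_singleton tr.1; have dF := nbhs_singleton tF.1.
split=> //.
  rewrite /pgrad /egrad /grad; congr (_ *m _); apply/rowP => i; rewrite !mxE.
  rewrite /partial -(near_eq_derive _ FE).
  have [_ ->] := is_derive_comp_rV (delta_mx 0 i) dF dr.
  by rewrite -(derive_partials _ dF) DRr r0.
move=> so v; pose q (s : R) := s *: v + (0 : 'rV[R]_n); pose c s := Rt x (q s).
have dq (s : R) : is_derive s 1 q v by exact: is_derive_line.
have q0 : q 0 = 0 by rewrite /q scale0r add0r.
have derq (s : R) : derivable q s 1 by case: (dq s).
have cq : {for 0, continuous q}.
  by apply: differentiable_continuous; apply/derivable1_diffP.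
have D1q s : derive1 q s = v by rewrite derive1E; case: (dq s).
have c0 : c 0 = x by rewrite /c q0 R0.
have nq (P : 'rV[R]_n -> Prop) : (\forall w \near (0 : 'rV[R]_n), P w) ->
    \forall s \near (0 : R), P (q s).
  by rewrite -q0 => nP; exact: (cq P nP).
have dc : \forall s \near (0 : R), dom x (c s) by exact: nq dx.
have ndr : \forall s \near (0 : R), differentiable r (q s).
  exact: nq tr.1.
have drc : \forall s \near (0 : R), derivable (phi x \o c) s 1.
  apply: filterS ndr => s ds.
  by case: (is_derive_comp_curve ds (derq s)).
have d1E : {near (0 : R), (fun s => \sum_i v 0 i *: partial i r (q s)) =1
    derive1 (phi x \o c)}.
  apply: filterS ndr => s ds; rewrite derive1E.
  by have [_ ->] := is_derive_comp_curve ds (derq s); rewrite D1q.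
have ddc : derivable (derive1 (phi x \o c)) (0 : R) 1.
  apply: near_eq_derivable d1E _.
  have -> : (fun s => \sum_i v 0 i *: partial i r (q s)) =
    \sum_i (v 0 i \*: (partial i r \o q)).
    by apply/funext => s; rewrite fct_sumE.
  apply: derivable_sum => i; apply: derivableZ.
  have dpr : differentiable (partial i r) (q 0) by rewrite q0; exact: tr.2.
  by case: (is_derive_comp_curve dpr (derq 0)).
have acc : acceleration x c 0 = 0.
  have -> : c = (fun t : R => Rt x (t *: v)).
    by apply/funext => s; rewrite /c /q addr0.
  exact: so.
have a0 : derive1 (phi x \o c) 0 = v.
  by rewrite -(nbhs_singleton d1E) q0 -(derive_partials _ dr).
have [_] := second_derivative_along Cf c0 dc drc ddc acc.
rewrite /= a0 => <-.
have tPq : twice_differentiable_at (pullback Rt f x) (q 0) by rewrite q0.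
have ndq : \forall s \near (0 : R), derivable q s 1.
  by apply: filterS drc => s _; exact: derq.
have D1qE : derive1 q = cst v by apply/funext => s; rewrite D1q.
have ddq : derivable (derive1 q) (0 : R) 1 by rewrite D1qE; exact: derivable_cst.
have [_ E] := is_derive2_comp_curve tPq ndq ddq.
rewrite -[RHS]/('D_1 (derive1 (pullback Rt f x \o q)) 0) E.
have -> : derive1 (derive1 q) 0 = 0 by rewrite D1qE derive1_cst.
rewrite [X in _ + X]big1 ?addr0 => [|j _]; last by rewrite mxE mul0r.
rewrite q0 D1q /phess0 /ehess mulmxA inner_mul_invmx trmx_mul mulmxA.
rewrite quad_sum exchange_big /=.
by apply: eq_bigr => j _; apply: eq_bigr => i _; rewrite !mxE; ring.
Qed.

(** The pullback is twice differentiable at the origin, so that its second partial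
    derivatives there commute. *)
Lemma phess0_sym f x v w : C2_fun f ->
  inner x w (v *m phess0 Rt f x) = inner x v (w *m phess0 Rt f x).
Proof.
move=> /(pullback_expansion x)[tP _ _].
rewrite /phess0 /ehess !mulmxA !inner_mul_invmx.
set P := \matrix_(i, j) _.
have Ps : P^T = P by apply/matrixP => i j; rewrite !mxE; exact: young.
rewrite -[in LHS](trmxK (w *m (v *m P)^T)) mxE.
by rewrite trmx_mul trmxK [in RHS]trmx_mul Ps mulmxA.
Qed.

End RetractionCharts.

(** * The trust-region subproblem *)

Section TrustRegionStep.
Variables (R : realType) (n : nat) (M : riemannianManifold R n).
Variables (Rt : M -> 'rV[R]_n -> M) (f : M -> R) (x : M) (s : 'rV[R]_n) (D : R).
Hypothesis (D0 : 0 < D) (s_sol : subproblem_solution Rt f x D s).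
Let g := grad f x.
Let H := phess0 Rt f x.
Implicit Types v w : 'rV[R]_n.

Definition model_decrease : R := model Rt f x 0 - model Rt f x s.

Lemma model_drop w : model Rt f x 0 - model Rt f x w =
  - inner x w g - 2^-1 * inner x w (w *m H).
Proof. by rewrite /model mul0mx !inner0l !mulr0 !addr0 -/g -/H; ring. Qed.

Lemma model_decrease_ge w : tnorm x w <= D ->
  - inner x w g - 2^-1 * inner x w (w *m H) <= model_decrease.
Proof. by move=> wD; rewrite -model_drop lerD2l lerN2; exact: s_sol.2. Qed.

Lemma step_le : tnorm x s <= D. Proof. exact: s_sol.1. Qed.

(** A step of length [min D (alpha / kappa)] along the negative gradient: up to this
    length the quadratic term loses at most half of the gain of the linear one. *)
Lemma cauchy_decrease alpha kappa : 0 < alpha -> alpha <= tnorm x g ->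
  0 < kappa -> opnorm x H <= kappa ->
  alpha / 2 * Num.min D (alpha / kappa) <= model_decrease.
Proof.
move=> a0 ag k0 Hk; set t := Num.min _ _.
have g0 : 0 < tnorm x g by exact: lt_le_trans ag.
have t0 : 0 < t by rewrite lt_min D0 divr_gt0.
have [u u1 ug] : exists2 u, tnorm x u = 1 & inner x u g = tnorm x g.
  exists ((tnorm x g)^-1 *: g).
    by rewrite tnormZ gtr0_norm ?invr_gt0 // mulVf // gt_eqF.
  by rewrite innerZl -tnorm_sqr expr2 mulKf // gt_eqF.
have wD : tnorm x (- t *: u) <= D.
  by rewrite tnormZ u1 mulr1 normrN gtr0_norm // ge_min lexx.
apply: le_trans (model_decrease_ge wD).
rewrite -scalemxAl !innerZl innerZr ug.
have uH := opnorm_bound u Hk; rewrite u1 expr1n mulr1 in uH.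
have tk : t * kappa <= alpha by rewrite -ler_pdivlMr // ge_min lexx orbT.
have : t * alpha <= t * tnorm x g by rewrite ler_pM2l.
have : t ^+ 2 * inner x u (u *m H) <= t ^+ 2 * kappa by rewrite ler_pM2l ?exprn_gt0.
have : t * (t * kappa) <= t * alpha by rewrite ler_pM2l.
clearbody t; rewrite expr2 !mulNr mulrN !opprK -!mulrA.
move: (t * (t * inner x u (u *m H))) (t * tnorm x g) => i b h1 h2 h3; lra.
Qed.

(** Decrease along an almost minimal eigenvector, oriented so as not to increase
    the linear part of the model. *)
Lemma eigen_decrease beta : 0 < beta -> lambda_min (hess f x) <= - beta ->
  (forall v, inner x v (v *m H) = inner x v (v *m hess f x)) ->
  beta / 2 * D ^+ 2 <= model_decrease.
Proof.
move=> b0 lb HE; have D2 : 0 < D ^+ 2 by rewrite exprn_gt0.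
rewrite -ler_pdivlMr //; apply/ler_addgt0Pr => e e0.
have [v v1 vH] := lambda_min_le_direction x lb b0 e0.
rewrite -HE in vH.
have [w wD [wg wH]] : exists2 w, tnorm x w <= D &
    inner x w g <= 0 /\ inner x w (w *m H) = D ^+ 2 * inner x v (v *m H).
  have [vg|/ltW vg] := leP (inner x v g) 0.
    exists (D *: v); first by rewrite tnormZ v1 mulr1 gtr0_norm.
    rewrite -scalemxAl !innerZl innerZr mulrA -expr2; split=> //.
    by rewrite pmulr_rle0.
  exists (- D *: v); first by rewrite tnormZ v1 mulr1 normrN gtr0_norm.
  rewrite -scalemxAl !innerZl innerZr mulrA -expr2 sqrrN; split=> //.
  by rewrite mulNr oppr_le0 pmulr_rge0.
have := model_decrease_ge wD; rewrite wH => H1.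
have H2 : D ^+ 2 * inner x v (v *m H) <= D ^+ 2 * (- beta + e) by rewrite ler_pM2l.
rewrite -lerBlDr ler_pdivlMr //; apply: le_trans H1.
have H3 : 0 <= D ^+ 2 * e by rewrite mulr_ge0 // ltW.
move: H2 H3 wg; move: (inner x w g) (inner x v _) (D ^+ 2) => i j d.
by move=> h1 h2 h3; lra.
Qed.

Section StronglyConvexModel.
Variable gamma : R.
Hypotheses (gamma0 : 0 < gamma)
  (Hgamma : forall v, gamma * tnorm x v ^+ 2 <= inner x v (v *m H)).

(** The model is minimal at [s] on the segment from [0] to [s]. *)
Lemma directional_optimality : inner x s g + inner x s (s *m H) <= 0.
Proof.
set b := inner x s g; set a := inner x s (s *m H); rewrite leNgt; apply/negP => ba.
have a0 : 0 <= a by apply: le_trans (Hgamma s); rewrite mulr_ge0 ?exprn_ge0 ?tnorm_ge0 // ltW.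
pose e := Num.min 1 ((b + a) / (a + 1)).
have a1 : 0 < a + 1 by rewrite ltr_wpDl.
have e0 : 0 < e by rewrite lt_min ltr01 divr_gt0.
have e1 : e <= 1 by rewrite ge_min lexx.
have ea : e * (a + 1) <= b + a by rewrite -ler_pdivlMr // ge_min lexx orbT.
have sD : tnorm x ((1 - e) *: s) <= D.
  rewrite tnormZ ger0_norm ?subr_ge0 //; apply: le_trans step_le.
  by rewrite ler_piMl ?tnorm_ge0 // gerBl ltW.
have := model_decrease_ge sD.
rewrite /model_decrease model_drop -scalemxAl !innerZl innerZr -/a -/b.
have -> : (- ((1 - e) * b) - 2^-1 * ((1 - e) * ((1 - e) * a)) <= - b - 2^-1 * a)
  = (e * (b + a - e * a / 2) <= 0).
  by rewrite -[LHS]subr_le0; congr (_ <= 0); field.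
rewrite pmulr_rle0 //; move: ea ba e0 a0; clearbody a b.
by move=> h1 h2 h3 h4 h5; nra.
Qed.

Lemma strong_decrease : gamma / 2 * tnorm x s ^+ 2 <= model_decrease.
Proof.
have := directional_optimality; have := Hgamma s.
rewrite /model_decrease model_drop.
move: (inner x s g) (inner x s _) (tnorm x s ^+ 2) => b a d; lra.
Qed.

Lemma step_le_gradient : gamma * tnorm x s <= tnorm x g.
Proof.
have [/tnorm_eq0 -> | s0] := eqVneq (tnorm x s) 0.
  by rewrite tnorm0 mulr0 tnorm_ge0.
have sp : 0 < tnorm x s by rewrite lt_def s0 tnorm_ge0.
rewrite -(ler_pM2r sp) -mulrA -expr2.
have := directional_optimality; have := Hgamma s; have := inner_ge_cauchy x s g.
rewrite [tnorm x s * _]mulrC.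
move: (inner x s g) (inner x s _) (_ ^+ 2) (_ * tnorm x s) => b a d e; lra.
Qed.

End StronglyConvexModel.

(** A short step from [s] along minus the residual would stay in the ball and
    decrease the model. *)
Lemma interior_stationary :
  (forall v w, inner x w (v *m H) = inner x v (w *m H)) ->
  tnorm x s < D -> g + s *m H = 0.
Proof.
move=> Hsym sD; have [w wE] : exists w, w = g + s *m H by eexists.
rewrite -wE; apply/eqP/contraT => w0.
have wp := inner_gt0 x w0; set c := inner x w w in wp.
set a := inner x w (w *m H).
have wn := tnorm_gt0 x w0.
pose t := Num.min ((D - tnorm x s) / tnorm x w) (c / (`|a| + 1)).
have t0 : 0 < t by rewrite lt_min !divr_gt0 ?subr_gt0 // ltr_wpDl.
have tD : tnorm x (s - t *: w) <= D.
  apply: le_trans (tnormD _ _ _) _; rewrite tnormN tnormZ gtr0_norm //.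
  by rewrite -lerBrDl -ler_pdivlMr // ge_min lexx.
have ta : t * (`|a| + 1) <= c.
  by rewrite -ler_pdivlMr ?ltr_wpDl // ge_min lexx orbT.
have tc := model_decrease_ge tD.
have E : inner x (s - t *: w) g + 2^-1 * inner x (s - t *: w) ((s - t *: w) *m H) =
  inner x s g + 2^-1 * inner x s (s *m H) - t * (inner x w g + inner x w (s *m H))
  + 2^-1 * t ^+ 2 * a.
  rewrite -scaleNr mulmxDl -scalemxAl !(innerDl, innerDr, innerZl, innerZr).
  by rewrite (Hsym w s) -/a; field.
have cE : inner x w g + inner x w (s *m H) = c by rewrite -innerDr -wE.
move: tc; rewrite /model_decrease model_drop -!opprD E cE lerN2.
have aa := ler_norm a; have nw : 0 <= `|a| by [].
move: ta aa nw wp t0; move: (`|a|) (inner x s g) (inner x s _) => na i j.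
clearbody a c t; move=> h1 h2 h3 h4 h5 h6.
have h7 : 0 <= t * (t * a / 2 - c) by rewrite expr2 in h6; lra.
have h8 : 0 <= t * a / 2 - c by rewrite -(pmulr_rge0 _ h5).
have h9 : t * a <= t * na by rewrite ler_pM2l.
lra.
Qed.

Lemma ratio_ge LH eta :
  f (Rt x s) <= f x + inner x s g + 2^-1 * inner x s (s *m H) + LH / 6 * tnorm x s ^+ 3 ->
  0 < model_decrease -> LH / 6 * tnorm x s ^+ 3 <= (1 - eta) * model_decrease ->
  eta <= Defs.ratio Rt f x s.
Proof.
move=> fs dec0 He; rewrite /Defs.ratio -/model_decrease ler_pdivlMr //.
have := fs; have := He; rewrite /model_decrease model_drop.
by move: (inner x s g) (inner x s _) (LH / 6 * _) (f x) (f _) => a b c d e; lra.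
Qed.

Lemma ratio_decrease eta : 0 < model_decrease -> eta <= Defs.ratio Rt f x s ->
  f (Rt x s) <= f x - eta * model_decrease.
Proof. by move=> d0; rewrite /Defs.ratio -/model_decrease ler_pdivlMr // lerBrDr -lerBrDl. Qed.

(** With [a = <s, H s>], the linear term at [t s] is at most [- t a] and the cubic one
    at most [a t^3 / 2], whence a bound by [- a / 2] times
    [2 t - t^2 - t^3 = t (1 - t) (2 + t) >= 0]. *)
Lemma path_decrease gamma LH t : 0 < gamma ->
  (forall v, gamma * tnorm x v ^+ 2 <= inner x v (v *m H)) ->
  LH / 6 * tnorm x s <= gamma / 2 -> t \in `[0, 1] ->
  f (Rt x (t *: s)) <= f x + inner x (t *: s) g
    + 2^-1 * inner x (t *: s) ((t *: s) *m H) + LH / 6 * tnorm x (t *: s) ^+ 3 ->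
  f (Rt x (t *: s)) <= f x.
Proof.
move=> g0 Hg Ls; rewrite in_itv /= => /andP[t0 t1] /le_trans; apply.
rewrite -scalemxAl tnormZ !innerZl innerZr (ger0_norm t0).
have := directional_optimality g0 Hg; have := Hg s; have sn := tnorm_ge0 x s.
move: (inner x s g) (inner x s _) (tnorm x s) sn Ls => b a r r0 Ls ar ba.
have r2 : 0 <= r ^+ 2 by rewrite exprn_ge0.
have h1 : LH / 6 * (t * r) ^+ 3 <= gamma / 2 * r ^+ 2 * t ^+ 3.
  have -> : LH / 6 * (t * r) ^+ 3 = LH / 6 * r * (r ^+ 2 * t ^+ 3) by ring.
  by rewrite -[leRHS]mulrA; apply: ler_wpM2r => //; rewrite mulr_ge0 // exprn_ge0.
have h2 : t * b <= - (t * a) by rewrite -mulrN ler_wpM2l //; lra.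
have h3 : gamma / 2 * r ^+ 2 * t ^+ 3 <= a / 2 * t ^+ 3.
  by apply: ler_wpM2r; [rewrite exprn_ge0 | lra].
have a0 : 0 <= a by apply: le_trans ar; rewrite mulr_ge0 // ltW.
have tt : 0 <= a * (t * (1 - t) * (2 + t)).
  by rewrite !mulr_ge0 ?subr_ge0 // addr_ge0.
have E : a * (t * (1 - t) * (2 + t)) = 2 * (t * a) - t * (t * a) - a * t ^+ 3 by ring.
by rewrite E in tt; lra.
Qed.

Lemma newton_residual :
  (forall v w, inner x w (v *m H) = inner x v (w *m H)) ->
  pgrad Rt f x 0 = g -> tnorm x s < D ->
  pgrad Rt f x s - pgrad Rt f x 0 - s *m H = pgrad Rt f x s.
Proof.
by move=> Hsym -> sD; rewrite -addrA -opprD interior_stationary // subr0.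
Qed.

End TrustRegionStep.

(** * Constants of the iteration bound *)

Section Constants.
Variable R : realType.
Implicit Types (alpha beta gamma delta : R).

Lemma minl_le (y x : R) (s : seq R) : x \in y :: s -> minl y s <= x.
Proof.
rewrite inE => /predU1P[->|].
  by elim: s => [|z s IH]; rewrite /minl /= ?lexx // ge_min IH orbT.
elim: s => [//|z s IH]; rewrite inE => /predU1P[->|/IH h].
  by rewrite /minl /= ge_min lexx.
by rewrite /minl /= ge_min [X in _ || X]h orbT.
Qed.

Lemma powR_third (x : R) : 0 <= x -> (x `^ 3^-1) ^+ 3 = x.
Proof.
move=> x0; rewrite -powR_mulrn ?powR_ge0 // -powRrM mulVf ?pnatr_eq0 //.
by rewrite powRr1.
Qed.

Lemma powR_two_thirds (x : R) : 0 <= x -> (x `^ (2 / 3)) ^+ 3 = x ^+ 2.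
Proof.
move=> x0; rewrite -powR_mulrn ?powR_ge0 // -powRrM divfK ?pnatr_eq0 //.
by rewrite powR_mulrn.
Qed.

Lemma powR_four_thirds (x : R) : x `^ (4 / 3) = (x `^ (2 / 3)) ^+ 2.
Proof.
rewrite -powR_mulrn ?powR_ge0 // -powRrM; congr (_ `^ _).
by field.
Qed.

(** Lower bound for the radii at the iterates before termination. *)
Definition radius_floor (D0 cD alpha beta gamma : R) : R :=
  Num.min D0 (cD * Num.min (alpha `^ 2^-1)
    (Num.min (alpha `^ (2 / 3)) (Num.min beta gamma))).

(** Gradient norm below which, in the third region, the step is a Newton step and
    the quadratic phase begins; [Dmin] is a lower bound for the radii. *)
Definition gradient_threshold (cQ gamma delta Dmin : R) : R :=
  cQ * gamma * Num.min (Num.min 1 gamma) (Num.min (Num.min 1 delta) Dmin).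

(** The part of the guaranteed decrease per step that is independent of the
    saddle parameters; the other factor is [saddle_scale].  The entries of the
    minimum correspond to the kinds of steps: gradient steps (short or not), steps of
    length comparable to the radius, steps longer than [nuR], and Newton steps. *)
Definition decrease_rate (kappaH cD D0 nuR kappaR hLH eta1 cQ : R) : R :=
  let w := Num.min D0 cD in
  eta1 / 2 * minl w [:: kappaH^-1; w ^+ 2; nuR ^+ 2; 2 * cQ * w / (kappaR * hLH)].

Lemma cD_bounds (tau1 eta1 kappaH LH : R) : 0 < tau1 -> eta1 < 1 -> 0 < kappaH -> 0 < LH ->
  let cD := c_Delta tau1 eta1 kappaH LH in
  [/\ 0 < cD, cD <= 1, cD <= tau1 * Num.sqrt (3 * (1 - eta1) / LH),
      cD <= tau1 * (3 * (1 - eta1) / (kappaH * LH)) `^ 3^-1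
    & cD <= 3 * tau1 * ((1 - eta1) / LH)].
Proof.
move=> t0 e1 k0 L0 /=; have e0 : 0 < 1 - eta1 by rewrite subr_gt0.
rewrite /c_Delta; split; try by apply: minl_le; rewrite !inE eqxx ?orbT.
rewrite /minl /=.
have h1 : 0 < 3 * (1 - eta1) by rewrite mulr_gt0.
by rewrite !lt_min ltr01 !(mulr_gt0, powR_gt0, sqrtr_gt0, invr_gt0).
Qed.

Lemma cQ_bounds (eta1 LH nuR kappaS kappaR hLH : R) : eta1 < 1 -> 0 < LH -> 0 < nuR ->
  0 < kappaS -> 0 < kappaR -> 0 < hLH ->
  let cQ := c_Q eta1 LH nuR kappaS kappaR hLH in
  [/\ 0 < cQ, cQ <= 3 * (1 - eta1) / LH, cQ <= nuR, cQ <= 2^-1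
    & cQ <= (kappaR * hLH)^-1].
Proof.
move=> e1 L0 n0 s0 k0 h0 /=; have e0 : 0 < 1 - eta1 by rewrite subr_gt0.
rewrite /c_Q; split; try by apply: minl_le; rewrite !inE eqxx ?orbT.
rewrite /minl /=.
by rewrite !lt_min n0 !invr_gt0 s0 ltr0n !mulr_gt0 ?invr_gt0 ?mulr_gt0.
Qed.

Section RadiusFloor.
Variables (D0 cD alpha beta gamma : R).
Hypotheses (D00 : 0 < D0) (cD0 : 0 < cD) (cD1 : cD <= 1).
Hypotheses (a0 : 0 < alpha) (b0 : 0 < beta) (g0 : 0 < gamma).
Let Dmin := radius_floor D0 cD alpha beta gamma.

Lemma radius_floor_gt0 : 0 < Dmin.
Proof.
rewrite /Dmin /radius_floor lt_min D00 mulr_gt0 //.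
by rewrite !lt_min !powR_gt0 // b0.
Qed.

Lemma radius_floor_le : [/\ Dmin <= D0, Dmin <= cD * alpha `^ 2^-1,
  Dmin <= cD * alpha `^ (2 / 3), Dmin <= cD * beta & Dmin <= cD * gamma].
Proof.
by split; rewrite /Dmin /radius_floor ge_min ?lexx //; apply/orP; right;
  rewrite ler_pM2l // !ge_min ?lexx ?orbT.
Qed.

Lemma radius_floor_log (tau2 : R) : 1 < tau2 ->
  log tau2 (D0 / Dmin) <= maxl (log tau2 cD^-1)
   [:: log tau2 (D0 / (cD * alpha `^ 2^-1)); log tau2 (D0 / (cD * alpha `^ (2 / 3)));
       log tau2 (D0 / (cD * beta)); log tau2 (D0 / (cD * gamma))].
Proof.
move=> t1; have lt0 : 0 < ln tau2 by exact: ln_gt0.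
rewrite /Dmin /radius_floor /maxl /=.
have [h|h] := leP D0 _.
  rewrite divff ?gt_eqF // /log ln1 mul0r !le_max; do 4 (apply/orP; right).
  by apply: divr_ge0; [apply: ln_ge0; rewrite invf_ge1 | exact: ltW].
have [h1|h1] := leP (alpha `^ 2^-1) _; first by rewrite !le_max lexx ?orbT.
have [h2|h2] := leP (alpha `^ (2 / 3)) _; first by rewrite !le_max lexx ?orbT.
have [h3|h3] := leP beta gamma; first by rewrite !le_max lexx ?orbT.
by rewrite !le_max lexx ?orbT.
Qed.

(** A rejected step contradicts a radius below the floor: the predicted decrease
    is at least quadratic in the radius, the model error at most cubic. *)
Lemma floor_rejected_gradient (tau1 eta1 kappaH LH D : R) :
  0 < tau1 -> eta1 < 1 -> 0 < kappaH -> 0 < LH -> 0 < D ->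
  cD = c_Delta tau1 eta1 kappaH LH ->
  (1 - eta1) * (alpha / 2 * Num.min D (alpha / kappaH)) < LH / 6 * D ^+ 3 ->
  Dmin <= tau1 * D.
Proof.
move=> t0 e1 k0 L0 DD cE; have e0 : 0 < 1 - eta1 by rewrite subr_gt0.
have [_ _ c1 c2 _] := cD_bounds t0 e1 k0 L0; rewrite -cE in c1 c2.
have [_ d1 d2 _ _] := radius_floor_le.
have [h|h] := leP D (alpha / kappaH) => H.
  apply: le_trans d1 _; apply: (@le_trans _ _ (tau1 * Num.sqrt (3 * (1 - eta1) / LH) * alpha `^ 2^-1)).
    by rewrite ler_wpM2r // powR_ge0.
  rewrite -mulrA ler_pM2l // powR12_sqrt ?(ltW a0) // -sqrtrM; last first.
    by rewrite divr_ge0 ?mulr_ge0 // ltW.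
  rewrite -[leRHS]gtr0_norm // -sqrtr_sqr ler_wsqrtr // ltW //.
  rewrite mulrAC ltr_pdivrMr // -(ltr_pM2l DD).
  have -> : D * (D ^+ 2 * LH) = 6 * (LH / 6 * D ^+ 3) by field.
  have -> : D * (3 * (1 - eta1) * alpha) = 6 * ((1 - eta1) * (alpha / 2 * D)) by field.
  by rewrite ltr_pM2l.
apply: le_trans d2 _.
set P := (3 * (1 - eta1) / (kappaH * LH)) `^ 3^-1 in c2.
apply: (@le_trans _ _ (tau1 * P * alpha `^ (2 / 3))).
  by rewrite ler_wpM2r // powR_ge0.
rewrite -mulrA ler_pM2l // -(ler_pXn2r (n := 3)) ?nnegrE ?mulr_ge0 ?powR_ge0 ?(ltW DD) //.
rewrite exprMn powR_two_thirds ?(ltW a0) // powR_third; last first.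
  by rewrite divr_ge0 ?mulr_ge0 // ltW.
apply/ltW; rewrite mulrAC ltr_pdivrMr ?mulr_gt0 //.
have -> : D ^+ 3 * (kappaH * LH) = 6 * kappaH * (LH / 6 * D ^+ 3) by field.
have -> : 3 * (1 - eta1) * alpha ^+ 2 =
  6 * kappaH * ((1 - eta1) * (alpha / 2 * (alpha / kappaH))) by field; rewrite gt_eqF.
by rewrite ltr_pM2l // mulr_gt0.
Qed.

Lemma floor_rejected_curvature (c tau1 eta1 kappaH LH D r : R) :
  0 < tau1 -> eta1 < 1 -> 0 < kappaH -> 0 < LH -> 0 < r -> r <= D -> 0 < c ->
  Dmin <= cD * c -> cD = c_Delta tau1 eta1 kappaH LH ->
  (1 - eta1) * (c / 2 * r ^+ 2) < LH / 6 * r ^+ 3 ->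
  Dmin <= tau1 * D.
Proof.
move=> t0 e1 k0 L0 r0 rD c0 dc cE H; have e0 : 0 < 1 - eta1 by rewrite subr_gt0.
have [_ _ _ _ c3] := cD_bounds t0 e1 k0 L0; rewrite -cE in c3.
apply: le_trans dc _; apply: (@le_trans _ _ (tau1 * r)); last by rewrite ler_pM2l.
apply: (@le_trans _ _ (3 * tau1 * ((1 - eta1) / LH) * c)).
  by rewrite ler_wpM2r // ltW.
have -> : 3 * tau1 * ((1 - eta1) / LH) * c = tau1 * (3 * (1 - eta1) * c / LH) by field; rewrite gt_eqF.
rewrite ler_pM2l // ler_pdivrMr // ltW //.
have r2 : 0 < r ^+ 2 / 6 by rewrite divr_gt0 // exprn_gt0.
rewrite -(ltr_pM2l r2).
have -> : r ^+ 2 / 6 * (r * LH) = LH / 6 * r ^+ 3 by field.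
have -> : r ^+ 2 / 6 * (3 * (1 - eta1) * c) = (1 - eta1) * (c / 2 * r ^+ 2) by field.
by [].
Qed.

End RadiusFloor.

Section Rate.
Variables (kappaH cD D0 nuR kappaR hLH eta1 cQ alpha beta gamma delta : R).
Hypotheses (k0 : 0 < kappaH) (cD0 : 0 < cD) (cD1 : cD <= 1) (D00 : 0 < D0).
Hypotheses (n0 : 0 < nuR) (kR0 : 0 < kappaR) (h0 : 0 < hLH) (e0 : 0 < eta1) (cQ0 : 0 < cQ).
Hypotheses (a0 : 0 < alpha) (b0 : 0 < beta) (g0 : 0 < gamma) (d0 : 0 < delta).
Let rate := decrease_rate kappaH cD D0 nuR kappaR hLH eta1 cQ.
Let scale := saddle_scale alpha beta gamma delta.
(* In terms of [t = a^(2/3)] the powers of [a] in the scale become [t] and [t^2], as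
   [a^(4/3) = t^2], and the floor is at least [w * m]. *)
Let Dmin := radius_floor D0 cD alpha beta gamma.
Let w := Num.min D0 cD.
Let t := Num.min 1 alpha `^ (2 / 3).
Let a := Num.min 1 alpha.
Let b := Num.min 1 beta.
Let g := Num.min 1 gamma.
Let d := Num.min 1 delta.
Let m := Num.min t (Num.min b g).

Let w0 : 0 < w. Proof. by rewrite lt_min D00. Qed.
Let w1 : w <= 1. Proof. by rewrite ge_min cD1 orbT. Qed.
Let pa : 0 < a. Proof. by rewrite lt_min ltr01. Qed.
Let pb : 0 < b. Proof. by rewrite lt_min ltr01. Qed.
Let pg : 0 < g. Proof. by rewrite lt_min ltr01. Qed.
Let pd : 0 < d. Proof. by rewrite lt_min ltr01. Qed.
Let a1 : a <= 1. Proof. by rewrite ge_min lexx. Qed.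
Let g1 : g <= 1. Proof. by rewrite ge_min lexx. Qed.
Let t0 : 0 < t. Proof. exact: powR_gt0. Qed.
Let t1 : t <= 1.
Proof.
have h : (0 : R) <= 2 / 3 by rewrite divr_ge0.
have := ge0_ler_powR h (_ : a \in Num.nneg) (_ : 1 \in Num.nneg) a1.
by rewrite powR1; apply; rewrite nnegrE // ltW.
Qed.
Let at_ : a <= t.
Proof. by apply: ger1_powR; [rewrite pa a1 | lra]. Qed.
Let tta : t ^+ 2 <= a.
Proof. by rewrite -powR_four_thirds; apply: ge1r_powR; [rewrite pa a1 | lra]. Qed.
Let m0 : 0 < m. Proof. by rewrite lt_min t0 lt_min pb pg. Qed.

Lemma scale_le : [/\ scale <= a ^+ 2, scale <= t ^+ 2 * b, scale <= t ^+ 2 * g,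
  scale <= t * g ^+ 2 & [/\ scale <= b ^+ 3, scale <= b ^+ 2 * g, scale <= b * g ^+ 2,
  scale <= g ^+ 3 & scale <= g ^+ 2 * d]].
Proof.
by do !split; rewrite /scale /saddle_scale; apply: minl_le;
  rewrite !powR_four_thirds !inE eqxx ?orbT.
Qed.

Lemma scale_gt0 : 0 < scale.
Proof.
rewrite /scale /saddle_scale /minl /= !powR_four_thirds -/a -/b -/g -/d -/t.
by rewrite !lt_min ?mulr_gt0 ?exprn_gt0.
Qed.

Lemma scale_le1 : scale <= 1.
Proof. by have [h _ _ _ _] := scale_le; apply: le_trans h _; rewrite exprn_ile1 // ltW. Qed.

Lemma rate_gt0 : 0 < rate.
Proof.
rewrite /rate /decrease_rate /minl /= -/w mulr_gt0 ?divr_gt0 //.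
by rewrite !lt_min D00 cD0 invr_gt0 k0 !exprn_gt0 //= divr_gt0 ?mulr_gt0.
Qed.

Lemma rate_le : [/\ rate <= eta1 / 2 * w, rate <= eta1 / 2 * kappaH^-1,
  rate <= eta1 / 2 * w ^+ 2, rate <= eta1 / 2 * nuR ^+ 2
  & rate <= eta1 / 2 * (2 * cQ * w / (kappaR * hLH))].
Proof.
by split; rewrite /rate /decrease_rate -/w ler_pM2l ?divr_gt0 //; apply: minl_le;
  rewrite !inE eqxx ?orbT.
Qed.

Lemma floor_ge : w * m <= Dmin.
Proof.
rewrite /Dmin /radius_floor le_min; apply/andP; split.
  apply: (@le_trans _ _ w); last by rewrite ge_min lexx.
  by rewrite ler_piMr ?(ltW w0) // !ge_min t1.
apply: ler_pM; [exact: ltW | exact: ltW | by rewrite /w ge_min lexx orbT |].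
have ta : t <= alpha `^ (2 / 3).
  apply: ge0_ler_powR; rewrite ?nnegrE ?(ltW pa) ?(ltW a0) ?divr_ge0 //.
  by rewrite ge_min lexx orbT.
have mt : m <= t by rewrite /m ge_min lexx.
have mb : m <= beta by rewrite /m ge_min ge_min [b <= beta]ge_min lexx !orbT.
have mg : m <= gamma by rewrite /m ge_min ge_min [g <= gamma]ge_min lexx !orbT.
rewrite 3!le_min mb mg (le_trans mt ta) /= andbT; apply: (le_trans mt).
have [al|al] := leP alpha 1.
  apply: le_trans ta _; apply: ger_powR; first by rewrite a0.
  by lra.
apply: (le_trans t1).
by rewrite -[leLHS](powRr0 alpha); apply: ler_powR; [exact: ltW | rewrite invr_ge0].
Qed.

Let scale_m2 (c : R) : 0 < c -> scale <= t ^+ 2 * c -> scale <= b ^+ 2 * c ->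
  scale <= g ^+ 2 * c -> scale <= c * m ^+ 2.
Proof.
move=> c0 h1 h2 h3; rewrite mulrC /m.
by have [?|?] := leP t (Num.min b g) => //; have [?|?] := leP b g.
Qed.

Let rateM X Y : 0 <= X -> rate <= eta1 / 2 * X -> scale <= Y ->
  rate * scale <= eta1 * (X * Y / 2).
Proof.
move=> X0 rX sY; have -> : eta1 * (X * Y / 2) = eta1 / 2 * X * Y by field.
by apply: ler_pM => //; apply: ltW; [exact: rate_gt0 | exact: scale_gt0].
Qed.

Let le_a : a <= alpha. Proof. by rewrite ge_min lexx orbT. Qed.
Let le_b : b <= beta. Proof. by rewrite ge_min lexx orbT. Qed.
Let le_g : g <= gamma. Proof. by rewrite ge_min lexx orbT. Qed.

(** The radius is at least the floor, hence at least [w * m]; expanding the minimum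
    [m] leaves entries of the scale. *)
Lemma rate_gradient D : Dmin <= D ->
  rate * scale <= eta1 * (alpha / 2 * Num.min D (alpha / kappaH)).
Proof.
move=> DD; have [r1 r2 _ _ _] := rate_le.
have [s1 s2 s3 _ _] := scale_le.
have [h|h] := leP D (alpha / kappaH).
  apply: le_trans (rateM (ltW w0) r1 (_ : scale <= a * m)) _.
    rewrite /m; have [?|?] := leP t (Num.min b g).
      by apply: le_trans s1 _; rewrite expr2 ler_pM2l.
    by have [?|?] := leP b g; [apply: le_trans s2 _ | apply: le_trans s3 _]; rewrite ler_pM2r.
  rewrite ler_pM2l //; have -> : w * (a * m) / 2 = a / 2 * (w * m) by field.
  apply: ler_pM; rewrite ?divr_ge0 ?mulr_ge0 ?(ltW pa) ?(ltW w0) ?(ltW m0) //.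
    by rewrite ler_pM2r.
  exact: le_trans floor_ge DD.
apply: le_trans (rateM _ r2 s1) _; first by rewrite invr_ge0 ltW.
rewrite ler_pM2l //.
have -> : kappaH^-1 * a ^+ 2 / 2 = a / 2 * (a / kappaH) by field; rewrite gt_eqF.
apply: ler_pM; rewrite ?divr_ge0 ?(ltW pa) ?(ltW k0) //.
  by rewrite ler_pM2r.
by rewrite ler_pM2r // invr_gt0.
Qed.

Let rate_square c D : 0 < c -> scale <= c * m ^+ 2 -> Dmin <= D ->
  rate * scale <= eta1 * (c / 2 * D ^+ 2).
Proof.
move=> c0 sc DD; have [_ _ r3 _ _] := rate_le.
apply: le_trans (rateM _ r3 sc) _; first by rewrite exprn_ge0 // ltW.
rewrite ler_pM2l //; have -> : w ^+ 2 * (c * m ^+ 2) / 2 = c / 2 * (w * m) ^+ 2 by field.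
rewrite ler_pM2l ?divr_gt0 // ler_sqr ?nnegrE ?mulr_ge0 ?(ltW w0) ?(ltW m0) //.
  exact: le_trans floor_ge DD.
by apply: le_trans DD; apply/ltW/radius_floor_gt0.
Qed.

Lemma rate_curvature D : Dmin <= D -> rate * scale <= eta1 * (beta / 2 * D ^+ 2).
Proof.
move=> DD; have [_ s2 _ _ [s5 _ s7 _ _]] := scale_le.
have sc : scale <= b * m ^+ 2.
  by apply: scale_m2 => //; [rewrite -exprSr | rewrite mulrC].
apply: le_trans (rate_square pb sc DD) _.
by rewrite ler_pM2l // ler_wpM2r ?exprn_even_ge0 // ler_pM2r.
Qed.

Lemma rate_boundary D : Dmin <= D -> rate * scale <= eta1 * (gamma / 2 * D ^+ 2).
Proof.
move=> DD; have [_ _ s3 _ [_ s6 _ s8 _]] := scale_le.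
have sc : scale <= g * m ^+ 2 by apply: scale_m2 => //; rewrite -exprSr.
apply: le_trans (rate_square pg sc DD) _.
by rewrite ler_pM2l // ler_wpM2r ?exprn_even_ge0 // ler_pM2r.
Qed.

Lemma rate_long_step : rate * scale <= eta1 * (gamma / 2 * nuR ^+ 2).
Proof.
have [_ _ _ r4 _] := rate_le; have [_ _ _ _ [_ _ _ s8 _]] := scale_le.
apply: le_trans (rateM _ r4 s8) _; first by rewrite exprn_ge0 // ltW.
rewrite ler_pM2l // mulrC mulrA mulrAC ler_pM2r ?exprn_gt0 //.
rewrite mulrC ler_pM2r // ; apply: le_trans le_g.
by rewrite exprSr ler_piMl ?(ltW pg) // exprn_ile1 // ltW.
Qed.

Lemma rate_large_gradient :
  rate * scale <= eta1 * (gamma / 2 * (2 * gradient_threshold cQ gamma delta Dmin / (kappaR * hLH))).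
Proof.
have [_ _ _ _ r5] := rate_le; have [_ _ _ s4 [_ _ s7 s8 s9]] := scale_le.
have sc : scale <= g * (g * Num.min g (Num.min d m)).
  have -> : g * (g * Num.min g (Num.min d m)) = Num.min g (Num.min d m) * g ^+ 2 by ring.
  rewrite /m; have [?|?] := leP g (Num.min d (Num.min t (Num.min b g))).
    by rewrite -exprS.
  have [?|?] := leP d (Num.min t (Num.min b g)); first by rewrite mulrC.
  have [?|?] := leP t (Num.min b g) => //.
  by have [?|?] := leP b g => //; rewrite -exprS.
have X0 : 0 <= 2 * cQ * w / (kappaR * hLH).
  by rewrite divr_ge0 ?mulr_ge0 // ltW.
apply: le_trans (rateM X0 r5 sc) _; rewrite ler_pM2l // /gradient_threshold -/g -/d.
have mw : w * Num.min g (Num.min d m) <= Num.min g (Num.min d Dmin).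
  have A0 : 0 <= Num.min g (Num.min d m) by rewrite le_min (ltW pg) le_min (ltW pd) (ltW m0).
  have Ag : Num.min g (Num.min d m) <= g by rewrite ge_min lexx.
  have Ad : Num.min g (Num.min d m) <= d by rewrite ge_min [Num.min d m <= d]ge_min lexx orbT.
  have Am : Num.min g (Num.min d m) <= m by rewrite ge_min [Num.min d m <= m]ge_min lexx !orbT.
  rewrite le_min; apply/andP; split; last first.
    rewrite le_min; apply/andP; split; last by apply: le_trans floor_ge; rewrite ler_pM2l.
    by apply: le_trans Ad; rewrite ler_piMl.
  by apply: le_trans Ag; rewrite ler_piMl.
set A := Num.min g (Num.min d m) in mw *; set B := Num.min g (Num.min d Dmin) in mw *.
have A0 : 0 <= A by rewrite /A le_min (ltW pg) le_min (ltW pd) (ltW m0).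
have -> : 2 * cQ * w / (kappaR * hLH) * (g * (g * A)) / 2 =
   cQ / (kappaR * hLH) * (g * g * (w * A)) by field; rewrite !gt_eqF.
have -> : gamma / 2 * (2 * (cQ * gamma * B) / (kappaR * hLH)) =
   cQ / (kappaR * hLH) * (gamma * gamma * B) by field; rewrite !gt_eqF.
rewrite ler_pM2l ?divr_gt0 ?mulr_gt0 //.
apply: ler_pM; rewrite ?mulr_ge0 ?(ltW pg) ?(ltW w0) //.
by apply: ler_pM; rewrite ?(ltW pg).
Qed.

End Rate.
End Constants.

(** * Counting iterations *)

Section Counting.
Variable R : realType.

Definition successes (suc : nat -> bool) (k : nat) : nat := \sum_(j < k) suc j.

Lemma successesS suc k : successes suc k.+1 = (successes suc k + suc k)%N.
Proof. by rewrite /successes big_ord_recr. Qed.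

(** Each rejected step costs [ln (1 / tau1)] on the logarithm of the radius, which
    starts at [ln D0], stays above [ln Dmin], and gains at most [ln tau2] at an
    accepted step. *)
Lemma iterations_le_successes (tau1 tau2 Dmin : R) (D : nat -> R) (suc : nat -> bool) K :
  0 < tau1 < 1 -> 1 < tau2 -> 0 < Dmin -> (forall k, (k <= K)%N -> Dmin <= D k) ->
  (forall k, (k < K)%N -> D k.+1 <= (if suc k then tau2 else tau1) * D k) ->
  let l := log tau2 tau1^-1 in
  0 < l /\
  K%:R <= (1 + l) / l * (successes suc K)%:R + l^-1 * log tau2 (D 0 / Dmin).
Proof.
move=> /andP[t0 t1] t2 Dm0 HD HS l.
have lt2 : 0 < ln tau2 by exact: ln_gt0.
have lt1 : 0 < ln tau1^-1 by rewrite ln_gt0 // invf_gt1.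
have l0 : 0 < l by rewrite divr_gt0.
split=> //.
have Dp k : (k <= K)%N -> 0 < D k by move=> kK; exact: lt_le_trans (HD _ kK).
have t20 : 0 < tau2 by exact: lt_trans t2.
have pot k : (k <= K)%N -> ln (D k) <= ln (D 0) + (successes suc k)%:R * ln tau2
    - (k%:R - (successes suc k)%:R) * ln tau1^-1.
  elim: k => [|k IH] kK.
    by rewrite /successes big_ord0 !mul0r subrr mul0r addr0 subr0.
  have k1 := ltnW kK.
  have c0 : 0 < (if suc k then tau2 else tau1) by case: ifP.
  have : ln (D k.+1) <= ln ((if suc k then tau2 else tau1) * D k).
    by rewrite ler_ln ?posrE ?mulr_gt0 ?Dp //; exact: HS.
  rewrite lnM ?posrE ?Dp // => H.
  rewrite lnV ?posrE // in lt1 IH *.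
  have := IH k1; rewrite successesS natrD -natr1 => {}IH.
  move: H IH; case: (suc k) => /=; lra.
have H := pot K (leqnn K).
have H2 : ln Dmin <= ln (D K) by rewrite ler_ln ?posrE ?Dp //; exact: HD.
have D00 := Dp 0%N (leq0n K).
rewrite /log ln_div ?posrE //.
rewrite -(ler_pM2r lt1).
have -> : ((1 + l) / l * (successes suc K)%:R + l^-1 * ((ln (D 0) - ln Dmin) / ln tau2)) * ln tau1^-1
  = (successes suc K)%:R * (ln tau2 + ln tau1^-1) + (ln (D 0) - ln Dmin).
  by rewrite /l /log; field; rewrite !gt_eqF.
move: H; move: (successes suc K)%:R (K%:R) => s k; move: H2 lt1.
by move: (ln tau1^-1) (ln tau2) (ln (D 0)) (ln Dmin) (ln (D K)) => x y z u v; lra.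
Qed.

(** [Q] marks the iterations of the final, quadratically convergent, phase. Before
    it, an accepted step either decreases [F] by [d] or makes the gradient small
    for the first time since the last such decrease. *)
Lemma successes_before_phase (F : nat -> R) (d : R) (suc small Q : nat -> bool) K :
  0 < d ->
  (forall k, (k < K)%N -> ~~ suc k -> F k.+1 = F k /\ small k.+1 = small k) ->
  (forall k, (k < K)%N -> suc k -> ~~ Q k ->
     F k.+1 <= F k - d \/ [/\ ~~ small k, small k.+1 & F k.+1 <= F k]) ->
  (forall k, (k < K)%N -> Q k -> suc k /\ Q k.+1) ->
  (forall k, Q k -> small k) ->
  exists k0, [/\ (k0 <= K)%N,
    (successes suc k0)%:R <= 2 * (F 0 - F k0) / d + 1,
    (successes suc K <= successes suc k0 + (K - k0))%N
    & forall j, (k0 <= j < K)%N -> Q j].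
Proof.
move=> d0 Hf Hs HQ Qs.
have pre k : (k <= K)%N -> (forall j, (j < k)%N -> ~~ Q j) ->
    (successes suc k)%:R <= 2 * (F 0 - F k) / d + (small k : nat)%:R.
  elim: k => [|k IH] kK nQ.
    by rewrite /successes big_ord0 subrr mulr0 mul0r add0r.
  have {}IH := IH (ltnW kK) (fun j jk => nQ j (ltnW jk)).
  rewrite successesS natrD.
  have [sk|nsk] := boolP (suc k); last first.
    by have [-> ->] := Hf k kK nsk; rewrite addr0.
  have [drop|[ns s1 mono]] := Hs k kK sk (nQ k (ltnSn k)).
    have : 2 * (F 0 - F k) / d + 2 <= 2 * (F 0 - F k.+1) / d.
      rewrite -lerBrDl -mulrBl ler_pdivlMr //.
      by move: drop; move: (F k) (F k.+1) (F 0) => x y z; lra.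
    move: IH; case: (small k); case: (small k.+1); rewrite /=; lra.
  have : 2 * (F 0 - F k) / d <= 2 * (F 0 - F k.+1) / d.
    by rewrite ler_pM2r ?invr_gt0 // ler_pM2l // lerD2l lerN2.
  move: IH; rewrite s1 (negbTE ns) /=; lra.
have fin k : (k <= K)%N -> (small k : nat)%:R <= 1 :> R by case: (small k); rewrite // ler01.
have cnt k0 : (k0 <= K)%N -> (successes suc K <= successes suc k0 + (K - k0))%N.
  move=> kK; rewrite -{1}(subnKC kK); elim: (K - k0)%N => [|j IH]; first by rewrite !addn0.
  rewrite addnS successesS; apply: leq_trans (leq_add IH (leq_b1 _)) _.
  by rewrite addn1 addnS.
have [[j0 /andP[jK Qj]]|none] := pselect (exists j, (j < K)%N && Q j); last first.
  exists K; split=> //; last by move=> j /andP[Kj jK]; rewrite ltnNge Kj in jK.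
    apply: le_trans (pre K (leqnn K) _) _; last by rewrite lerD2l fin.
    by move=> j jK; apply/negP => Qj; apply: none; exists j; rewrite jK.
  exact: cnt.
have ex : exists j, (j < K)%N && Q j by exists j0; rewrite jK.
case: (ex_minnP ex) => k0 /andP[k0K Qk0] kmin; exists k0; split.
- exact: ltnW.
- apply: le_trans (pre k0 (ltnW k0K) _) _; last by rewrite lerD2l fin // ltnW.
  move=> j jk; apply/negP => Qj'; have := kmin j; rewrite Qj' (ltn_trans jk k0K) => /(_ isT).
  by rewrite leqNgt jk.
- exact/cnt/ltnW.
move=> j /andP[kj jK']; rewrite -(subnKC kj).
have : (k0 + (j - k0) < K)%N by rewrite subnKC.
elim: (j - k0)%N => [|i IH]; first by rewrite addn0.
by rewrite addnS => iK; apply: (HQ _ _ (IH _)).2; exact: ltnW.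
Qed.

Lemma quadratic_decay (y : nat -> R) (J : nat) : (forall j, 0 <= y j) -> y 0%N <= 2^-1 ->
  (forall j, (j < J)%N -> y j.+1 <= y j ^+ 2) -> y J <= 2^-1 ^+ (2 ^ J).
Proof.
move=> y0 yh; elim: J => [|J IH] H; first by rewrite expn0 expr1.
apply: le_trans (H J (ltnSn J)) _; rewrite expnSr exprM ler_sqr ?nnegrE ?exprn_ge0 ?invr_ge0 //.
by apply: IH => j jJ; apply: H; exact: ltnW.
Qed.

(** Quadratic convergence from [1 / 2] passes [1 / A] after [log2 log2 A] steps. *)
Lemma phase_length (y : nat -> R) (A : R) (J : nat) : 0 < A ->
  (forall j, 0 <= y j) -> y 0%N <= 2^-1 ->
  (forall j, (j < J)%N -> y j.+1 <= y j ^+ 2) ->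
  (forall j, (j < J)%N -> A^-1 < y j) -> J%:R <= 1 + loglog2 A.
Proof.
move=> A0 y0 yh ysq yA; have ll0 : 0 <= loglog2 A by rewrite le_max lexx.
case: J ysq yA => [|J] ysq yA; first by rewrite addr_ge0.
rewrite -natr1 addrC lerD2l.
have H : 2 ^+ (2 ^ J) < A.
  rewrite -ltf_pV2 ?posrE ?exprn_gt0 // -exprVn; apply: lt_le_trans (yA J (ltnSn J)) _.
  by apply: quadratic_decay => // j jJ; apply: ysq; exact: ltnW.
have l2 : 0 < ln 2 :> R by rewrite ln_gt0 // ltr1n.
have H1 : 2 ^+ J < log 2 A.
  rewrite /log ltr_pdivlMr //.
  have : ln (2 ^+ (2 ^ J)) < ln A by rewrite ltr_ln ?posrE ?exprn_gt0.
  by rewrite lnXn // -[ln 2 *+ _]mulr_natl natrX.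
rewrite /loglog2 le_max; apply/orP; right; rewrite {1}/log ler_pdivlMr //.
have : ln (2 ^+ J) < ln (log 2 A).
  by rewrite ltr_ln ?posrE ?exprn_gt0 //; apply: lt_trans H1; rewrite exprn_gt0.
by rewrite lnXn // -[ln 2 *+ _]mulr_natl => /ltW.
Qed.

End Counting.

(** * The trust-region run *)

Section Run.
Variables (R : realType) (n : nat) (M : riemannianManifold R n) (f : M -> R)
  (Rt : M -> 'rV[R]_n -> M) (radius : M -> \bar R) (alpha beta gamma delta : R)
  (x0 : M) (D0 Dbar eta1 eta2 tau1 tau2 : R)
  (xs : nat -> M) (ss : nat -> 'rV[R]_n) (Ds : nat -> R)
  (LH kappaH fstar hLH kappaR nuR kappaS epsg epsH : R).
Hypotheses (Cf : C2_fun f) (Rt_retr : retraction Rt radius) (Rt2 : second_order Rt).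
Hypotheses (a0 : 0 < alpha) (b0 : 0 < beta) (g0 : 0 < gamma) (d0 : 0 < delta).
Hypothesis saddle : strict_saddle f alpha beta gamma delta.
Hypotheses (D00 : 0 < D0) (D0bar : D0 < Dbar) (e10 : 0 < eta1) (e12 : eta1 < eta2)
  (e21 : eta2 < 1) (t10 : 0 < tau1) (t11 : tau1 < 1) (t21 : 1 < tau2).
Hypothesis run : rtr_run Rt f x0 D0 Dbar eta1 eta2 tau1 tau2 xs ss Ds.
Hypotheses (LH0 : 0 < LH) (cubic : pullback_cubic_bound Rt radius f LH xs Ds).
Hypotheses (kH0 : 0 < kappaH)
  (Hk : forall k, opnorm (xs k) (phess0 Rt f (xs k)) <= kappaH)
  (fs : forall x, fstar <= f x) (h0 : 0 < hLH).
Hypothesis lipH : forall k, region3 f gamma delta (xs k) ->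
  tnorm (xs k) (pgrad Rt f (xs k) (ss k) - pgrad Rt f (xs k) 0
                - ss k *m phess0 Rt f (xs k)) <= hLH / 2 * tnorm (xs k) (ss k) ^+ 2.
Hypotheses (kR1 : 1 < kappaR) (n0 : 0 < nuR) (kS0 : 0 < kappaS).
Hypothesis grad_transport : forall x s, region3 f gamma delta x -> in_ball radius x s ->
  tnorm x s <= nuR -> tnorm (Rt x s) (grad f (Rt x s)) <= kappaR * tnorm x (pgrad Rt f x s).
Hypotheses (eg0 : 0 < epsg) (eH0 : 0 < epsH).

Let cD := c_Delta tau1 eta1 kappaH LH.
Let cQ := c_Q eta1 LH nuR kappaS kappaR hLH.
(* [d] is the decrease guaranteed by the accepted steps that precede the final
   phase, in which [Q] holds: third region and gradient norm below [T]. *)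
Let Dmin := radius_floor D0 cD alpha beta gamma.
Let T := gradient_threshold cQ gamma delta Dmin.
Let d := decrease_rate kappaH cD D0 nuR kappaR hLH eta1 cQ
         * saddle_scale alpha beta gamma delta.
Let suc k := eta1 <= Defs.ratio Rt f (xs k) (ss k).
Let gn k := tnorm (xs k) (grad f (xs k)).
Let sn k := tnorm (xs k) (ss k).
Let dec k := model_decrease Rt f (xs k) (ss k).
Let nonterm k := ~ (gn k <= epsg /\ - epsH <= lambda_min (hess f (xs k))).
Let small k := gn k < T.
Let Q k := `[< region3 f gamma delta (xs k) >] && small k.

Let e11 : eta1 < 1. Proof. exact: lt_trans e21. Qed.
Let kR0 : 0 < kappaR. Proof. exact: lt_trans kR1. Qed.
Let cDb := cD_bounds t10 e11 kH0 LH0.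
Let cD0 : 0 < cD. Proof. by case: cDb. Qed.
Let cD1 : cD <= 1. Proof. by case: cDb. Qed.
Let cQb := cQ_bounds e11 LH0 n0 kS0 kR0 h0.
Let cQ0 : 0 < cQ. Proof. by case: cQb. Qed.
Let Dmin0 : 0 < Dmin. Proof. exact: radius_floor_gt0. Qed.

Let sol k : subproblem_solution Rt f (xs k) (Ds k) (ss k).
Proof. by case: run => _ _ /(_ k)[]. Qed.

Let next_x k : xs k.+1 = if suc k then Rt (xs k) (ss k) else xs k.
Proof. by case: run => _ _ /(_ k)[]. Qed.

Let next_D k : Ds k.+1 = if eta2 < Defs.ratio Rt f (xs k) (ss k)
  then Num.min (tau2 * Ds k) Dbar else if suc k then Ds k else tau1 * Ds k.
Proof. by case: run => _ _ /(_ k)[]. Qed.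

Let HE k v : inner (xs k) v (v *m phess0 Rt f (xs k)) = inner (xs k) v (v *m hess f (xs k)).
Proof. by have [_ _ /(_ Rt2)] := pullback_expansion Rt_retr (xs k) Cf. Qed.

Let Hsym k v w : inner (xs k) w (v *m phess0 Rt f (xs k))
  = inner (xs k) v (w *m phess0 Rt f (xs k)).
Proof. by apply: (@phess0_sym _ _ _ _ radius). Qed.

Let Hgrad k : pgrad Rt f (xs k) 0 = grad f (xs k).
Proof. by have [] := pullback_expansion Rt_retr (xs k) Cf. Qed.

Let Hstrong k : region3 f gamma delta (xs k) -> forall v,
  gamma * tnorm (xs k) v ^+ 2 <= inner (xs k) v (v *m phess0 Rt f (xs k)).
Proof. by move=> r3 v; rewrite HE; exact: (region3_hess Cf d0 v r3). Qed.

Let ball_step k : 0 < Ds k -> in_ball radius (xs k) (ss k).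
Proof.
move=> Dk; rewrite /in_ball; apply: le_trans (cubic.2 k); rewrite lee_fin.
exact: step_le (sol k).
Qed.

Let regions k : [\/ region1 f alpha (xs k), region2 f beta (xs k)
  | region3 f gamma delta (xs k)].
Proof.
have : [set: M] (xs k) by [].
by rewrite -saddle => -[[]|]; [exact: Or31 | exact: Or32 | exact: Or33].
Qed.

Let dec1 k : 0 < Ds k -> region1 f alpha (xs k) ->
  alpha / 2 * Num.min (Ds k) (alpha / kappaH) <= dec k.
Proof. by move=> Dk r1; exact: cauchy_decrease (sol k) _ _ _ _ _ _. Qed.

Let dec2 k : 0 < Ds k -> region2 f beta (xs k) -> beta / 2 * Ds k ^+ 2 <= dec k.
Proof. by move=> Dk r2; exact: eigen_decrease (sol k) _ _ _ _. Qed.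

Let dec3 k : 0 < Ds k -> region3 f gamma delta (xs k) -> gamma / 2 * sn k ^+ 2 <= dec k.
Proof. by move=> Dk r3; exact: strong_decrease (sol k) _ g0 (Hstrong r3). Qed.

Let nonterm3 k : nonterm k -> region3 f gamma delta (xs k) -> epsg < gn k.
Proof.
move=> nt r3; rewrite ltNge; apply/negP => ge; apply: nt; split=> //.
apply: (@le_trans _ _ 0); first by rewrite oppr_le0 ltW.
apply: (@lambda_min_ge0 _ _ _ (xs k)) => v; apply: le_trans (region3_hess Cf d0 v r3).
by rewrite mulr_ge0 ?exprn_ge0 ?tnorm_ge0 // ltW.
Qed.

(* A zero step would be interior, and the gradient would vanish. *)
Let sn_gt0 k : nonterm k -> 0 < Ds k -> region3 f gamma delta (xs k) -> 0 < sn k.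
Proof.
move=> nt Dk r3; have := tnorm_ge0 (xs k) (ss k); rewrite le_eqVlt => /predU1P[s0|//].
have := nonterm3 nt r3; suff -> : gn k = 0 by rewrite ltNge (ltW eg0).
have sD : tnorm (xs k) (ss k) < Ds k by rewrite -s0.
have := interior_stationary (sol k) (@Hsym k) sD.
by rewrite (tnorm_eq0 (esym s0)) mul0mx addr0 /gn => ->; rewrite tnorm0.
Qed.

Let dec_gt0 k : nonterm k -> 0 < Ds k -> 0 < dec k.
Proof.
move=> nt Dk; case: (regions k) => r.
- apply: lt_le_trans (dec1 Dk r); rewrite mulr_gt0 ?divr_gt0 // lt_min Dk.
  exact: divr_gt0.
- by apply: lt_le_trans (dec2 Dk r); rewrite mulr_gt0 ?divr_gt0 ?exprn_gt0.
- apply: lt_le_trans (dec3 Dk r); rewrite mulr_gt0 ?divr_gt0 ?exprn_gt0 //.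
  exact: sn_gt0.
Qed.

Let cubic_step k : 0 < Ds k -> f (Rt (xs k) (ss k)) <=
  f (xs k) + inner (xs k) (ss k) (grad f (xs k))
   + 2^-1 * inner (xs k) (ss k) (ss k *m phess0 Rt f (xs k)) + LH / 6 * sn k ^+ 3.
Proof. by move=> Dk; exact: cubic.1 (ball_step Dk). Qed.

Let success_criterion k : nonterm k -> 0 < Ds k ->
  LH / 6 * sn k ^+ 3 <= (1 - eta1) * dec k -> suc k.
Proof. by move=> nt Dk; exact: ratio_ge (cubic_step Dk) (dec_gt0 nt Dk). Qed.

Let rejected k : nonterm k -> 0 < Ds k -> ~~ suc k -> Dmin <= tau1 * Ds k.
Proof.
move=> nt Dk nsuc.
have : (1 - eta1) * dec k < LH / 6 * sn k ^+ 3.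
  by rewrite ltNge; apply: contra nsuc; exact: success_criterion.
have sD : sn k <= Ds k by exact: step_le (sol k).
have s0 : 0 <= sn k by exact: tnorm_ge0.
have e0 : 0 < 1 - eta1 by rewrite subr_gt0.
have L6 : 0 < LH / 6 by rewrite divr_gt0.
have s3 : LH / 6 * sn k ^+ 3 <= LH / 6 * Ds k ^+ 3.
  by rewrite ler_pM2l // ler_pXn2r ?nnegrE // ltW.
have [_ _ _ fb fg] := radius_floor_le D0 alpha beta gamma cD0.
case: (regions k) => r H.
- apply: (floor_rejected_gradient D0 beta gamma cD0 a0 t10 e11 kH0 LH0 Dk erefl).
  apply: le_lt_trans (lt_le_trans H s3); rewrite ler_pM2l //; exact: dec1.
- apply: (floor_rejected_curvature t10 e11 kH0 LH0 Dk (lexx _) b0 fb erefl).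
  apply: le_lt_trans (lt_le_trans H s3); rewrite ler_pM2l //; exact: dec2.
- have sp := sn_gt0 nt Dk r.
  apply: (floor_rejected_curvature t10 e11 kH0 LH0 sp sD g0 fg erefl).
  apply: le_lt_trans H; rewrite ler_pM2l //; exact: dec3.
Qed.

Let floor k : (forall j, (j < k)%N -> nonterm j) -> Dmin <= Ds k.
Proof.
have [f0 _ _ _ _] := radius_floor_le D0 alpha beta gamma cD0.
elim: k => [|k IH] nt; first by case: run => _ -> _.
have {}IH := IH (fun j jk => nt j (ltnW jk)).
have Dk : 0 < Ds k by exact: lt_le_trans IH.
rewrite next_D; case: ifP => _.
  rewrite le_min (le_trans f0 (ltW D0bar)) andbT; apply: le_trans IH _.
  by rewrite ler_peMl // ltW.
by have [//|nsuc] := boolP (suc k); exact: rejected (nt _ _) Dk nsuc.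
Qed.

Let next_D_le k : 0 < Ds k -> Ds k.+1 <= (if suc k then tau2 else tau1) * Ds k.
Proof.
move=> Dk; rewrite next_D; case: ifP => [h2|_].
  by rewrite /suc (ltW (lt_trans e12 h2)) ge_min lexx.
by case: (suc k) => //; rewrite ler_peMl // ltW.
Qed.

Let newton k : 0 < Ds k -> region3 f gamma delta (xs k) -> sn k < Ds k -> sn k <= nuR ->
  tnorm (Rt (xs k) (ss k)) (grad f (Rt (xs k) (ss k))) <= kappaR * hLH / 2 * sn k ^+ 2.
Proof.
move=> Dk r3 sD snu; apply: le_trans (grad_transport r3 (ball_step Dk) snu) _.
rewrite -!mulrA ler_pM2l // mulrA.
by have := lipH r3; rewrite (newton_residual (sol k) (@Hsym k) (Hgrad k) sD).
Qed.

Let accepted k : nonterm k -> 0 < Ds k -> suc k -> f (xs k.+1) <= f (xs k) - eta1 * dec k.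
Proof. by move=> nt Dk sk; rewrite next_x sk; exact: ratio_decrease (dec_gt0 nt Dk) sk. Qed.

Let d_gt0 : 0 < d.
Proof. by rewrite mulr_gt0 ?rate_gt0 ?scale_gt0. Qed.

(** In the third region, a step that reaches the boundary of the trust region or is
    longer than [nuR] decreases [f] enough by its length.  Otherwise the next
    gradient norm is at most a multiple of the squared step length, so that it is
    below [T] or the step is long. *)
Let progress k : nonterm k -> Dmin <= Ds k -> suc k -> ~~ Q k ->
  f (xs k.+1) <= f (xs k) - d \/
  [/\ ~~ small k, small k.+1 & f (xs k.+1) <= f (xs k)].
Proof.
move=> nt Dmk sk nQ; have Dk : 0 < Ds k by exact: lt_le_trans Dmk.
have acc := accepted nt Dk sk.
have big : d <= eta1 * dec k -> f (xs k.+1) <= f (xs k) - d.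
  by move=> dd; apply: le_trans acc _; rewrite lerD2l lerN2.
case: (regions k) => r.
- have rg : d <= eta1 * (alpha / 2 * Num.min (Ds k) (alpha / kappaH)).
    by apply: rate_gradient.
  left; apply: big; apply: le_trans rg _.
  by rewrite ler_pM2l //; exact: dec1.
- have rg : d <= eta1 * (beta / 2 * Ds k ^+ 2) by apply: rate_curvature.
  left; apply: big; apply: le_trans rg _.
  by rewrite ler_pM2l //; exact: dec2.
have d3 := dec3 Dk r.
have bigs X : d <= eta1 * (gamma / 2 * X) -> X <= sn k ^+ 2 -> f (xs k.+1) <= f (xs k) - d.
  move=> dX Xs; apply: big; apply: le_trans dX _; rewrite ler_pM2l //.
  by apply: le_trans d3; rewrite ler_pM2l ?divr_gt0.
have [Ds_le|sD] := leP (Ds k) (sn k).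
  left; apply: (bigs (Ds k ^+ 2)).
    by apply: rate_boundary.
  by rewrite ler_sqr ?nnegrE ?tnorm_ge0 // ltW.
have [snu|nus] := leP (sn k) nuR; last first.
  left; apply: (bigs (nuR ^+ 2)); first by apply: rate_long_step.
  by rewrite ler_sqr ?nnegrE ?tnorm_ge0 // ltW.
have gE : gn k.+1 = tnorm (Rt (xs k) (ss k)) (grad f (Rt (xs k) (ss k))).
  by rewrite /gn next_x sk.
have gle := newton Dk r sD snu; rewrite -gE in gle.
have [gT|gT] := leP T (gn k.+1); last first.
  right; split=> //.
    by apply: contra nQ => sm; rewrite /Q sm andbT; apply/asboolP.
  apply: le_trans acc _; rewrite gerBl mulr_ge0 ?(ltW e10) //.
  exact/ltW/dec_gt0.
left; apply: (bigs (2 * T / (kappaR * hLH))); first by apply: rate_large_gradient.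
rewrite ler_pdivrMr ?mulr_gt0 //.
have := le_trans gT gle; set X := sn k ^+ 2; set Y := kappaR * hLH; clearbody X Y T.
by move=> h; lra.
Qed.

(* In this order the bounds make the step interior, shorter than [nuR] and accepted,
   keep the path in the ball of radius [delta], and make the gradient norms
   decrease. *)
Let threshold_facts : [/\ T <= gamma * Dmin / 2, T <= gamma * nuR,
  T <= gamma * (3 * (1 - eta1) / LH * gamma), T <= gamma * delta
  & T <= gamma ^+ 2 / (kappaR * hLH)].
Proof.
have [_ c1 c2 c3 c4] := cQb; rewrite -/cQ in c1 c2 c3 c4.
rewrite /T /gradient_threshold; set m := Num.min (Num.min 1 gamma) _.
have m1 : m <= 1 by rewrite /m !ge_min lexx.
have mg : m <= gamma by rewrite /m !ge_min lexx orbT.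
have md : m <= delta by rewrite /m !ge_min lexx !orbT.
have mD : m <= Dmin by rewrite /m ge_min [Num.min (Num.min 1 delta) _ <= _]ge_min lexx !orbT.
have m0 : 0 < m by rewrite /m 2!lt_min ltr01 g0 /= 2!lt_min ltr01 d0 Dmin0.
have cg X Y : cQ <= X -> m <= Y -> cQ * gamma * m <= gamma * (X * Y).
  move=> cX mY; rewrite [cQ * gamma]mulrC -mulrA ler_pM2l //.
  by apply: ler_pM => //; exact: ltW.
split.
- by have := cg _ _ c3 mD; rewrite [2^-1 * _]mulrC mulrA.
- by have := cg _ _ c2 m1; rewrite mulr1.
- exact: cg c1 mg.
- have := cg _ _ (le_trans c3 (_ : 2^-1 <= 1)) md; rewrite mul1r; apply.
  by rewrite invf_le1 // ler1n.
- by have := cg _ _ c4 mg; rewrite [_^-1 * gamma]mulrC mulrA -expr2.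
Qed.

(** As the model is strongly convex, [gamma |s| <= |grad f|]: below the threshold the
    step is short enough to be interior and accepted, and interiority makes the
    gradient of the pullback at [s] quadratic in [s]. *)
Let phase k : nonterm k -> Dmin <= Ds k -> Q k ->
  [/\ suc k, Q k.+1 & gn k.+1 <= kappaR * hLH / (2 * gamma ^+ 2) * gn k ^+ 2].
Proof.
move=> nt Dmk /andP[/asboolP r3 sm].
have Dk : 0 < Ds k by exact: lt_le_trans Dmk.
have [T1 T2 T3 T4 T5] := threshold_facts.
have sg : gamma * sn k <= gn k by exact: step_le_gradient (sol k) _ g0 (Hstrong r3).
have sX X : T <= gamma * X -> sn k < X.
  by move=> TX; rewrite -(ltr_pM2l g0); apply: le_lt_trans sg (lt_le_trans sm TX).
have s0 : 0 <= sn k by exact: tnorm_ge0.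
have sD : sn k < Ds k.
  apply: lt_le_trans Dmk; apply: sX; apply: le_trans T1 _.
  by rewrite ler_pdivrMr // ler_pMr ?mulr_gt0 // ler1n.
have snu : sn k <= nuR by apply/ltW/sX.
have sL : sn k < 3 * (1 - eta1) / LH * gamma by exact: sX.
have e0 : 0 < 1 - eta1 by rewrite subr_gt0.
have Ls : LH / 6 * sn k <= (1 - eta1) * (gamma / 2).
  have -> : (1 - eta1) * (gamma / 2) = LH / 6 * (3 * (1 - eta1) / LH * gamma).
    by field; rewrite gt_eqF.
  by rewrite ler_pM2l ?divr_gt0 // ltW.
have sk : suc k.
  apply: success_criterion => //; apply: (@le_trans _ _ ((1 - eta1) * (gamma / 2 * sn k ^+ 2))).
    have -> : LH / 6 * sn k ^+ 3 = LH / 6 * sn k * sn k ^+ 2 by ring.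
    by rewrite [leRHS]mulrA; apply: ler_wpM2r => //; rewrite exprn_ge0.
  by rewrite ler_pM2l //; exact: dec3.
have gE : gn k.+1 = tnorm (Rt (xs k) (ss k)) (grad f (Rt (xs k) (ss k))).
  by rewrite /gn next_x sk.
have gle := newton Dk r3 sD snu; rewrite -gE in gle.
have gq : gn k.+1 <= kappaR * hLH / (2 * gamma ^+ 2) * gn k ^+ 2.
  apply: le_trans gle _.
  have -> : kappaR * hLH / 2 * sn k ^+ 2 =
     kappaR * hLH / (2 * gamma ^+ 2) * (gamma * sn k) ^+ 2 by field; rewrite gt_eqF.
  rewrite ler_pM2l ?divr_gt0 ?mulr_gt0 ?exprn_gt0 // ler_sqr ?nnegrE //.
    by rewrite mulr_ge0 // ltW.
  exact: tnorm_ge0.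
split=> //; apply/andP; split.
  apply/asboolP; rewrite next_x sk.
  have balls t : t \in `[0, 1] -> in_ball radius (xs k) (t *: ss k).
    rewrite in_itv /= => /andP[t0 t1]; apply: le_trans (ball_step Dk).
    by rewrite lee_fin tnormZ ger0_norm // ler_piMl ?tnorm_ge0.
  have := @region3_path _ _ _ f gamma delta Cf g0 d0 (xs k)
    (fun t => Rt (xs k) (t *: ss k)) r3.
  rewrite /= scale1r; apply.
  - by rewrite scale0r; case: Rt_retr.
  - exact: le_trans (ltW sm) T4.
  - move=> t /balls bt; have [cR _] := retraction_chart Rt_retr bt.
    have h : {for t, continuous (Rt (xs k) \o ( *:%R^~ (ss k) : R -> 'rV[R]_n))}.
      by apply: continuous_comp; [exact: scalel_continuous | exact: cR].
    exact: h.
  - move=> t t01; apply: (path_decrease (sol k) g0 (Hstrong r3) _ t01).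
      apply: le_trans Ls _; rewrite ler_piMl ?divr_ge0 ?(ltW g0) //.
      by rewrite gerBl ltW.
    exact: cubic.1 (balls _ t01).
have gk0 : 0 <= gn k by exact: tnorm_ge0.
rewrite /small; apply: le_lt_trans gq (le_lt_trans _ sm).
rewrite [gn k ^+ 2]expr2 mulrA ler_piMl //.
rewrite mulrC; apply: (@le_trans _ _ (gamma ^+ 2 / (kappaR * hLH) * (kappaR * hLH / (2 * gamma ^+ 2)))).
  by rewrite ler_pM2r ?divr_gt0 ?mulr_gt0 ?exprn_gt0 // (le_trans (ltW sm) T5).
have -> : gamma ^+ 2 / (kappaR * hLH) * (kappaR * hLH / (2 * gamma ^+ 2)) = 2^-1.
  by field; rewrite !gt_eqF.
by rewrite invf_le1 // ler1n.
Qed.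

Lemma successes_le K : (forall k, (k < K)%N -> nonterm k) ->
  (successes suc K)%:R <= 2 * (f x0 - fstar) / d + 2
    + loglog2 (2 * gamma ^+ 2 / (kappaR * hLH * epsg)).
Proof.
move=> nt.
have Dm k : (k <= K)%N -> Dmin <= Ds k.
  by move=> kK; apply: floor => j jk; apply: nt; exact: leq_trans kK.
have [||||k0 [k0K S0 SK QK]] := @successes_before_phase R (f \o xs) d suc small Q K d_gt0.
- by move=> k kK nsk; rewrite /= /small /gn next_x (negbTE nsk).
- by move=> k kK sk nQ; apply: progress => //; [exact: nt | exact/Dm/ltnW].
- by move=> k kK Qk; have [] := phase (nt _ kK) (Dm _ (ltnW kK)) Qk.
- by move=> k /andP[].
pose q := kappaR * hLH / (2 * gamma ^+ 2).
have q0 : 0 < q by rewrite divr_gt0 ?mulr_gt0 ?exprn_gt0.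
have len : (K - k0)%:R <= 1 + loglog2 (2 * gamma ^+ 2 / (kappaR * hLH * epsg)).
  have [KE|k0lt] := eqVneq k0 K.
    by rewrite KE subnn addr_ge0 // /loglog2 le_max lexx.
  have {}k0lt : (k0 < K)%N by rewrite ltn_neqAle k0lt.
  apply: (@phase_length _ (fun j => q * gn (k0 + j))).
  - by rewrite divr_gt0 ?mulr_gt0 ?exprn_gt0.
  - by move=> j; rewrite mulr_ge0 ?tnorm_ge0 // ltW.
  - have /andP[_ sm] : Q k0 by apply: QK; rewrite leqnn.
    have [_ _ _ _ T5] := threshold_facts.
    rewrite addn0; apply: (@le_trans _ _ (q * (gamma ^+ 2 / (kappaR * hLH)))).
      by rewrite ler_pM2l // (le_trans (ltW sm)).
    by rewrite le_eqVlt; apply/orP; left; apply/eqP; rewrite /q; field; rewrite !gt_eqF.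
  - move=> j jJ; have jK : (k0 + j < K)%N by rewrite -ltn_subRL.
    have Qj : Q (k0 + j)%N by apply: QK; rewrite leq_addr.
    have [_ _ gq] := phase (nt _ jK) (Dm _ (ltnW jK)) Qj.
    by rewrite addnS exprMn expr2 -mulrA ler_pM2l.
  - move=> j jJ; have jK : (k0 + j < K)%N by rewrite -ltn_subRL.
    have /andP[/asboolP r3 _] : Q (k0 + j)%N by apply: QK; rewrite leq_addr.
    have := nonterm3 (nt _ jK) r3; rewrite -(ltr_pM2l q0).
    by congr (_ < _); rewrite /q; field; rewrite !gt_eqF.
have SKR : (successes suc K)%:R <= (successes suc k0)%:R + (K - k0)%:R :> R.
  by rewrite -natrD ler_nat.
have drop : 2 * (f (xs 0%N) - f (xs k0)) / d <= 2 * (f x0 - fstar) / d.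
  rewrite ler_pM2r ?invr_gt0 // ler_pM2l //.
  by case: run => -> _ _; rewrite lerD2l lerN2.
move: S0 SKR len drop; rewrite /=.
move: (successes suc K)%:R (successes suc k0)%:R (K - k0)%:R => u v w.
move: (loglog2 _) (2 * _ / d) (2 * _ / d) => p r s; lra.
Qed.

Lemma run_terminates (C : R) : 0 <= C ->
  2 * (f x0 - fstar) / decrease_rate kappaH cD D0 nuR kappaR hLH eta1 cQ + 1 <= C ->
  exists k : nat,
    k%:R <= iteration_bound C alpha beta gamma delta epsg D0 tau1 tau2 kappaR hLH cD /\
    tnorm (xs k) (grad f (xs k)) <= epsg /\ - epsH <= lambda_min (hess f (xs k)).
Proof.
move=> C0 CC.
pose l := log tau2 tau1^-1.
pose ll := loglog2 (2 * gamma ^+ 2 / (kappaR * hLH * epsg)).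
pose L := maxl (log tau2 cD^-1) [:: log tau2 (D0 / (cD * alpha `^ 2^-1));
  log tau2 (D0 / (cD * alpha `^ (2 / 3))); log tau2 (D0 / (cD * beta));
  log tau2 (D0 / (cD * gamma))].
have -> : iteration_bound C alpha beta gamma delta epsg D0 tau1 tau2 kappaR hLH cD =
  (1 + l) / l * (C / saddle_scale alpha beta gamma delta + 1 + ll) + l^-1 * L by [].
set B := _ + l^-1 * L.
have t12 : 0 < tau1 < 1 by rewrite t10.
have lt2 : 0 < ln tau2 by exact: ln_gt0.
have l0 : 0 < l by rewrite divr_gt0 ?ln_gt0 ?invf_gt1.
have sc0 : 0 < saddle_scale alpha beta gamma delta by exact: scale_gt0.
have sc1 : saddle_scale alpha beta gamma delta <= 1 by exact: scale_le1.
have r0 : 0 < decrease_rate kappaH cD D0 nuR kappaR hLH eta1 cQ by exact: rate_gt0.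
have ll0 : 0 <= ll by rewrite /ll /loglog2 le_max lexx.
have logm : log tau2 (D0 / Dmin) <= L by exact: radius_floor_log.
have L0 : 0 <= L.
  have [fD _ _ _ _] := radius_floor_le D0 alpha beta gamma cD0.
  apply: le_trans logm; apply: divr_ge0; last exact: ltW.
  by apply: ln_ge0; rewrite ler_pdivlMr // mul1r.
have B0 : 0 <= B.
  rewrite /B addr_ge0 // mulr_ge0 //.
  - by rewrite divr_ge0 ?addr_ge0 // ltW.
  - by rewrite !addr_ge0 // divr_ge0 // ltW.
  - by rewrite invr_ge0 ltW.
apply: contrapT => nex; set K := (Num.truncn B).+1.
have nt k : (k < K)%N -> nonterm k.
  move=> kK [gk lk]; apply: nex; exists k; split=> //.
  by apply: le_trans (_ : (Num.truncn B)%:R <= B); [rewrite ler_nat -ltnS | case/andP: (truncn_itv B0)].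
have Dm k : (k <= K)%N -> Dmin <= Ds k.
  by move=> kK; apply: floor => j jk; apply: nt; exact: leq_trans kK.
have Dstep k : (k < K)%N -> Ds k.+1 <= (if suc k then tau2 else tau1) * Ds k.
  by move=> kK; apply: next_D_le; apply: lt_le_trans (Dm _ (ltnW kK)).
have [_] := iterations_le_successes t12 t21 Dmin0 Dm Dstep.
have -> : Ds 0%N = D0 by case: run.
have SK := successes_le nt; rewrite -/ll in SK.
have KB : B < K%:R by case/andP: (truncn_itv B0).
apply/negP; rewrite -ltNge; apply: le_lt_trans KB.
rewrite -/l /B; apply: lerD.
  have p : 0 < (1 + l) / l by rewrite divr_gt0 // addr_gt0.
  rewrite (ler_pM2l p); apply: le_trans SK _.
  rewrite lerD2r -[2 in leLHS]/(1 + 1) addrA lerD2r.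
  rewrite ler_pdivlMr // mulrDl mul1r.
  apply: le_trans CC; apply: lerD => //.
  by rewrite /d invfM mulrA divfK // gt_eqF.
by rewrite ler_pM2l ?invr_gt0.
Qed.

End Run.

Unset Implicit Arguments.

Theorem theorem3p18 (R : realType) :
  exists C : R -> R -> R -> R -> R -> R -> R -> R -> R -> R,
  (forall a1 a2 a3 a4 a5 a6 a7 a8 a9 : R, 0 < C a1 a2 a3 a4 a5 a6 a7 a8 a9) /\
  forall (n : nat) (M : riemannianManifold R n) (f : M -> R)
    (Rt : M -> 'rV[R]_n -> M) (radius : M -> \bar R)
    (alpha beta gamma delta : R)
    (x0 : M) (D0 Dbar eta1 eta2 tau1 tau2 : R)
    (xs : nat -> M) (ss : nat -> 'rV[R]_n) (Ds : nat -> R)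
    (LH kappaH fstar hLH kappaR nuR nuS kappaS epsg epsH : R),
  (0 < n)%N ->
  C2_fun f ->
  retraction Rt radius ->
  second_order Rt ->
  0 < alpha -> 0 < beta -> 0 < gamma -> 0 < delta ->
  strict_saddle f alpha beta gamma delta ->
  compact (region3 f gamma delta) ->
  0 < D0 < Dbar -> 0 < eta1 < eta2 -> eta2 < 1 -> 0 < tau1 < 1 -> 1 < tau2 ->
  rtr_run Rt f x0 D0 Dbar eta1 eta2 tau1 tau2 xs ss Ds ->
  0 < LH ->
  pullback_cubic_bound Rt radius f LH xs Ds ->
  0 < kappaH ->
  (forall k, opnorm (xs k) (phess0 Rt f (xs k)) <= kappaH) ->
  (forall x, fstar <= f x) ->
  0 < hLH ->
  (forall k, region3 f gamma delta (xs k) ->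
     tnorm (xs k) (pgrad Rt f (xs k) (ss k) - pgrad Rt f (xs k) 0
                   - ss k *m phess0 Rt f (xs k))
       <= hLH / 2 * tnorm (xs k) (ss k) ^+ 2) ->
  1 < kappaR -> 0 < nuR ->
  (forall x s, region3 f gamma delta x -> in_ball radius x s ->
     tnorm x s <= nuR ->
     tnorm (Rt x s) (grad f (Rt x s)) <= kappaR * tnorm x (pgrad Rt f x s)) ->
  0 < nuS -> 0 < kappaS ->
  (forall x s, region3 f gamma delta x -> in_ball radius x s ->
     tnorm x s <= nuS ->
     (dist x (Rt x s) <= (kappaS * tnorm x s)%:E)%E) ->
  0 < epsg -> 0 < epsH ->
  let cD := c_Delta tau1 eta1 kappaH LH in
  let cQ := c_Q eta1 LH nuR kappaS kappaR hLH in
  exists k : nat,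
    k%:R <= iteration_bound
              (C kappaH cD D0 nuR kappaR hLH eta1 cQ (f x0 - fstar))
              alpha beta gamma delta epsg D0 tau1 tau2 kappaR hLH cD /\
    tnorm (xs k) (grad f (xs k)) <= epsg /\
    - epsH <= lambda_min (hess f (xs k)).
Proof.
(* Absolute values make the constant positive for all values of the arguments. *)
exists (fun kappaH cD D0 nuR kappaR hLH eta1 cQ gap =>
  1 + 2 * `|gap| / `|decrease_rate kappaH cD D0 nuR kappaR hLH eta1 cQ|).
split; first by move=> *; rewrite ltr_pwDl // divr_ge0 // mulr_ge0.
move=> n M f Rt radius alpha beta gamma delta x0 D0 Dbar eta1 eta2 tau1 tau2
  xs ss Ds LH kappaH fstar hLH kappaR nuR nuS kappaS epsg epsH.
move=> _ Cf retr so a0 b0 g0 d0 saddle _ /andP[D00 D0bar] /andP[e10 e12] e21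
  /andP[t10 t11] t21 run LH0 cubic kH0 Hk fs h0 lipH kR1 n0 trans _ kS0 _ eg0 eH0 cD cQ.
have rate0 : 0 < decrease_rate kappaH cD D0 nuR kappaR hLH eta1 cQ.
  have e11 := lt_trans e12 e21; have kR0 := lt_trans ltr01 kR1.
  have [c0 _ _ _ _] := cD_bounds t10 e11 kH0 LH0.
  have [q0 _ _ _ _] := cQ_bounds e11 LH0 n0 kS0 kR0 h0.
  exact: rate_gt0.
apply: (run_terminates Cf retr so a0 b0 g0 d0 saddle D00 D0bar e10 e12 e21 t10 t11 t21
  run LH0 cubic kH0 Hk fs h0 lipH kR1 n0 kS0 trans eg0 eH0).
  by rewrite addr_ge0 // divr_ge0 // mulr_ge0.
rewrite addrC lerD2l !ger0_norm ?subr_ge0 ?(ltW rate0) //.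
Qed.
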